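(* Let $d\ge 1$, $N=d+1$, and let $\sigma>0$, $a>0$, $c>0$, $\alpha\in(0,1]$, $\beta\in(0,1]$, $\gamma\in(0,1]$ be constants. Let $X=\{X(x,t),(x,t)\in\mathbb{R}^d\times\mathbb{R}\}$ be a centered stationary real-valued Gaussian random field with covariance function $\mathbb{E}[X(x+y,t+s)X(y,s)]=C(x,t)$, where $$C(x,t)=\frac{\sigma^2}{(1+a|t|^{2\alpha})^{\beta N/2}}\exp\Big(-\frac{c|x|^{2\gamma}}{(1+a|t|^{2\alpha})^{\beta\gamma}}\Big).$$ Let $p\ge1$ be an integer and $\mathbf{X}=(X_1,\dots,X_p)$, where $X_1,\dots,X_p$ are independent copies of $X$. (i) If $\frac1\alpha+\frac d\gamma<p$, then for every $z\in\mathbb{R}^p$, $\mathbf{X}^{-1}(z)=\emptyset$ almost surely. (ii) Suppose $\frac1\alpha+\frac d\gamma>p$. If $0<\alpha\le\gamma\le1$, then for any $z\in\mathbb{R}^p$, with positive probability $$\dim\mathbf{X}^{-1}(z)=\begin{cases}d+1-\alpha p&\text{if }p<\frac1\alpha,\\ d+\frac\gamma\alpha-\gamma p&\text{if }p\ge\frac1\alpha;\end{cases}$$ and if $0<\gamma\le\alpha\le1$, then for any $z\in\mathbb{R}^p$, with positive probability $$\dim\mathbf{X}^{-1}(z)=\begin{cases}d+1-\gamma p&\text{if }p<\frac d\gamma,\\ \frac{d\alpha}\gamma+1-\alpha p&\text{if }p\ge\frac d\gamma.\end{cases}$$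
   Context: $\dim$ denotes Hausdorff dimension. $\mathbf{X}^{-1}(z)=\{(x,t)\in\mathbb{R}^d\times\mathbb{R}:\mathbf{X}(x,t)=z\}$ is the level set. $|\cdot|$ is the Euclidean norm. Sample functions are taken almost surely continuous. *)

(* Defs.v *)
From HB Require Import structures.
From mathcomp Require Import all_boot all_order all_algebra.
From mathcomp Require Import all_classical all_reals all_analysis.

Set Implicit Arguments.
Unset Strict Implicit.
Unset Printing Implicit Defensive.

Import Order.TTheory GRing.Theory Num.Theory.
Import numFieldNormedType.Exports.

Local Open Scope classical_set_scope.
Local Open Scope ring_scope.

(* The norm of the normed module 'rV[R]_d is the sup norm, whence this one. *)
Definition euclid_norm (R : realType) (d : nat) (x : 'rV[R]_d) : R :=
  Num.sqrt (\sum_(i < d) x ord0 i ^+ 2).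

(* R^d * R is identified with R^(d+1). *)
Definition euclid_dist (R : realType) (d : nat) (u v : 'rV[R]_d * R) : R :=
  Num.sqrt (euclid_norm (u.1 - v.1) ^+ 2 + (u.2 - v.2) ^+ 2).

Section hausdorff.
Context (R : realType) (T : Type) (dist : T -> T -> R).
Local Open Scope ereal_scope.

(* Equal to -oo on the empty set. *)
Definition ediam (U : set T) : \bar R :=
  ereal_sup [set r | exists x y, [/\ U x, U y & r = (dist x y)%:E]].

(* For s = 0 a nonempty set has weight 1 (even a singleton, since 0 `^ 0 = 1)
   and the empty set has weight 0. *)
Definition diam_pow (s : R) (U : set T) : \bar R :=
  if U == set0 then 0 else poweR (ediam U) s.

Definition hausdorff_premeasure (s delta : R) (E : set T) : \bar R :=
  ereal_inf [set \sum_(k <oo) diam_pow s (F k) | F in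
    [set F : (set T)^nat |
      E `<=` \bigcup_k F k /\ forall k, ediam (F k) <= delta%:E]].

Definition hausdorff_measure (s : R) (E : set T) : \bar R :=
  ereal_sup [set hausdorff_premeasure s delta E | delta in [set x : R | (0 < x)%R]].

(* The dimension of the empty set is 0. *)
Definition hausdorff_dim (E : set T) : \bar R :=
  ereal_inf [set s%:E | s in [set s : R | (0 <= s)%R /\ hausdorff_measure s E = 0]].

End hausdorff.

Section random_fields.
Context (R : realType).

(* [normal_prob m 0] is the uniform law on [0, 1] by convention in the library,
   so that the degenerate Gaussian law has to be treated separately. *)
Definition gaussian_law (m s : R) (B : set R) : \bar R :=
  if s == 0 then dirac m B else normal_prob m s B.

Section one_field.
Context (d : measure_display) (T : measurableType d) (P : probability T R).
Context (I : Type) (X : I -> {RV P >-> R}).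

Definition gaussian_field : Prop :=
  forall (n : nat) (u : 'I_n -> I) (b : 'I_n -> R),
    exists m s : R, forall B : set R, measurable B ->
      P [set w | B (\sum_(i < n) b i * X (u i) w)] = gaussian_law m s B.

Definition centered_field : Prop := forall u, ('E_P[X u] = 0)%E.

Definition fdd (n : nat) (u : 'I_n -> I) (B : set (n.-tuple R)) : \bar R :=
  P [set w | B [tuple X (u i) w | i < n]].

Definition field_sigma_algebra : set (set T) :=
  <<s \bigcup_u preimage_set_system [set: T] (X u) measurable >>.

End one_field.

Definition same_fdd (I : Type)
    (d1 : measure_display) (T1 : measurableType d1) (P1 : probability T1 R)
    (X1 : I -> {RV P1 >-> R})
    (d2 : measure_display) (T2 : measurableType d2) (P2 : probability T2 R)
    (X2 : I -> {RV P2 >-> R}) : Prop :=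
  forall (n : nat) (u : 'I_n -> I) (B : set (n.-tuple R)), measurable B ->
    fdd X1 u B = fdd X2 u B.

Definition stationary_field (d : measure_display) (T : measurableType d)
    (P : probability T R) (V : zmodType) (X : V -> {RV P >-> R}) : Prop :=
  forall h : V, same_fdd (fun u => X (u + h)) X.

(* Taking [E j := setT] gives the product rule for subfamilies. *)
Definition independent_fields (d : measure_display) (T : measurableType d)
    (P : probability T R) (I : Type) (p : nat)
    (X : 'I_p -> I -> {RV P >-> R}) : Prop :=
  forall E : 'I_p -> set T,
    (forall j, field_sigma_algebra (X j) (E j)) ->
    P (\bigcap_j E j) = (\prod_(j < p) P (E j))%E.

Definition independent_copies (I : Type)
    (d0 : measure_display) (T0 : measurableType d0) (P0 : probability T0 R)
    (X : I -> {RV P0 >-> R})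
    (d : measure_display) (T : measurableType d) (P : probability T R)
    (p : nat) (Xs : 'I_p -> I -> {RV P >-> R}) : Prop :=
  (forall j, same_fdd (Xs j) X) /\ independent_fields Xs.

Definition ae_continuous (d : measure_display) (T : measurableType d)
    (P : probability T R) (I : topologicalType) (X : I -> {RV P >-> R}) : Prop :=
  {ae P, forall w, continuous (fun u => X u w : R)}.

Definition vector_field (d : measure_display) (T : measurableType d)
    (P : probability T R) (I : Type) (p : nat)
    (Xs : 'I_p -> I -> {RV P >-> R}) (u : I) (w : T) : 'rV[R]_p :=
  \row_(j < p) Xs j u w.

Definition level_set (d : measure_display) (T : measurableType d)
    (P : probability T R) (I : Type) (p : nat)
    (Xs : 'I_p -> I -> {RV P >-> R}) (z : 'rV[R]_p) (w : T) : set I :=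
  [set u | vector_field Xs u w = z].

(* [A] is not assumed measurable; when it is, this says [0 < P A]. *)
Definition positive_probability (d : measure_display) (T : measurableType d)
    (P : probability T R) (A : set T) : Prop :=
  exists E : set T, [/\ measurable E, E `<=` A & (0 < P E)%E].

End random_fields.

Definition space_time_cov (R : realType) (d : nat)
    (sigma a c alpha beta gamma : R) (x : 'rV[R]_d) (t : R) : R :=
  let N := d.+1 in
  let g := 1 + a * `|t| `^ (2 * alpha) in
  sigma ^+ 2 / g `^ (beta * N%:R / 2) *
  expR (- (c * euclid_norm x `^ (2 * gamma) / g `^ (beta * gamma))).

(* Main.v *)
Require Import Defs.
From HB Require Import structures.
From mathcomp Require Import all_boot all_order all_algebra.
From mathcomp Require Import all_classical all_reals all_analysis.
From mathcomp Require Import measurable_realfun ring lra zify.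

Set Implicit Arguments.
Unset Strict Implicit.
Unset Printing Implicit Defensive.

Import Order.TTheory GRing.Theory Num.Theory.
Import numFieldNormedType.Exports.

Local Open Scope classical_set_scope.
Local Open Scope ring_scope.

(* Everything rests on two-point estimates.  The variance of X_j(u) - X_j(v) is comparable
   to rho(u,v)^2, where rho = |t - s|^alpha + sum_i |x_i - y_i|^gamma, which bounds the
   probability that X_j(u) and X_j(v) both lie within delta of z_j by a multiple of
   delta^2 / rho (integrate a product of two Fejer kernels against the Gaussian law of
   X_j(u) - X_j(v), X_j(u) + X_j(v)); independence raises this to the power p.

   Upper bounds: cut a unit cube into cells of sides r^B in space and r^A in time, with
   alpha A, gamma B >= 1, on which X oscillates by at most r^(1-) (dyadic chaining).  The
   expected number of cells meeting the level set is at most r^((p-) - A - dB), and the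
   choice of (A, B) among 1/alpha and 1/gamma gives emptiness and the dimension.

   Lower bounds: let mu_m be the normalized counting measure of the points of the grid
   of mesh 1/m at which |X - z| <= m^-min(alpha,gamma).  Its mass has expectation bounded
   below, and its s-energy expectation bounded above for s below the dimension, so with
   positive probability both bounds hold for infinitely many m.  A finite cover of the
   level set by small sets would then, by the Cauchy-Schwarz inequality on each of
   them, make the mass of mu_m too small. *)

(** * Gaussian random variables *)

(** The pair (X_j(u), X_j(v)) may be degenerate, and the hypotheses only give laws of linear
    combinations. So no joint density appears: Fejer kernels are trigonometric polynomials, whose
    expectations need only characteristic functions, and Stein's identity yields these for every
    variance, zero included. Equal variances make the difference and the sum of the two values
    uncorrelated, and as the covariance is nonnegative the sum has variance at least 2 sigma^2; only
    the difference can be small. No limit measure on the level set is constructed. The finite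
    measures mu_m are tested directly against a cover, made finite by compactness of the unit cube
    once its sets are opened up and supplemented by open sets on which X stays away from z. One
    event must serve all exponents below the dimension, so the energies for a sequence of exponents
    are bounded together, with failure probabilities summing to half of the Paley-Zygmund bound for
    the mass. In the upper bounds the longer side of a cell governs its diameter; cutting cells
    further into cubes of the shorter side pays off for some p only, hence the case distinctions. *)

Section integral_density.
Context d (T : measurableType d) (R : realType).
Variables (mu nu : {measure set T -> \bar R}) (g : T -> R).
Hypotheses (mg : measurable_fun [set: T] g) (g0 : forall x, 0 <= g x).
Hypothesis nuE : forall A, measurable A -> nu A = (\int[mu]_(x in A) (g x)%:E)%E.
Local Open Scope ereal_scope.

Import HBNNSimple.

Let integral_density_nnsfun (f : {nnsfun T >-> R}) :
  \int[nu]_x (f x)%:E = \int[mu]_x ((f x)%:E * (g x)%:E).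
Proof.
have mpre r : measurable (f @^-1` [set r]) by exact: measurable_funPTI.
under [LHS]eq_integral do rewrite fimfunE -fsumEFin//.
rewrite ge0_integral_fsum//; last 2 first.
  - by move=> r; apply/measurable_EFinP; apply: measurable_funM.
  - by move=> r z _; rewrite EFinM nnfun_muleindic_ge0.
under [RHS]eq_integral.
  move=> x _.
  rewrite fimfunE -fsumEFin// ge0_mule_fsuml; last first.
    by move=> r; rewrite EFinM nnfun_muleindic_ge0.
  over.
rewrite /= ge0_integral_fsum//; last 2 first.
  - move=> r; apply: emeasurable_funM; last exact/measurable_EFinP.
    by apply/measurable_EFinP; apply: measurable_funM.
  - move=> r x _; apply: mule_ge0; last by rewrite lee_fin.
    by rewrite EFinM nnfun_muleindic_ge0.
apply: eq_fsbigr => r _.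
have [r0|r0] := leP 0%R r; last first.
  by rewrite !integral0_eq// => x _; rewrite preimage_nnfun0// indic0 mulr0// mul0e.
under [LHS]eq_integral do rewrite EFinM.
rewrite ge0_integralZl//; last exact/measurable_EFinP/measurable_indic.
rewrite [X in _ * X = _]integral_indic// setIT nuE//.
under [RHS]eq_integral do rewrite EFinM -muleA.
rewrite ge0_integralZl//; last 2 first.
- by apply: emeasurable_funM; apply/measurable_EFinP => //; exact/measurable_indic.
- by move=> x _; rewrite mule_ge0// lee_fin.
congr (_ * _).
rewrite [LHS]integral_mkcond/=.
apply: eq_integral => x _; rewrite patchE indicE.
by case: ifPn => _; rewrite ?mul1e ?mul0e.
Qed.

Lemma ge0_integral_density (f : T -> \bar R) :
  measurable_fun [set: T] f -> (forall x, 0 <= f x) ->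
  \int[nu]_x f x = \int[mu]_x (f x * (g x)%:E).
Proof.
move=> mf f0.
pose f_ := nnsfun_approx measurableT mf.
transitivity (\int[nu]_x (lim ((f_ n x)%:E @[n --> \oo]))).
  by apply/eq_integral => z _; apply/esym/cvg_lim => //=; exact: cvg_nnsfun_approx.
rewrite monotone_convergence//; last 3 first.
  by move=> n; exact/measurable_EFinP.
  by move=> n z _; rewrite lee_fin.
  by move=> z _ a b ab; rewrite lee_fin; exact/lefP/nd_nnsfun_approx.
under eq_fun do rewrite integral_density_nnsfun.
rewrite -monotone_convergence//; last 3 first.
- by move=> n; apply: emeasurable_funM; exact/measurable_EFinP.
- by move=> n z _; rewrite mule_ge0// lee_fin.
- move=> z _ a b ab; apply: lee_wpmul2r; first by rewrite lee_fin.
  by rewrite lee_fin; exact/lefP/nd_nnsfun_approx.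
apply: eq_integral => x _; apply/cvg_lim => //.
have cf : (f_ n x)%:E @[n --> \oo] --> f x by exact: cvg_nnsfun_approx.
exact: cvgeMr.
Qed.
End integral_density.

Section normal_integral.
Context {R : realType}.
Local Notation mu := (@lebesgue_measure R).
Implicit Types (m s : R).

Lemma ge0_integral_normal_prob m s (f : R -> \bar R) :
  measurable_fun [set: R] f -> (forall x, 0 <= f x)%E ->
  (\int[normal_prob m s]_x f x = \int[mu]_x (f x * (normal_pdf m s x)%:E))%E.
Proof.
move=> mf f0; apply: ge0_integral_density => //.
- exact: measurable_normal_pdf.
- by move=> x; exact: normal_pdf_ge0.
Qed.

(** This is integration by parts on the line: the fundamental theorem on growing symmetric
    intervals, then dominated convergence by [|f|]. *)
Lemma integralT_derive0 (F f : R -> R) :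
  (forall x : R, is_derive x (1 : R) F (f x)) -> continuous f ->
  mu.-integrable [set: R] (EFin \o f) ->
  F n%:R @[n --> \oo] --> 0 -> F (- n%:R) @[n --> \oo] --> 0 ->
  (\int[mu]_x (f x)%:E = 0)%E.
Proof.
move=> dF cf intf Fy FNy.
pose f_ (n : nat) := (EFin \o f) \_ `[(- n.+1%:R : R), n.+1%:R]%classic.
have mf : measurable_fun [set: R] (EFin \o f) by exact: measurable_int intf.
have [] := @dominated_convergence _ _ _ mu setT measurableT f_ (EFin \o f)
  (abse \o (EFin \o f)).
- move=> n; apply/(measurable_restrictT _ _).1 => //.
  exact: measurable_funTS.
- exact: mf.
- apply: aeW => x _; apply: cvg_near_cst; near=> n.
  rewrite /f_ patchE ifT// inE/= in_itv/= -ler_norml.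
  apply: (@le_trans _ _ (n%:R)); last by rewrite ler_nat.
  by near: n; exact: nbhs_infty_ger.
- exact: integrable_abse.
- apply: aeW => x n _; rewrite /f_ patchE; case: ifPn => //=.
  by move=> _; rewrite lee_fin normr0.
move=> _ _.
have fnE n : (\int[mu]_x f_ n x = (F n.+1%:R - F (- n.+1%:R))%:E)%E.
  rewrite /f_ -integral_mkcond EFinB.
  apply: continuous_FTC2.
  - by rewrite gtrN// ltr0n.
  - exact: continuous_subspaceT.
  - have cF : continuous F.
      move=> x; apply: differentiable_continuous; apply/derivable1_diffP.
      exact: ex_derive.
    split.
    + by move=> x _; exact: ex_derive.
    + by apply: cvg_at_right_filter; exact: cF.
    + by apply: cvg_at_left_filter; exact: cF.
  - by move=> x _; rewrite derive1E; exact: derive_val.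
rewrite (_ : [sequence _]_n = (fun n => (F n.+1%:R - F (- n.+1%:R))%:E)); last first.
  by apply/funext => n /=; rewrite fnE.
have h : (F n.+1%:R - F (- n.+1%:R))%:E @[n --> \oo] --> (0 - 0)%:E.
  apply: cvg_EFin; first exact: nearW.
  apply: cvgB.
    by rewrite -(cvg_shiftS (fun n => F n%:R)) in Fy.
  by rewrite -(cvg_shiftS (fun n => F (- n%:R))) in FNy.
rewrite subrr in h => h'.
by rewrite -(cvg_unique _ h h').
Unshelve. all: by end_near. Qed.

Lemma is_derive_normal_pdf m s (x : R) : s != 0 ->
  is_derive x (1 : R) (normal_pdf m s) (- (x - m) / s ^+ 2 * normal_pdf m s x).
Proof.
move=> s0; rewrite normal_pdfE//.
rewrite (_ : - (x - m) / s ^+ 2 * _ = normal_peak s *: ((- (x - m) / s ^+ 2) *: normal_fun m s x)); last first.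
  by rewrite /GRing.scale/=; ring.
apply: is_deriveZ.
have h : is_derive x (1 : R) (fun y => - (y - m) ^+ 2 / (s ^+ 2 *+ 2)) (- (x - m) / s ^+ 2).
  rewrite (_ : (fun y => _) = (fun y => (- (s ^+ 2 *+ 2)^-1) *: (y - m) ^+ 2)); last first.
    by apply/funext => y; rewrite /GRing.scale/= mulNr mulrC mulNr.
  apply: is_derive_eq.
  rewrite /GRing.scale/=.
  by rewrite -mulr_natr; field.
have := is_derive1_comp (is_derive_expR _) h.
by rewrite mulrC.
Qed.

(** With [u = (x - m)^2 / (4 s^2)] the density at [x] is a constant times [exp (- 2 u)], and
    [u exp (- u) <= 1] turns the quadratic factor into a constant at the price of replacing [s] by
    [sqrt 2 * s]. *)
Lemma integrable_normal_growth m s (f : R -> R) (A : R) : s != 0 ->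
  measurable_fun [set: R] f -> (forall x, `|f x| <= A + A * (x - m) ^+ 2) ->
  mu.-integrable [set: R] (fun x => (f x * normal_pdf m s x)%:E).
Proof.
move=> s0 mf fA.
have A0 : 0 <= A by have := fA m; rewrite subrr expr0n mulr0 addr0; exact: le_trans.
pose s' := Num.sqrt 2 * s.
have s'0 : s' != 0 by rewrite mulf_neq0// sqrtr_eq0 -ltNge.
apply: (@le_integrable _ _ _ mu _ measurableT _
  (fun x => (A * normal_pdf m s x + 4 * s ^+ 2 * A * normal_peak s / normal_peak s' * normal_pdf m s' x)%:E)).
- by apply/measurable_EFinP; apply: measurable_funM => //; exact: measurable_normal_pdf.
- move=> x _; rewrite /= lee_fin.
  rewrite [leRHS]ger0_norm; last first.
    move: (s ^+ 2) (sqr_ge0 s) => t t0.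
    by apply: addr_ge0; repeat apply: mulr_ge0; rewrite ?normal_pdf_ge0 ?invr_ge0 ?normal_peak_ge0.
  rewrite normrM [X in _ * X]ger0_norm ?normal_pdf_ge0//.
  apply: (le_trans (ler_wpM2r (normal_pdf_ge0 _ _ _) (fA x))).
  rewrite mulrDl lerD2l normal_pdfE// normal_pdfE//.
  have p'0 : normal_peak s' != 0 by rewrite gt_eqF// normal_peak_gt0.
  rewrite [leRHS](_ : _ = A * normal_peak s * (4 * s ^+ 2 * normal_fun m s' x)); last by field.
  rewrite [leLHS](_ : _ = A * normal_peak s * ((x - m) ^+ 2 * normal_fun m s x)); last by ring.
  rewrite ler_wpM2l ?mulr_ge0 ?normal_peak_ge0// /normal_fun.
  set u := (x - m) ^+ 2 / (4 * s ^+ 2).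
  have s2 : 0 < s ^+ 2 by rewrite exprn_even_gt0.
  rewrite (_ : - (x - m) ^+ 2 / (s ^+ 2 *+ 2) = - u + - u); last by rewrite /u; field.
  rewrite (_ : - (x - m) ^+ 2 / (s' ^+ 2 *+ 2) = - u); last first.
    rewrite /u /s' exprMn sqr_sqrtr//; field.
    by rewrite s0.
  rewrite expRD mulrA ler_wpM2r ?expR_ge0//.
  rewrite (_ : (x - m) ^+ 2 = 4 * s ^+ 2 * u); last by rewrite /u; field.
  have t4 : 0 <= 4 * s ^+ 2 by rewrite mulr_ge0// ltW.
  move: (4 * s ^+ 2) t4 u => t t4 u; rewrite -mulrA ler_piMr// expRN.
  rewrite ler_pdivrMr ?expR_gt0// mul1r.
  by apply: le_trans (expR_ge1Dx u); rewrite lerDr.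
- under eq_fun do rewrite EFinD !EFinM.
  by apply: integrableD => //; apply: integrableZl => //; exact: integrable_normal_pdf.
Qed.

End normal_integral.

Section normal_stein.
Context {R : realType}.
Local Notation mu := (@lebesgue_measure R).

(* The Gaussian density decays faster than any affine function grows, so the
   boundary terms of the integration by parts vanish. *)
Lemma normal_pdf_mul_cvg0 (m s : R) (h : R -> R) (A : R) (x : R^nat) : s != 0 ->
  (forall y, `|h y| <= A + A * `|y - m|) ->
  (`|x n - m| @[n --> \oo] --> +oo) ->
  h (x n) * normal_pdf m s (x n) @[n --> \oo] --> 0.
Proof.
move=> s0 hA xy.
have A0 : 0 <= A by have := hA m; rewrite subrr normr0 mulr0 addr0; exact: le_trans.
have p0 := normal_peak_ge0 s.
have s2 : 0 < s ^+ 2 by rewrite exprn_even_gt0.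
have xge : \forall n \near \oo, 1 <= `|x n - m| by move/cvgryPge : xy; exact.
have cV : (`|x n - m|)^-1 @[n --> \oo] --> 0.
  apply/gtr0_cvgV0 => //; near=> n.
  have : 1 <= `|x n - m| by near: n.
  exact: lt_le_trans.
have : (2 * s ^+ 2 * (2 * A) * normal_peak s) * (`|x n - m|)^-1 @[n --> \oo] --> 0.
  by rewrite -[X in _ --> X](mulr0 (2 * s ^+ 2 * (2 * A) * normal_peak s)); apply: cvgMr.
move=> cu; apply: norm_cvg0; apply: (squeeze_cvgr _ (cvg_cst 0) cu).
near=> n; rewrite normr_ge0/=.
have x1 : 1 <= `|x n - m| by near: n.
have x0 : 0 < `|x n - m| by exact: lt_le_trans x1.
rewrite normrM [X in _ * X]ger0_norm ?normal_pdf_ge0// normal_pdfE//.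
apply: (le_trans (ler_wpM2r _ (hA _))).
  by rewrite mulr_ge0// normal_fun_ge0.
have -> : normal_fun m s (x n) = expR (- (`|x n - m| ^+ 2 / (2 * s ^+ 2))).
  by rewrite /normal_fun real_normK ?num_real// -mulr_natl mulNr.
move: (`|x n - m| : R) x0 x1 => y x0 x1.
set u := y ^+ 2 / (2 * s ^+ 2).
have u0 : 0 < u by apply: divr_gt0; [exact: exprn_gt0|exact: mulr_gt0].
have eu : expR (- u) <= u^-1.
  rewrite expRN lef_pV2 ?posrE ?expR_gt0//.
  by apply: le_trans (expR_ge1Dx u); rewrite lerDr.
apply: (@le_trans _ _ ((A * y + A * y) * (normal_peak s * u^-1))).
  apply: ler_pM => //.
  - by rewrite addr_ge0// mulr_ge0// ltW.
  - by rewrite mulr_ge0// expR_ge0.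
  - by rewrite lerD2r ler_peMr.
  - by rewrite ler_wpM2l.
rewrite le_eqVlt; apply/orP; left; apply/eqP; rewrite /u; field.
by rewrite s0 gt_eqF.
Unshelve. all: by end_near. Qed.

(** Stein's identity: the density solves [phi' = - (x - m) / s^2 * phi], so the difference of the
    two integrands is the derivative of [s^2 h phi], whose integral vanishes. The growth bounds make
    both integrands integrable and kill the boundary terms. *)
Lemma normal_stein (m s : R) (h h' : R -> R) (A : R) : s != 0 ->
  (forall x : R, is_derive x (1 : R) h (h' x)) -> continuous h' ->
  (forall x, `|h x| <= A + A * `|x - m|) -> (forall x, `|h' x| <= A) ->
  (\int[mu]_x ((x - m) * h x * normal_pdf m s x) =
   s ^+ 2 * \int[mu]_x (h' x * normal_pdf m s x))%R.
Proof.
move=> s0 dh ch' hA h'A.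
have A0 : 0 <= A by exact: le_trans (h'A 0).
have ch : continuous h.
  move=> x; apply: differentiable_continuous; apply/derivable1_diffP.
  exact: ex_derive.
have mh : measurable_fun [set: R] h by exact: continuous_measurable_fun.
have mh' : measurable_fun [set: R] h' by exact: continuous_measurable_fun.
have i1 : mu.-integrable [set: R] (EFin \o (fun x => (x - m) * h x * normal_pdf m s x)).
  apply: (@integrable_normal_growth _ _ _ _ (2 * A)) => //.
    by apply: measurable_funM => //; exact: measurable_funB.
  move=> x; rewrite normrM.
  apply: (le_trans (ler_wpM2l (normr_ge0 _) (hA x))).
  rewrite -[in leRHS](@real_normK _ (x - m)) ?num_real//.
  move: (`|x - m| : R) => y.
  rewrite -subr_ge0 (_ : _ - _ = A * ((y - 2^-1) ^+ 2 + 7 / 4)); last by field.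
  by rewrite mulr_ge0// addr_ge0// sqr_ge0.
have i2 : mu.-integrable [set: R] (EFin \o (fun x => h' x * normal_pdf m s x)).
  apply: (@integrable_normal_growth _ _ _ _ A) => // x.
  by apply: le_trans (h'A x) _; rewrite lerDl mulr_ge0// sqr_ge0.
have i2' : mu.-integrable [set: R] (EFin \o (fun x => s ^+ 2 * (h' x * normal_pdf m s x))).
  rewrite (_ : _ \o _ = fun x => ((s ^+ 2)%:E * (h' x * normal_pdf m s x)%:E)%E)//.
  exact: integrableZl.
apply/eqP; rewrite eq_sym -subr_eq0 -RintegralZl// -RintegralB//; apply/eqP.
suff H : (\int[mu]_x (s ^+ 2 * (h' x * normal_pdf m s x) -
    (x - m) * h x * normal_pdf m s x)%:E = 0)%E by rewrite /Rintegral H.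
apply: (@integralT_derive0 _ (fun x => s ^+ 2 *: (h x * normal_pdf m s x))
  (fun x => s ^+ 2 * (h' x * normal_pdf m s x) - (x - m) * h x * normal_pdf m s x)).
- move=> x.
  have dp := is_derive_normal_pdf m x s0.
  apply: is_derive_eq.
  rewrite /GRing.scale/=; field.
  by [].
- move=> x; apply: cvgB.
    by apply: cvgMr; apply: cvgM; [exact: ch'|exact: continuous_normal_pdf].
  apply: cvgM; last exact: continuous_normal_pdf.
  by apply: cvgM; [apply: cvgB; [exact: cvg_id|exact: cvg_cst]|exact: ch].
- rewrite (_ : _ \o _ = (fun x => (s ^+ 2 * (h' x * normal_pdf m s x))%:E - ((x - m) * h x * normal_pdf m s x)%:E)%E)//.
  exact: integrableB.
- rewrite -[X in _ --> X](scaler0 _ (s ^+ 2)); apply: cvgZr.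
  apply: (@normal_pdf_mul_cvg0 _ _ _ A (fun n => n%:R)) => //.
  apply/cvgryPge => B; near=> n.
  apply: (@le_trans _ _ (n%:R - m)); last exact: ler_norm.
  by rewrite lerBrDr; near: n; exact: nbhs_infty_ger.
- rewrite -[X in _ --> X](scaler0 _ (s ^+ 2)); apply: cvgZr.
  apply: (@normal_pdf_mul_cvg0 _ _ _ A (fun n => - n%:R)) => //.
  apply/cvgryPge => B; near=> n.
  rewrite -opprD normrN; apply: (@le_trans _ _ (n%:R + m)); last exact: ler_norm.
  by rewrite -lerBlDr; near: n; exact: nbhs_infty_ger.
Unshelve. all: by end_near. Qed.

End normal_stein.

Section gaussian_variable.
Context d (T : measurableType d) (R : realType) (P : probability T R).
Local Notation mu := (@lebesgue_measure R).
Variables (Y : T -> R) (m s : R).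
Hypothesis mY : measurable_fun [set: T] Y.
Let mY_mixin := isMeasurableFun.Build _ _ T (measurableTypeR R) Y mY.
Let RVY : {mfun T >-> measurableTypeR R} := HB.pack Y mY_mixin.
Hypothesis lawY : forall B : set R, measurable B ->
  P [set w | B (Y w)] = gaussian_law m s B.

Lemma ge0_expectation_normal (f : R -> \bar R) : s != 0 ->
  measurable_fun [set: R] f -> (forall x, 0 <= f x)%E ->
  (\int[P]_w f (Y w) = \int[mu]_x (f x * (normal_pdf m s x)%:E))%E.
Proof.
move=> s0 mf f0.
rewrite -(ge0_integral_normal_prob _ _ mf)//.
rewrite -(ge0_integral_distribution RVY)//.
apply: (eq_measure_integral (normal_prob m s)) => A mA _; have := lawY mA.
by rewrite /gaussian_law (negbTE s0).
Qed.

Lemma ge0_expectation_dirac (f : R -> \bar R) : s = 0 ->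
  measurable_fun [set: R] f -> (forall x, 0 <= f x)%E ->
  (\int[P]_w f (Y w) = f m)%E.
Proof.
move=> s0 mf f0.
rewrite -(ge0_integral_distribution RVY)//.
transitivity (\int[\d_(m : measurableTypeR R)]_x f x)%E.
  apply: (eq_measure_integral (\d_(m : measurableTypeR R))) => A mA _; have := lawY mA.
  by rewrite /gaussian_law s0 eqxx.
by rewrite integral_dirac// diracT mul1e.
Qed.

Lemma gaussian_integrable (f : R -> R) (A : R) :
  measurable_fun [set: R] f -> (forall x, `|f x| <= A + A * (x - m) ^+ 2) ->
  P.-integrable [set: T] (fun w => (f (Y w))%:E).
Proof.
move=> mf fA; apply/integrableP; split.
  by apply/measurable_EFinP; exact: measurableT_comp.
have mf' : measurable_fun [set: R] (fun x => (`|f x|)%:E).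
  by apply/measurable_EFinP; exact: measurableT_comp.
have [s0|s0] := eqVneq s 0.
  by rewrite (ge0_expectation_dirac (f := fun x => (`|f x|)%:E) s0)// ltry.
rewrite (ge0_expectation_normal (f := fun x => (`|f x|)%:E) s0)//.
have /integrableP[_] := integrable_normal_growth s0 mf fA.
apply: le_lt_trans.
under [leRHS]eq_integral do rewrite /= normrM [X in _ * X]ger0_norm ?normal_pdf_ge0//.
by [].
Qed.

Lemma Rexpectation_normal (f : R -> R) (A : R) : s != 0 ->
  measurable_fun [set: R] f -> (forall x, `|f x| <= A + A * (x - m) ^+ 2) ->
  \int[P]_w f (Y w) = \int[mu]_x (f x * normal_pdf m s x).
Proof.
move=> s0 mf fA; rewrite /Rintegral; congr fine.
rewrite [LHS]integralE [RHS]integralE.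
have h1 := @ge0_expectation_normal (fun x => ((EFin \o f)^\+ x)%E) s0.
have h2 := @ge0_expectation_normal (fun x => ((EFin \o f)^\- x)%E) s0.
rewrite (_ : (fun w => (f (Y w))%:E)^\+%E = (fun w => ((EFin \o f)^\+ (Y w)))%E); last by apply/funext => w; rewrite !funeposE.
rewrite (_ : (fun w => (f (Y w))%:E)^\-%E = (fun w => ((EFin \o f)^\- (Y w)))%E); last by apply/funext => w; rewrite !funenegE.
have mf' : measurable_fun [set: R] (EFin \o f) by exact/measurable_EFinP.
rewrite h1//; last exact: measurable_funepos.
rewrite h2//; last exact: measurable_funeneg.
congr (_ - _)%E; apply: eq_integral => x _; rewrite ?funeposE ?funenegE /= -?EFin_max -EFinM; congr EFin.
  by rewrite maxr_pMl ?normal_pdf_ge0// mul0r.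
by rewrite maxr_pMl ?normal_pdf_ge0// mul0r mulNr.
Qed.

Lemma Rexpectation_dirac (f : R -> R) : s = 0 ->
  measurable_fun [set: R] f -> \int[P]_w f (Y w) = f m.
Proof.
move=> s0 mf; rewrite /Rintegral [X in fine X]integralE.
have h1 := @ge0_expectation_dirac (fun x => ((EFin \o f)^\+ x)%E) s0.
have h2 := @ge0_expectation_dirac (fun x => ((EFin \o f)^\- x)%E) s0.
rewrite (_ : (fun w => (f (Y w))%:E)^\+%E = (fun w => ((EFin \o f)^\+ (Y w)))%E); last by apply/funext => w; rewrite !funeposE.
rewrite (_ : (fun w => (f (Y w))%:E)^\-%E = (fun w => ((EFin \o f)^\- (Y w)))%E); last by apply/funext => w; rewrite !funenegE.
have mf' : measurable_fun [set: R] (EFin \o f) by exact/measurable_EFinP.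
rewrite h1//; last exact: measurable_funepos.
rewrite h2//; last exact: measurable_funeneg.
by have /(congr1 (fun g => fine (g m))) := funeposneg (EFin \o f).
Qed.

(** For [s = 0] the variable equals [m] almost surely and both sides vanish, so degenerate and
    nondegenerate laws can be treated alike from here on. *)
Lemma gaussian_stein (h h' : R -> R) (A : R) :
  (forall x : R, is_derive x (1 : R) h (h' x)) -> continuous h' ->
  (forall x, `|h x| <= A + A * `|x - m|) -> (forall x, `|h' x| <= A) ->
  \int[P]_w ((Y w - m) * h (Y w)) = s ^+ 2 * \int[P]_w (h' (Y w)).
Proof.
move=> dh ch' hA h'A.
have A0 : 0 <= A by exact: le_trans (h'A 0).
have ch : continuous h.
  move=> x; apply: differentiable_continuous; apply/derivable1_diffP.
  exact: ex_derive.
have mh : measurable_fun [set: R] h by exact: continuous_measurable_fun.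
have mh' : measurable_fun [set: R] h' by exact: continuous_measurable_fun.
have mg : measurable_fun [set: R] (fun x => (x - m) * h x).
  by apply: measurable_funM => //; exact: measurable_funB.
have [s0|s0] := eqVneq s 0.
  rewrite s0 expr0n mul0r.
  by rewrite (Rexpectation_dirac (f := fun x => (x - m) * h x))// subrr mul0r.
rewrite (Rexpectation_normal (f := h') (A := A))//; last first.
  by move=> x; apply: le_trans (h'A x) _; rewrite lerDl mulr_ge0// sqr_ge0.
rewrite (Rexpectation_normal (f := fun x => (x - m) * h x) (A := 2 * A))//.
  exact: (normal_stein s0 dh ch' hA h'A).
move=> x; rewrite normrM.
apply: (le_trans (ler_wpM2l (normr_ge0 _) (hA x))).
rewrite -[in leRHS](@real_normK _ (x - m)) ?num_real//.
move: (`|x - m| : R) => y.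
rewrite -subr_ge0 (_ : _ - _ = A * ((y - 2^-1) ^+ 2 + 7 / 4)); last by field.
by rewrite mulr_ge0// addr_ge0// sqr_ge0.
Qed.

End gaussian_variable.

Section centered_gaussian_variable.
Context d (T : measurableType d) (R : realType) (P : probability T R).
Local Notation mu := (@lebesgue_measure R).
Variables (Y : T -> R) (m s : R).
Hypothesis mY : measurable_fun [set: T] Y.
Hypothesis lawY : forall B : set R, measurable B ->
  P [set w | B (Y w)] = gaussian_law m s B.

Lemma gaussian_integrable_id : P.-integrable [set: T] (EFin \o Y).
Proof.
apply: (gaussian_integrable mY lawY (f := id) (A := 1 + `|m|)) => // x.
have : `|x| <= `|x - m| + `|m| by rewrite -{1}(subrK m x); exact: ler_normD.
rewrite -[X in _ + _ * X]real_normK ?num_real//.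
move: (`|x - m| : R) (`|m| : R) (normr_ge0 m) => y M M0 xy.
have My : 0 <= M * y ^+ 2 by rewrite mulr_ge0// sqr_ge0.
by apply: (le_trans xy); have := sqr_ge0 (y - 2^-1); nra.
Qed.

(** Stein's identity with [h = 1]; the second moment comes from [h x = x - m]. Together they
    identify the parameters of [gaussian_law], which [gaussian_field] leaves existential. *)
Lemma gaussian_mean : \int[P]_w Y w = m.
Proof.
have := @gaussian_stein _ _ _ _ _ _ _ mY lawY (cst 1) (cst 0) 1.
rewrite (_ : (fun w => (Y w - m) * cst 1 (Y w)) = (fun w => Y w - m)); last first.
  by apply/funext => w /=; rewrite mulr1.
rewrite Rintegral_cst//= mul0r mulr0 RintegralB//; last 2 first.
- exact: gaussian_integrable_id.
- exact: finite_measure_integrable_cst.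
rewrite Rintegral_cst//= probability_setT mulr1 => h.
apply/eqP; rewrite -subr_eq0; apply/eqP/h.
- by move=> x; exact: cst_continuous.
- by move=> x; rewrite normr1 lerDl.
- by move=> x; rewrite normr0.
Qed.

Lemma gaussian_second_moment : \int[P]_w ((Y w - m) ^+ 2) = s ^+ 2.
Proof.
have := @gaussian_stein _ _ _ _ _ _ _ mY lawY (fun x => x - m) (cst 1) 1.
rewrite Rintegral_cst//= probability_setT !mulr1; apply.
- by move=> x; apply: is_derive_eq; rewrite subr0.
- by move=> x; exact: cst_continuous.
- by move=> x; rewrite mul1r lerDr.
- by move=> x; rewrite normr1.
Qed.

Lemma gaussian_integrable_sqr : P.-integrable [set: T] (fun w => (Y w ^+ 2)%:E).
Proof.
apply: (gaussian_integrable mY lawY (f := fun x => x ^+ 2) (A := 2 + 2 * m ^+ 2)) => // x.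
rewrite ger0_norm ?sqr_ge0//.
by have := sqr_ge0 (x - m - m); have := mulr_ge0 (sqr_ge0 m) (sqr_ge0 (x - m)); nra.
Qed.

Hypothesis m0 : m = 0.

(* Differentiating in t and applying Stein's identity to x |-> sin (t x + b)
   yields the differential equation f' = - s^2 t f. *)
Lemma gaussian_expectation_cos (t b : R) :
  \int[P]_w cos (t * Y w + b) = cos b * expR (- (t ^+ 2 * s ^+ 2 / 2)).
Proof.
pose f (t : R) (w : T) := cos (t * Y w + b).
pose F t := \int[P]_w f t w.
have mcos u : measurable_fun [set: T] (fun w => cos (u * Y w + b)).
  apply: (@measurableT_comp _ _ _ _ _ _ (cos : R -> R)).
    by apply: continuous_measurable_fun; exact: continuous_cos.
  by apply: measurable_funD => //; exact: measurable_funM.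
have fi u : P.-integrable [set: T] (EFin \o f u).
  apply: (@le_integrable _ _ _ P _ measurableT _ (cst 1%E)) => //.
  - exact/measurable_EFinP/mcos.
  - by move=> w _; rewrite /= lee_fin normr1 ler_norml cos_geN1 cos_le1.
  - exact: finite_measure_integrable_cst.
have dfE u w : is_derive u (1 : R) (f ^~ w) (- (Y w * sin (u * Y w + b))).
  have h : is_derive u (1 : R) (fun t => t * Y w + b) (Y w).
    by apply: is_derive_eq; rewrite addr0 /GRing.scale/= mulr1 mulr0 add0r.
  have := is_derive1_comp (is_derive_cos _) h.
  by rewrite mulNr mulrC.
have dF u : is_derive u (1 : R) F (- (s ^+ 2 * u * F u)).
  have dfu v w : (partial1of2 f) v w = - (Y w * sin (v * Y w + b)).
    by rewrite /partial1of2 derive1E; apply: derive_val.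
  have i1 : u \in `]u - 1, u + 1[.
    by rewrite in_itv/= gtrBl ltr01 ltrDl ltr01.
  have intG : P.-integrable [set: T] (EFin \o (fun w => `|Y w|)).
    exact: integrable_abse gaussian_integrable_id.
  have Gub (v : R) w : `]u - 1, u + 1[%classic v -> [set: T] w ->
      `|partial1of2 f v w| <= `|Y w|.
    move=> _ _; rewrite dfu normrN normrM ler_piMr//.
    by rewrite ler_norml sin_geN1 sin_le1.
  have der (v : R) w : `]u - 1, u + 1[%classic v -> [set: T] w -> derivable (f ^~ w) v 1.
    by move=> _ _; exact: ex_derive.
  have fi' (v : R) : `]u - 1, u + 1[%classic v -> P.-integrable [set: T] (EFin \o f v).
    by move=> _; exact: fi.
  have D := @derivable_under_integral _ _ _ P f setT measurableT _ _ _ i1 fi' der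
     (fun w => `|Y w|) (fun _ => normr_ge0 _) intG Gub.
  have E := @differentiation_under_integral _ _ _ P f setT measurableT _ _ _ i1 fi' der
     (fun w => `|Y w|) (fun _ => normr_ge0 _) intG Gub.
  apply: DeriveDef => //; rewrite -derive1E E.
  under eq_Rintegral do rewrite dfu.
  have St := @gaussian_stein _ _ _ _ _ _ _ mY lawY (fun x => - sin (u * x + b))
    (fun x => - (u * cos (u * x + b))) (1 + `|u|).
  transitivity (\int[P]_w ((Y w - m) * - sin (u * Y w + b))).
    by apply: eq_Rintegral => w _; rewrite m0 subr0 mulrN.
  transitivity (s ^+ 2 * \int[P]_w - (u * cos (u * Y w + b))).
    apply: St.
  - move=> x.
    have h : is_derive x (1 : R) (fun t => u * t + b) u.
      by apply: is_derive_eq; rewrite addr0 /GRing.scale/= mulr1.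
    have h2 := is_derive1_comp (is_derive_sin _) h.
    by rewrite mulrC; apply: is_deriveN.
  - move=> x; apply: cvgN; apply: cvgM; first exact: cvg_cst.
    apply: continuous_comp; last exact: continuous_cos.
    by apply: cvgD; [apply: cvgM; [exact: cvg_cst|exact: cvg_id]|exact: cvg_cst].
  - move=> x; rewrite normrN; apply: (@le_trans _ _ 1).
      by rewrite ler_norml sin_geN1 sin_le1.
    by rewrite -addrA lerDl addr_ge0// mulr_ge0// addr_ge0.
  - move=> x; rewrite normrN normrM.
    apply: (@le_trans _ _ `|u|); last by rewrite lerDr.
    by rewrite ler_piMr// ler_norml cos_geN1 cos_le1.
  under eq_Rintegral do rewrite -mulNr.
  rewrite RintegralZl//; last exact: fi.
  by rewrite mulrA mulrN mulNr.
(* Integrating factor: with [F' = - s^2 u F] the product [F E] is constant, and its value at 0 is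
   [cos b]. *)
pose E (u : R) := expR (u ^+ 2 * s ^+ 2 / 2).
have dE u : is_derive u (1 : R) E (u * s ^+ 2 * E u).
  have h : is_derive u (1 : R) (fun u => u ^+ 2 * s ^+ 2 / 2) (u * s ^+ 2).
    rewrite (_ : (fun _ => _) = (fun u => (s ^+ 2 / 2) *: u ^+ 2)); last first.
      by apply/funext => v; rewrite /GRing.scale/=; ring.
    by apply: is_derive_eq; rewrite /GRing.scale/=; field.
  by have := is_derive1_comp (is_derive_expR _) h; rewrite mulrC.
have dG (u : R) : is_derive u (1 : R) (fun u => F u * E u) 0.
  have := @is_deriveM _ _ F E u 1 _ _ (dF u) (dE u).
  by rewrite /GRing.scale/= (_ : _ + _ = 0)//; ring.
have := @is_derive_0_is_cst _ (fun u : R => F u * E u) t 0 dG.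
rewrite /E expr0n !mul0r expR0 mulr1.
have -> : F 0 = cos b.
  rewrite /F /f; under eq_Rintegral do rewrite mul0r add0r.
  by rewrite (@Rintegral_cst _ _ _ P setT measurableT)/= probability_setT mulr1.
by move=> <-; rewrite expRN mulfK ?gt_eqF ?expR_gt0.
Qed.

End centered_gaussian_variable.

Section gaussian_tail.
Context d (T : measurableType d) (R : realType) (P : probability T R).
Local Notation mu := (@lebesgue_measure R).
Variables (Y : T -> R) (s : R).
Hypothesis mY : measurable_fun [set: T] Y.
Hypothesis lawY : forall B : set R, measurable B ->
  P [set w | B (Y w)] = gaussian_law 0 s B.

Lemma measurable_normge (a : R) : measurable [set x : R | a <= `|x|].
Proof.
rewrite -[X in measurable X]setTI.
rewrite (_ : [set x : R | a <= `|x|] = (fun x : R => `|x|) @^-1` `[a, +oo[%classic); last first.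
  by apply/seteqP; split => x /=; rewrite in_itv/= andbT.
have mn : measurable_fun [set: R] (fun x : R => `|x|) by exact: measurableT_comp.
exact: mn.
Qed.

Lemma measurable_normle (z a : R) : measurable [set x : R | `|x - z| <= a].
Proof.
rewrite (_ : [set x : R | _] = `[z - a, z + a]%classic); first exact: measurable_itv.
by apply/seteqP; split => x /=; rewrite in_itv/= ler_distl.
Qed.

(* For x >= l one has x^2 >= l^2 + (x - l)^2, so on [l, +oo[ the centered density is
   at most exp (- l^2 / (2 s^2)) times the density centered at l. *)
Lemma normal_tail (l tau : R) : 0 < l -> 0 < tau -> s ^+ 2 <= tau ^+ 2 ->
  (P [set w | (l * tau <= `|Y w|)%R] <= (2 * expR (- (l ^+ 2 / 2)))%:E)%E.
Proof.
move=> l0 tau0 stau.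
have lt0 : 0 < l * tau by rewrite mulr_gt0.
rewrite (lawY (B := [set x | l * tau <= `|x|])); last exact: measurable_normge.
rewrite /gaussian_law; have [s0|s0] := eqVneq s 0.
  rewrite diracE memNset ?lee_fin ?mulr_ge0 ?expR_ge0//=.
  by rewrite normr0; apply/negP; rewrite -ltNge.
set L := l * tau in lt0 *.
have s2 : 0 < s ^+ 2 by rewrite exprn_even_gt0.
pose C := expR (- (l ^+ 2 / 2)).
have bnd x : L <= `|x| -> normal_pdf 0 s x <= C * normal_pdf L s x + C * normal_pdf (- L) s x.
  move=> Lx; rewrite !normal_pdfE//.
  (* [M] is [L] or [- L], whichever has the sign of [x]; both half-lines are handled at once. *)
  have main (M : R) : `|M| = L -> M * x = `|M| * `|x| ->
     normal_peak s * normal_fun 0 s x <= C * (normal_peak s * normal_fun M s x).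
    move=> ML Mx; rewrite mulrCA ler_wpM2l ?normal_peak_ge0// /normal_fun -expRD ler_expR.
    rewrite subr0 -subr_ge0.
    have -> : - (l ^+ 2 / 2) + - (x - M) ^+ 2 / (s ^+ 2 *+ 2) - - x ^+ 2 / (s ^+ 2 *+ 2)
      = (2 * (M * x) - M ^+ 2 - l ^+ 2 * s ^+ 2) / (s ^+ 2 *+ 2).
      by field.
    rewrite divr_ge0 ?mulrn_wge0 ?sqr_ge0//.
    have -> : M ^+ 2 = L ^+ 2 by rewrite -ML real_normK ?num_real.
    rewrite Mx ML.
    have h1 : L ^+ 2 <= L * `|x| by rewrite expr2 ler_wpM2l// ltW.
    have h2 : l ^+ 2 * s ^+ 2 <= L ^+ 2 by rewrite /L exprMn ler_wpM2l ?sqr_ge0.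
    by lra.
  have nn (M : R) : 0 <= C * (normal_peak s * normal_fun M s x).
    by rewrite !mulr_ge0 ?expR_ge0 ?normal_peak_ge0 ?normal_fun_ge0.
  have L0 : `|L| = L by rewrite gtr0_norm.
  have [x0|x0] := leP 0 x.
    by apply: (le_trans (main L L0 _)); rewrite ?lerDl// L0 ger0_norm.
  apply: (le_trans (main (- L) _ _)); rewrite ?lerDr ?normrN//.
  by rewrite L0 ltr0_norm// mulrN mulNr.
have mp (M : R) : measurable_fun [set: R] (fun x => (C * normal_pdf M s x)%:E).
  by apply/measurable_EFinP; apply: measurable_funM => //; exact: measurable_normal_pdf.
have C0 : 0 <= C by exact: expR_ge0.
apply: (@le_trans _ _ (\int[mu]_x (C * normal_pdf L s x + C * normal_pdf (- L) s x)%:E)%E).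
  rewrite /normal_prob.
  apply: (@le_trans _ _ (\int[mu]_(x in [set x | (L <= `|x|)%R]) (C * normal_pdf L s x + C * normal_pdf (- L) s x)%:E)%E).
    apply: ge0_le_integral => //=.
    - exact: measurable_normge.
    - by move=> x _; rewrite lee_fin normal_pdf_ge0.
    - by apply/measurable_EFinP; apply: measurable_funTS; exact: measurable_normal_pdf.
    - apply/measurable_EFinP; apply: measurable_funTS.
      by apply: measurable_funD; apply: measurable_funM => //; exact: measurable_normal_pdf.
  apply: ge0_subset_integral => //=.
  - exact: measurable_normge.
  - apply/measurable_EFinP.
    by apply: measurable_funD; apply: measurable_funM => //; exact: measurable_normal_pdf.
  - by move=> x _; rewrite lee_fin addr_ge0 ?mulr_ge0 ?normal_pdf_ge0.
under eq_integral do rewrite EFinD.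
have ge0 (M : R) x : (0 <= (C * normal_pdf M s x)%:E)%E.
  by rewrite lee_fin mulr_ge0// normal_pdf_ge0.
rewrite ge0_integralD; [|by []|by move=> x _; exact: ge0|exact: mp|by move=> x _; exact: ge0|exact: mp].
have e1 M : (\int[mu]_x (C * normal_pdf M s x)%:E = C%:E)%E.
  under eq_integral do rewrite EFinM.
  rewrite ge0_integralZl_EFin//.
  - by rewrite integral_normal_pdf mule1.
  - by move=> x _; rewrite lee_fin normal_pdf_ge0.
  - by apply/measurable_EFinP; exact: measurable_normal_pdf.
by rewrite !e1 -EFinD lee_fin mulr2n mulrDl mul1r.
Qed.

(** On [[- (Z + 1), Z + 1]] the density is at least its value at the endpoints, which serves as [c];
    all the balls considered lie there. *)
Lemma gaussian_law_ball_ge (Z : R) : s != 0 ->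
  exists2 c : R, 0 < c & forall z delta : R, `|z| <= Z -> 0 <= delta <= 1 ->
    ((c * delta)%:E <= gaussian_law 0 s [set x | (`|x - z| <= delta)%R])%E.
Proof.
move=> s0; pose c := normal_peak s * expR (- (Z + 1) ^+ 2 / (s ^+ 2 *+ 2)).
have c0 : 0 < c by rewrite mulr_gt0 ?normal_peak_gt0 ?expR_gt0.
exists c => // z delta zZ /andP[d0 d1].
rewrite /gaussian_law (negbTE s0) /normal_prob.
apply: (@le_trans _ _ (\int[mu]_(x in [set x | (`|x - z| <= delta)%R]) (cst c%:E x))%E).
  rewrite integral_cst/=; last exact: measurable_normle.
  rewrite (_ : [set x : R | _] = `[z - delta, z + delta]%classic); last first.
    by apply/seteqP; split => x /=; rewrite in_itv/= ler_distl.
  rewrite lebesgue_measure_itv /= lte_fin ltrD2l; case: ifPn => [_|].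
    rewrite -EFinD -EFinM lee_fin ler_wpM2l//; first exact: ltW.
    lra.
  by rewrite -leNgt => dd; rewrite mule0 lee_fin pmulr_rle0//; lra.
apply: ge0_le_integral => //=.
- exact: measurable_normle.
- by move=> x _; rewrite lee_fin ltW.
- by apply/measurable_EFinP; apply: measurable_funTS; exact: measurable_normal_pdf.
- move=> x xz; rewrite lee_fin normal_pdfE// /c ler_wpM2l ?normal_peak_ge0//.
  rewrite /normal_fun ler_expR subr0 ler_wpM2r ?invr_ge0 ?mulrn_wge0 ?sqr_ge0//.
  rewrite lerN2 -[x ^+ 2]real_normK ?num_real// ler_sqr ?nnegrE//.
    rewrite -{1}(subrK z x); apply: le_trans (ler_normD _ _) _.
    by rewrite addrC lerD// (le_trans xz).
  by rewrite addr_ge0// (le_trans _ zZ).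
Qed.

End gaussian_tail.

(** * Small balls for Gaussian pairs *)

Section fejer.
Context {R : realType}.

(* A multiple of the Fejer kernel: it is of size n^2 on [-1/n, 1/n], and a trigonometric
   polynomial, so that its expectation only involves characteristic functions. *)
Definition fejer (n : nat) (x : R) : R :=
  (\sum_(k < n) cos (k%:R * x)) ^+ 2 + (\sum_(k < n) sin (k%:R * x)) ^+ 2.

Lemma fejer_ge0 n x : 0 <= fejer n x.
Proof. by rewrite addr_ge0// sqr_ge0. Qed.

Lemma fejerE n x :
  fejer n x = \sum_(i : 'I_n * 'I_n) cos ((i.1%:R - i.2%:R) * x).
Proof.
rewrite /fejer !expr2 !big_distrlr/= -big_split/=.
rewrite -(pair_big xpredT xpredT (fun i j : 'I_n => cos ((i%:R - j%:R) * x)))/=.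
apply: eq_bigr => i _; rewrite -big_split/=; apply: eq_bigr => j _.
by rewrite mulrBl cosB.
Qed.

Lemma fejer_ge n x : n%:R * `|x| <= 1 -> (n%:R * cos 1) ^+ 2 <= fejer n x.
Proof.
move=> nx; rewrite /fejer.
apply: (@le_trans _ _ ((\sum_(k < n) cos (k%:R * x)) ^+ 2)); last by rewrite lerDl sqr_ge0.
have h : n%:R * cos 1 <= \sum_(k < n) cos (k%:R * x).
  rewrite (_ : n%:R * cos 1 = \sum_(k < n) cos 1); last first.
    by rewrite sumr_const card_ord mulr_natl.
  apply: ler_sum => k _.
  have kx1 : `|k%:R * x| <= 1.
    rewrite normrM normr_nat; apply: le_trans nx.
    by rewrite ler_wpM2r// ler_nat ltnW.
  have pi1 : 1 <= pi :> R by apply: le_trans (pi_ge2 R); rewrite ler1n.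
  rewrite -(cos_norm (k%:R * x)).
  by rewrite leNgt ltr_cos ?in_itv/= ?ler01 ?normr_ge0//= -?leNgt// (le_trans kx1).
have n0 : 0 <= n%:R * cos 1 :> R by rewrite mulr_ge0// ltW// cos1_gt0.
by rewrite ler_sqr ?nnegrE// (le_trans n0).
Qed.

Lemma geometric_below (q : R) (j n : nat) : 0 <= q -> q < 1 ->
  \sum_(k < n) (if (k <= j)%N then q ^+ (j - k) else 0) <= (1 - q)^-1.
Proof.
move=> q0 q1; have q1' : 0 < 1 - q by rewrite subr_gt0.
rewrite -[leRHS]mul1r ler_pdivlMr//.
suff -> : (\sum_(k < n) (if (k <= j)%N then q ^+ (j - k) else 0)) * (1 - q) =
   (if (n <= j.+1)%N then q ^+ (j.+1 - n) else 1) - q ^+ j.+1.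
  by case: ifPn => _; rewrite lerBlDr ler_wpDr ?exprn_ge0// exprn_ile1// ltW.
elim: n => [|n IHn]; first by rewrite big_ord0 mul0r leq0n subn0 subrr.
rewrite big_ord_recr/= mulrDl IHn ltnS.
have [nj|nj] := leqP n j.
  rewrite leqW// subSn// subSS exprS; ring.
rewrite mul0r addr0; congr (_ - _); case: ifPn => // nj'.
by rewrite (_ : n = j.+1) ?subnn ?expr0//; apply/eqP; rewrite eqn_leq nj' nj.
Qed.

Lemma geometric_above (q : R) (j n : nat) : 0 <= q -> q < 1 ->
  \sum_(k < n) (if (j <= k)%N then q ^+ (k - j) else 0) <= (1 - q)^-1.
Proof.
move=> q0 q1; have q1' : 0 < 1 - q by rewrite subr_gt0.
rewrite -[leRHS]mul1r ler_pdivlMr//.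
suff -> : (\sum_(k < n) (if (j <= k)%N then q ^+ (k - j) else 0)) * (1 - q) =
   1 - q ^+ (n - j).
  by rewrite lerBlDr ler_wpDr ?exprn_ge0.
elim: n => [|n IHn]; first by rewrite big_ord0 mul0r sub0n expr0 subrr.
rewrite big_ord_recr/= mulrDl IHn.
have [nj|nj] := leqP j n.
  rewrite subSn// exprS; ring.
by rewrite mul0r addr0 (eqP (ltnW nj)) (eqP nj).
Qed.

(** Two geometric series of ratio [exp (- 1/2)], one on each side of the diagonal. *)
Definition fejer_cst : R := 2 / (1 - expR (- 2^-1)).

Lemma fejer_cst_ge1 : 1 <= fejer_cst.
Proof.
have q1 : expR (- 2^-1) < 1 :> R by rewrite expR_lt1 oppr_lt0 invr_gt0.
have q0 : 0 < expR (- 2^-1) :> R := expR_gt0 _.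
by rewrite /fejer_cst ler_pdivlMr ?subr_gt0//; lra.
Qed.

(** The gain over the trivial bound [n^2]: for [v >= 1] the terms decay geometrically away from the
    diagonal, because [k^2 >= k] for a natural number [k]. The case [n <= 1] consists of one term at
    most. *)
Lemma sum_gauss_le (n : nat) (v : R) : (n <= 1)%N \/ 1 <= v ->
  \sum_(i : 'I_n * 'I_n) expR (- ((i.1%:R - i.2%:R) ^+ 2 * v / 2)) <= fejer_cst * n%:R.
Proof.
have q1 : expR (- 2^-1) < 1 :> R by rewrite expR_lt1 oppr_lt0 invr_gt0.
have q0 : 0 < expR (- 2^-1) :> R := expR_gt0 _.
move=> nv.
rewrite -(pair_big xpredT xpredT (fun i j : 'I_n => expR (- ((i%:R - j%:R) ^+ 2 * v / 2))))/=.
rewrite mulrC -[n in n%:R * _]card_ord mulr_natl -sumr_const.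
apply: ler_sum => i _.
case: nv => [n1|v1].
  have n1' : n = 1%N by apply/eqP; rewrite eqn_leq n1 (leq_ltn_trans _ (ltn_ord i)).
  subst n; rewrite big_ord1 !ord1 subrr expr0n !mul0r oppr0 expR0.
  exact: fejer_cst_ge1.
set q := expR (- 2^-1) in q0 q1 *.
apply: (@le_trans _ _ (\sum_(k < n) ((if (k <= i)%N then q ^+ (i - k) else 0) +
                                     (if (i <= k)%N then q ^+ (k - i) else 0)))); last first.
  rewrite big_split/= /fejer_cst -/q mulr2n mulrDl mul1r.
  by apply: lerD; [apply: geometric_below|apply: geometric_above]; rewrite ?ltW.
have ge (c : bool) (e : nat) : 0 <= (if c then q ^+ e else 0).
  by case: c => //; rewrite exprn_ge0// ltW.
have key (a b : nat) : (a <= b)%N -> expR (- ((b%:R - a%:R) ^+ 2 * v / 2)) <= q ^+ (b - a).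
  move=> ab; rewrite /q -expRM_natl ler_expR -natrB// mulrN lerN2 ler_wpM2r//.
  have : ((b - a)%:R : R) <= (b - a)%:R ^+ 2.
    by rewrite -natrX ler_nat; case: (b - a)%N => // m; rewrite -mulnn leq_pmulr.
  by move=> h; apply: (le_trans h); rewrite ler_peMr// sqr_ge0.
apply: ler_sum => k _.
have [ki|ik] := leqP k i.
  by rewrite ler_wpDr// key.
rewrite add0r (ltnW ik).
by rewrite -sqrrN opprB key// ltnW.
Qed.

End fejer.

Section small_ball.
Context d (T : measurableType d) (R : realType) (P : probability T R).
Variables (V U : T -> R) (v w : R).
Hypotheses (mV : measurable_fun [set: T] V) (mU : measurable_fun [set: T] U).
(* V and U are centered, jointly Gaussian and uncorrelated, of variances v and w. *)
Hypothesis charVU : forall a b c : R,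
  \int[P]_x cos (a * V x + b * U x + c) =
  cos c * expR (- ((a ^+ 2 * v + b ^+ 2 * w) / 2)).

(** Markov's inequality for a product of two Fejer kernels: on the event it is at least a multiple
    of [(n n')^2] by [fejer_ge], and its expectation is at most a multiple of [n n'] by
    [sum_gauss_le]. The shift [u0] only changes phases, whose cosines are at most 1. *)
Lemma small_ball2 (t t' u0 : R) (n n' : nat) : (0 < n)%N -> (0 < n')%N ->
  (n <= 1)%N \/ 1 <= t ^+ 2 * v -> (n' <= 1)%N \/ 1 <= t' ^+ 2 * w ->
  (P [set x | (n%:R * `|t * V x| <= 1)%R /\ (n'%:R * `|t' * (U x - u0)| <= 1)%R]
    <= (fejer_cst ^+ 2 / cos 1 ^+ 4 / (n%:R * n'%:R))%:E)%E.
Proof.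
move=> n0 n'0 nv nw; set A := [set x | _ /\ _].
have c10 := cos1_gt0 R.
have mtV : measurable_fun [set: T] (fun x => n%:R * `|t * V x|).
  apply: measurable_funM => //; apply: measurableT_comp => //.
  exact: measurable_funM.
have mtU : measurable_fun [set: T] (fun x => n'%:R * `|t' * (U x - u0)|).
  apply: measurable_funM => //; apply: measurableT_comp => //.
  by apply: measurable_funM => //; exact: measurable_funB.
have mA : measurable A.
  rewrite (_ : A = ((fun x => n%:R * `|t * V x|) @^-1` `]-oo, 1%R]) `&`
                   ((fun x => n'%:R * `|t' * (U x - u0)|) @^-1` `]-oo, 1%R])); last first.
    by apply/seteqP; split => x /=; rewrite !in_itv.
  by apply: measurableI; rewrite -[X in measurable X]setTI; [apply: mtV|apply: mtU].
pose f (i : ('I_n * 'I_n) * ('I_n' * 'I_n')) x :=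
  cos ((i.1.1%:R - i.1.2%:R) * (t * V x)) * cos ((i.2.1%:R - i.2.2%:R) * (t' * (U x - u0))).
pose F x := fejer n (t * V x) * fejer n' (t' * (U x - u0)).
have FE x : F x = \sum_i f i x.
  rewrite /F !fejerE big_distrlr/= pair_big/=.
  by apply: eq_bigr => -[[a b] [a' b']].
(* The two signs [e = 1] and [e = -1] are the terms of the product formula [cos x * cos y = (cos (x
   + y) + cos (x - y)) / 2]; each has the form required by [charVU]. *)
pose g (i : ('I_n * 'I_n) * ('I_n' * 'I_n')) (e : R) x :=
  cos ((i.1.1%:R - i.1.2%:R) * t * V x + e * (i.2.1%:R - i.2.2%:R) * t' * U x
     + - e * ((i.2.1%:R - i.2.2%:R) * t' * u0)).
have mg i e : measurable_fun [set: T] (g i e).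
  apply: (@measurableT_comp _ _ _ _ _ _ (cos : R -> R)).
    by apply: continuous_measurable_fun; exact: continuous_cos.
  by apply: measurable_funD => //; apply: measurable_funD; exact: measurable_funM.
have ig i e : P.-integrable [set: T] (EFin \o g i e).
  apply: (@le_integrable _ _ _ P _ measurableT _ (cst 1%E)) => //.
  - exact/measurable_EFinP/mg.
  - by move=> x _; rewrite /= lee_fin normr1 ler_norml cos_geN1 cos_le1.
  - exact: finite_measure_integrable_cst.
have fgE i x : f i x = 2^-1 * g i 1 x + 2^-1 * g i (-1) x.
  rewrite /f /g.
  have pr (a b : R) : cos a * cos b = 2^-1 * cos (a + b) + 2^-1 * cos (a - b).
    by rewrite cosD cosB; field.
  by rewrite pr; congr (_ * cos _ + _ * cos _); ring.
have i2g i e : P.-integrable [set: T] (EFin \o (fun x => 2^-1 * g i e x)).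
  rewrite (_ : _ \o _ = fun x => (2^-1%:E * (g i e x)%:E)%E)//.
  by apply: integrableZl => //; exact: ig.
have if_ i : P.-integrable [set: T] (fun x => (f i x)%:E).
  under eq_fun do rewrite fgE EFinD.
  by apply: integrableD => //; exact: i2g.
have fle i : (\int[P]_x (f i x)%:E <=
   (expR (- ((i.1.1%:R - i.1.2%:R) ^+ 2 * (t ^+ 2 * v) / 2)) *
    expR (- ((i.2.1%:R - i.2.2%:R) ^+ 2 * (t' ^+ 2 * w) / 2)))%:E)%E.
  rewrite -(fineK (integrable_fin_num measurableT (if_ i))) lee_fin.
  rewrite -/(Rintegral P setT (f i)).
  rewrite (@eq_Rintegral _ _ _ P setT (fun x => 2^-1 * g i 1 x + 2^-1 * g i (-1) x) (f i)); last by move=> x _; exact: fgE.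
  rewrite RintegralD// !RintegralZl// /g !charVU -expRD.
  set e := expR _; set e' := expR _.
  have -> : e' = e by rewrite /e /e'; congr expR; field.
  rewrite [leRHS](_ : _ = e); last by rewrite /e; congr expR; field.
  have e0 : 0 <= e := expR_ge0 _.
  rewrite -mulrDr -mulrDl mulrA ler_piMl//.
  set a := cos _; set b := cos _.
  have a1 : a <= 1 := cos_le1 _. have b1 : b <= 1 := cos_le1 _.
  lra.
have IF : (\int[P]_x (F x)%:E <= ((fejer_cst * n%:R) * (fejer_cst * n'%:R))%:E)%E.
  under eq_integral do rewrite FE -sumEFin.
  rewrite integral_sum//.
  apply: (@le_trans _ _ (\sum_(i : ('I_n * 'I_n) * ('I_n' * 'I_n')) (expR (- ((i.1.1%:R - i.1.2%:R) ^+ 2 * (t ^+ 2 * v) / 2)) *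
    expR (- ((i.2.1%:R - i.2.2%:R) ^+ 2 * (t' ^+ 2 * w) / 2)))%:E)%E).
    by apply: lee_sum => i _; exact: fle.
  rewrite sumEFin lee_fin.
  rewrite -(pair_big xpredT xpredT (fun (i : 'I_n * 'I_n) (j : 'I_n' * 'I_n') => expR (- ((i.1%:R - i.2%:R) ^+ 2 * (t ^+ 2 * v) / 2)) *
    expR (- ((j.1%:R - j.2%:R) ^+ 2 * (t' ^+ 2 * w) / 2))))/=.
  rewrite -big_distrlr/=.
  by apply: ler_pM; [apply: sumr_ge0 => *; exact: expR_ge0|apply: sumr_ge0 => *; exact: expR_ge0|exact: sum_gauss_le|exact: sum_gauss_le].
pose K := (n%:R * cos 1) ^+ 2 * (n'%:R * cos 1) ^+ 2 : R.
have K0 : 0 < K by rewrite !mulr_gt0 ?ltr0n.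
have KF : (K%:E * P A <= \int[P]_x (F x)%:E)%E.
  rewrite -(setIT A) -integral_indic// -ge0_integralZl_EFin//; last 2 first.
  - exact/measurable_EFinP/measurable_indic.
  - exact: ltW.
  apply: ge0_le_integral => //.
  - by move=> x _; rewrite mule_ge0// lee_fin ltW.
  - apply: emeasurable_funM => //; exact/measurable_EFinP/measurable_indic.
  - by apply: (measurable_int P); rewrite (_ : (fun x => _) = (fun x => \sum_i (f i x)%:E)%E);
      [exact: integrable_sum|apply/funext => x; rewrite FE sumEFin].
  - move=> x _; rewrite -EFinM lee_fin indicE.
    have [|_] := boolP (x \in A); last by rewrite mulr0 mulr_ge0// fejer_ge0.
    rewrite inE => -[h1 h2]; rewrite mulr1.
    by apply: ler_pM; rewrite ?sqr_ge0//; apply: fejer_ge.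
have := le_trans KF IF.
have PA : P A \is a fin_num by rewrite fin_num_measure.
rewrite -(fineK PA) -EFinM !lee_fin => h.
rewrite -(ler_pM2l K0); apply: (le_trans h).
rewrite le_eqVlt; apply/orP; left; apply/eqP; rewrite /K; field.
by rewrite !pnatr_eq0 -!lt0n n0 n'0 gt_eqF.
Qed.

End small_ball.

Lemma powR_ile1 (R : realType) (x y : R) : 0 <= x <= 1 -> 0 <= y -> x `^ y <= 1.
Proof.
move=> /andP[x0 x1] y0; have := @ge0_ler_powR R y y0 x 1.
by rewrite powR1 !nnegrE; apply.
Qed.

(** * The covariance function *)

Section covariance_bounds.
Context (R : realType) (d : nat).
Variables (sigma a c alpha beta gamma : R).
Hypotheses (sigma0 : 0 < sigma) (a0 : 0 < a) (c0 : 0 < c)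
  (alpha01 : 0 < alpha <= 1) (beta01 : 0 < beta <= 1) (gamma01 : 0 < gamma <= 1).
Local Notation cov := (@space_time_cov R d sigma a c alpha beta gamma).

Let g (t : R) := 1 + a * `|t| `^ (2 * alpha).
Let e := beta * d.+1%:R / 2.
Let A (t : R) := e * ln (g t).
Let D (x : 'rV[R]_d) (t : R) :=
  c * euclid_norm x `^ (2 * gamma) / g t `^ (beta * gamma).

Let g_ge1 t : 1 <= g t.
Proof. by rewrite lerDl mulr_ge0 ?powR_ge0// ltW. Qed.

Let g_gt0 t : 0 < g t.
Proof. exact: lt_le_trans (g_ge1 t). Qed.

Let beta0 : 0 < beta. Proof. by case/andP: beta01. Qed.
Let gamma0 : 0 < gamma. Proof. by case/andP: gamma01. Qed.
Let alpha0 : 0 < alpha. Proof. by case/andP: alpha01. Qed.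

Let e_gt0 : 0 < e.
Proof. by rewrite /e divr_gt0// mulr_gt0. Qed.

Let covE x t : cov x t = sigma ^+ 2 * (expR (- A t) * expR (- D x t)).
Proof.
rewrite /space_time_cov -/(g t) -/e -/(D x t) mulrA; congr (_ * _ * _).
by rewrite expRN /powR gt_eqF.
Qed.

Let A_ge0 t : 0 <= A t.
Proof. by rewrite /A mulr_ge0 ?(ltW e_gt0)// ln_ge0. Qed.

Let D_ge0 x t : 0 <= D x t.
Proof. by rewrite /D divr_ge0 ?powR_ge0// mulr_ge0 ?powR_ge0// ltW. Qed.

Lemma space_time_cov_ge0 x t : 0 <= cov x t.
Proof. by rewrite covE mulr_ge0 ?sqr_ge0 ?mulr_ge0 ?expR_ge0. Qed.

Lemma space_time_cov0 : cov 0 0 = sigma ^+ 2.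
Proof.
rewrite covE /A /D /g.
have n0 : euclid_norm (0 : 'rV[R]_d) = 0.
  by rewrite /euclid_norm big1 ?sqrtr0// => i _; rewrite mxE expr0n.
rewrite n0 normr0 !powR0 ?gt_eqF ?mulr_gt0// !mulr0 addr0 ln1 mulr0 mul0r.
by rewrite oppr0 expR0 !mulr1.
Qed.

Lemma space_time_cov_le x t : cov x t <= sigma ^+ 2.
Proof.
rewrite covE ler_piMr ?sqr_ge0// mulr_ile1 ?expR_ge0//.
  by rewrite expR_le1 oppr_le0.
by rewrite expR_le1 oppr_le0.
Qed.

Lemma powR_mul2 (x y : R) : x `^ (2 * y) = (x `^ y) ^+ 2.
Proof. by rewrite mulrC powRrM powR_mulrn// powR_ge0. Qed.

Lemma euclid_norm_powR_le (x : 'rV[R]_d) (tau : R) : 0 <= tau ->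
  (forall i, `|x ord0 i| `^ gamma <= tau) ->
  euclid_norm x `^ (2 * gamma) <= d%:R `^ gamma * tau ^+ 2.
Proof.
move=> tau0 xtau.
have S0 : 0 <= \sum_(i < d) x ord0 i ^+ 2 by apply: sumr_ge0 => i _; exact: sqr_ge0.
rewrite powRrM powR_mulrn ?sqrtr_ge0// sqr_sqrtr//.
pose q := tau `^ gamma^-1.
have q0 : 0 <= q := powR_ge0 _ _.
apply: (@le_trans _ _ ((d%:R * q ^+ 2) `^ gamma)).
  apply: ge0_ler_powR; rewrite ?nnegrE ?mulr_ge0 ?sqr_ge0 ?(ltW gamma0)//.
  rewrite mulr_natl -[in leRHS](card_ord d) -sumr_const.
  apply: ler_sum => i _.
  rewrite -real_normK ?num_real// ler_sqr ?nnegrE//.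
  have := @ge0_ler_powR R gamma^-1 _ _ _ _ _ (xtau i).
  rewrite -powRrM divff ?gt_eqF// powRr1//; apply.
  - by rewrite invr_ge0 ltW.
  - by rewrite nnegrE powR_ge0.
  - by rewrite nnegrE.
rewrite powRM// ?sqr_ge0// ler_wpM2l ?powR_ge0//.
have qg : q `^ gamma = tau by rewrite /q -powRrM mulVf ?gt_eqF// powRr1.
by rewrite -powR_mulrn// -powRrM powR_mul2 qg.
Qed.

(** The quantity bounded is the variance of an increment. Writing the covariance as
    [sigma^2 exp (- A) exp (- D)], one has [1 - exp (- A) exp (- D) <= A + D], and both exponents
    are of order [tau^2]. *)
Lemma increment_variance_le : exists2 K : R, 0 < K &
  forall (x : 'rV[R]_d) (t tau : R), 0 <= tau ->
    `|t| `^ alpha <= tau -> (forall i, `|x ord0 i| `^ gamma <= tau) ->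
    2 * (sigma ^+ 2 - cov x t) <= (K * tau) ^+ 2.
Proof.
pose M := 2 * sigma ^+ 2 * (e * a + c * d%:R `^ gamma) + 1.
have M0 : 0 < M.
  apply: ltr_wpDl => //; apply: mulr_ge0; first by rewrite mulr_ge0// sqr_ge0.
  by apply: addr_ge0; apply: mulr_ge0; rewrite ?powR_ge0// ltW.
exists (Num.sqrt M); first by rewrite sqrtr_gt0.
move=> x t tau tau0 ttau xtau.
rewrite exprMn sqr_sqrtr ?(ltW M0)//.
have hA : 1 - expR (- A t) <= e * a * tau ^+ 2.
  apply: (@le_trans _ _ (A t)).
    by rewrite lerBlDr -lerBlDl; have := expR_ge1Dx (- A t).
  rewrite /A -mulrA ler_wpM2l ?(ltW e_gt0)//.
  apply: (@le_trans _ _ (a * `|t| `^ (2 * alpha))).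
    by apply: le_ln1Dx; apply: (lt_le_trans _ (_ : 0 <= _)); rewrite ?mulr_ge0 ?powR_ge0 ?(ltW a0)// oppr_lt0.
  rewrite ler_wpM2l ?(ltW a0)// powR_mul2 ler_sqr ?nnegrE ?powR_ge0//.
have hD : 1 - expR (- D x t) <= c * d%:R `^ gamma * tau ^+ 2.
  apply: (@le_trans _ _ (D x t)).
    by rewrite lerBlDr -lerBlDl; have := expR_ge1Dx (- D x t).
  rewrite /D ler_pdivrMr ?powR_gt0//.
  apply: (@le_trans _ _ (c * d%:R `^ gamma * tau ^+ 2 * 1)); last first.
    rewrite ler_wpM2l ?mulr_ge0 ?powR_ge0 ?sqr_ge0 ?(ltW c0)//.
    have := @ler_powR R _ (g_ge1 t) 0 (beta * gamma); rewrite powRr0; apply.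
    by rewrite mulr_ge0// ltW.
  by rewrite mulr1 -mulrA ler_wpM2l ?(ltW c0)//; exact: euclid_norm_powR_le.
rewrite covE.
have A1 : expR (- A t) <= 1 by rewrite expR_le1 oppr_le0.
have D1 : expR (- D x t) <= 1 by rewrite expR_le1 oppr_le0.
have h : 1 - expR (- A t) * expR (- D x t) <= (e * a + c * d%:R `^ gamma) * tau ^+ 2.
  rewrite mulrDl; apply: le_trans (lerD hA hD).
  rewrite -subr_ge0 (_ : _ - _ = (1 - expR (- A t)) * (1 - expR (- D x t))); last by ring.
  by rewrite mulr_ge0// subr_ge0.
rewrite (_ : 2 * _ = 2 * sigma ^+ 2 * (1 - expR (- A t) * expR (- D x t))); last by ring.
apply: (le_trans (ler_wpM2l _ h)); first by rewrite mulr_ge0// sqr_ge0.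
by rewrite mulrA ler_wpM2r ?sqr_ge0// /M lerDl.
Qed.

(** From [exp y >= 1 + y]. As [y0] ranges over a bounded interval [[0, Y]], the bound can be linear
    in [y0], although [1 - exp (- y)] itself saturates. *)
Lemma onem_expRN_ge (y0 y Y : R) : 0 <= y0 -> y0 <= y -> y0 <= Y ->
  y0 / (1 + Y) <= 1 - expR (- y).
Proof.
move=> y00 y0y y0Y.
have h : expR (- y) <= (1 + y0)^-1.
  rewrite expRN lef_pV2 ?posrE ?expR_gt0 ?ltr_wpDr//.
  by apply: le_trans (expR_ge1Dx y); rewrite lerD2l.
apply: (@le_trans _ _ (y0 / (1 + y0))).
  by rewrite ler_wpM2l// lef_pV2 ?posrE ?ltr_wpDr ?lerD2l// (le_trans y00).
apply: (@le_trans _ _ (1 - (1 + y0)^-1)); last by rewrite lerD2l lerN2.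
rewrite le_eqVlt; apply/orP; left; apply/eqP; field.
by rewrite gt_eqF// ltr_wpDr.
Qed.

Lemma coord_le_euclid_norm (x : 'rV[R]_d) i : `|x ord0 i| <= euclid_norm x.
Proof.
rewrite -sqrtr_sqr; apply: ler_wsqrtr.
by rewrite (bigD1 i)//= lerDl sumr_ge0// => j _; exact: sqr_ge0.
Qed.

(** Each of the two exponential factors alone bounds the covariance, so one coordinate with a large
    increment suffices. Confinement to unit increments keeps [g] below [1 + a] and the lower bounds
    of the exponents in a range where [onem_expRN_ge] is linear. *)
Lemma increment_variance_ge : exists2 M : R, 0 < M &
  forall (x : 'rV[R]_d) (t r : R), 0 <= r -> `|t| <= 1 ->
    (forall i, `|x ord0 i| <= 1) ->
    r <= `|t| `^ alpha \/ (exists i, r <= `|x ord0 i| `^ gamma) ->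
    r ^+ 2 <= M * (2 * (sigma ^+ 2 - cov x t)).
Proof.
pose G := (1 + a) `^ (beta * gamma).
have G0 : 0 < G by rewrite powR_gt0// addr_gt0.
(* Slopes given by [onem_expRN_ge]: the exponent in time is at least
   [e a / (1 + a) * |t|^(2 alpha)], the one in space at least [c / G * r^2]. *)
pose m1 := e * a / (1 + a) / (1 + e * a / (1 + a)).
pose m2 := c / G / (1 + c / G).
have m10 : 0 < m1.
  by rewrite /m1 divr_gt0// ?addr_gt0// divr_gt0// ?mulr_gt0// addr_gt0.
have m20 : 0 < m2.
  by rewrite /m2 divr_gt0// ?addr_gt0// divr_gt0.
have s20 : 0 < sigma ^+ 2 by rewrite exprn_gt0.
exists (m1^-1 / sigma ^+ 2 + m2^-1 / sigma ^+ 2).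
  by rewrite addr_gt0// divr_gt0// invr_gt0.
move=> x t r r0 t1 x1 rtx.
have A1 : expR (- A t) <= 1 by rewrite expR_le1 oppr_le0.
have D1 : expR (- D x t) <= 1 by rewrite expR_le1 oppr_le0.
have V0 : 0 <= 1 - expR (- A t) * expR (- D x t).
  by rewrite subr_ge0 mulr_ile1 ?expR_ge0.
have ta1 : `|t| `^ (2 * alpha) <= 1.
  by rewrite powR_ile1 ?normr_ge0// mulr_ge0// ltW.
have gt : g t <= 1 + a by rewrite /g lerD2l ler_piMr// ltW.
rewrite covE.
rewrite (_ : _ * (2 * _) = 2 * ((m1^-1 + m2^-1) * (1 - expR (- A t) * expR (- D x t)))); last first.
  by field; rewrite !gt_eqF.
suff : r ^+ 2 <= (m1^-1 + m2^-1) * (1 - expR (- A t) * expR (- D x t)).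
  move=> h; apply: (le_trans h); rewrite ler_peMl ?ler1n//.
  by rewrite mulr_ge0// addr_ge0// invr_ge0 ltW.
case: rtx => [rt|[i ri]].
- apply: (@le_trans _ _ (m1^-1 * (1 - expR (- A t) * expR (- D x t)))); last first.
    by rewrite ler_wpM2r// lerDl invr_ge0 ltW.
  rewrite ler_pdivlMl//.
  apply: (@le_trans _ _ (1 - expR (- A t))); last first.
    by rewrite lerD2l lerN2 ler_piMr ?expR_ge0.
  have r2 : r ^+ 2 <= `|t| `^ (2 * alpha).
    by rewrite powR_mul2 ler_sqr ?nnegrE ?powR_ge0.
  apply: (@le_trans _ _ (m1 * `|t| `^ (2 * alpha))); first by rewrite ler_wpM2l// ltW.
  (* [ln g = - ln (1 / g) >= 1 - 1 / g]. *)
  have b1 : ln (g t) >= a * `|t| `^ (2 * alpha) / (1 + a).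
    apply: (@le_trans _ _ (a * `|t| `^ (2 * alpha) / g t)).
      rewrite ler_wpM2l ?mulr_ge0 ?powR_ge0 ?(ltW a0)// lef_pV2 ?posrE//.
      by rewrite addr_gt0.
    rewrite -[ln _]opprK -lnV ?posrE// lerNr.
    have gV : (g t)^-1 = 1 + - (a * `|t| `^ (2 * alpha) / g t).
      by move: (g_gt0 t); rewrite /g => h; field; rewrite gt_eqF.
    rewrite [in leLHS]gV; apply: le_ln1Dx.
    by rewrite ltrN2 ltr_pdivrMr// mul1r /g ltrDr.
  rewrite (_ : m1 * _ = e * (a * `|t| `^ (2 * alpha) / (1 + a)) / (1 + e * a / (1 + a))); last first.
    by rewrite /m1; field; rewrite !gt_eqF ?addr_gt0 ?mulr_gt0.
  apply: onem_expRN_ge.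
  + by rewrite mulr_ge0 ?(ltW e_gt0)// divr_ge0 ?mulr_ge0 ?powR_ge0 ?(ltW a0) ?addr_ge0 ?(ltW a0).
  + by rewrite /A ler_wpM2l// ltW.
  + rewrite !mulrA ler_wpM2r ?invr_ge0 ?addr_ge0 ?(ltW a0)//.
    by rewrite ler_piMr// mulr_ge0 ?(ltW e_gt0)// ltW.
- apply: (@le_trans _ _ (m2^-1 * (1 - expR (- A t) * expR (- D x t)))); last first.
    by rewrite ler_wpM2r// lerDr invr_ge0 ltW.
  rewrite ler_pdivlMl//.
  apply: (@le_trans _ _ (1 - expR (- D x t))); last first.
    by rewrite lerD2l lerN2 ler_piMl ?expR_ge0.
  rewrite (_ : m2 * _ = (c * r ^+ 2 / G) / (1 + c / G)); last first.
    by rewrite /m2; field; rewrite !gt_eqF ?addr_gt0.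
  have ri1 : `|x ord0 i| `^ gamma <= 1.
    by rewrite powR_ile1 ?normr_ge0 ?x1// ltW.
  have r1 : r ^+ 2 <= 1.
    by rewrite expr_le1// (le_trans ri).
  apply: onem_expRN_ge.
  + by rewrite divr_ge0 ?(ltW G0)// mulr_ge0 ?sqr_ge0// ltW.
  + rewrite /D; apply: ler_pM.
    * by rewrite mulr_ge0 ?sqr_ge0// ltW.
    * by rewrite invr_ge0 ltW.
    * rewrite ler_wpM2l ?(ltW c0)// powR_mul2 ler_sqr ?nnegrE ?powR_ge0//.
      apply: (le_trans ri); apply: ge0_ler_powR; rewrite ?nnegrE ?(ltW gamma0)//.
        exact: sqrtr_ge0.
      exact: coord_le_euclid_norm.
    * rewrite lef_pV2 ?posrE ?powR_gt0 ?(g_gt0 t)//; last exact: addr_gt0.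
      apply: ge0_ler_powR; rewrite ?nnegrE ?mulr_ge0 ?(ltW beta0) ?(ltW gamma0)//.
        exact: ltW.
      by rewrite addr_ge0// ltW.
  + by rewrite ler_wpM2r ?invr_ge0 ?(ltW G0)// ler_piMr// ltW.
Qed.

End covariance_bounds.

(** * Two-point laws and probabilities for the field *)

Section field_law.
Context (R : realType) (d : nat).
Variables (sigma a c alpha beta gamma : R).
Hypotheses (sigma0 : 0 < sigma) (a0 : 0 < a) (c0 : 0 < c)
  (alpha01 : 0 < alpha <= 1) (beta01 : 0 < beta <= 1) (gamma01 : 0 < gamma <= 1).
Local Notation cov := (@space_time_cov R d sigma a c alpha beta gamma).
Local Notation I := ('rV[R]_d * R)%type.

(** The only information on the Gaussian structure that is carried over to the copies. The square
    root appears because [gaussian_law] is parametrized by the standard deviation. *)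
Definition pair_law (disp : measure_display) (T : measurableType disp)
    (P : probability T R) (Z : I -> T -> R) :=
  forall (u v : I) (b b' : R) (B : set R), measurable B ->
  P [set w | B (b * Z u w + b' * Z v w)] =
  gaussian_law 0 (Num.sqrt ((b ^+ 2 + b' ^+ 2) * sigma ^+ 2 +
    2 * b * b' * cov (u.1 - v.1) (u.2 - v.2))) B.

Lemma gaussian_law_norm (m s : R) (B : set R) :
  gaussian_law m s B = gaussian_law m (Num.sqrt (s ^+ 2)) B.
Proof.
rewrite /gaussian_law sqrtr_sqr normr_eq0; case: ifP => _; first by [].
rewrite /normal_prob; apply: eq_integral => x _.
by rewrite /normal_pdf normr_eq0 /normal_peak /normal_fun real_normK ?num_real.
Qed.

(** The law of [b X(u) + b' X(v)] is Gaussian with unspecified parameters; these are computed as its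
    first two moments, products being integrable by [|x y| <= x^2 + y^2]. *)
Lemma centered_gaussian_pair_law (disp : measure_display) (T : measurableType disp)
    (P : probability T R) (X : I -> {RV P >-> R}) :
  gaussian_field X -> centered_field X ->
  (forall (x y : 'rV[R]_d) (t s : R),
      ('E_P[X (x + y, t + s)%R \* X (y, s)%R] = (cov x t)%:E)%E) ->
  pair_law P (fun u => X u).
Proof.
move=> Xg Xc Xcov u v b b' B mB.
have single w : exists m s : R, forall B : set R, measurable B ->
    P [set x | B (X w x)] = gaussian_law m s B.
  have [m [s ms]] := Xg 1%N (fun=> w) (fun=> 1); exists m, s => B' mB'.
  rewrite -ms//; congr (P _); apply/seteqP; split => x /=; by rewrite big_ord1 mul1r.
have iX w : P.-integrable [set: T] (EFin \o X w).
  have [m [s ms]] := single w; exact: (gaussian_integrable_id _ ms).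
have iX2 w : P.-integrable [set: T] (fun x => (X w x ^+ 2)%:E).
  have [m [s ms]] := single w; exact: (gaussian_integrable_sqr _ ms).
have iXX w w' : P.-integrable [set: T] (EFin \o (fun x => X w x * X w' x)).
  apply: (@le_integrable _ _ _ P _ measurableT _ (fun x => ((X w x ^+ 2)%:E + (X w' x ^+ 2)%:E)%E)) => //.
  - by apply/measurable_EFinP; apply: measurable_funM.
  - move=> x _; rewrite /= lee_fin [leRHS]ger0_norm ?addr_ge0 ?sqr_ge0//.
    rewrite ler_norml; have := sqr_ge0 (X w x - X w' x); have := sqr_ge0 (X w x + X w' x).
    by have := sqr_ge0 (X w x); have := sqr_ge0 (X w' x); nra.
  - exact: integrableD.
have EX w : \int[P]_x X w x = 0.
  by have := Xc w; rewrite unlock /Rintegral => ->.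
have EXX w w' : \int[P]_x (X w x * X w' x) = cov (w.1 - w'.1) (w.2 - w'.2).
  have := Xcov (w.1 - w'.1) w'.1 (w.2 - w'.2) w'.2.
  by rewrite !subrK unlock /Rintegral -!surjective_pairing => ->.
have [m [s ms]] := Xg 2%N (fun i => if i == ord0 then u else v)
   (fun i => if i == ord0 then b else b').
pose Y w := b * X u w + b' * X v w.
have YE w : \sum_(i < 2) (if i == ord0 then b else b') *
    X (if i == ord0 then u else v) w = Y w.
  by rewrite big_ord_recl big_ord1.
have mY : measurable_fun [set: T] Y.
  by apply: measurable_funD; apply: measurable_funM.
have lawY (B' : set R) : measurable B' -> P [set w | B' (Y w)] = gaussian_law m s B'.
  move=> mB'; rewrite -ms//; congr (P _); apply/seteqP; split => x /=; by rewrite YE.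
have iZ (k : R) (f : T -> R) : P.-integrable [set: T] (EFin \o f) ->
    P.-integrable [set: T] (EFin \o (fun x => k * f x)).
  move=> fi; rewrite (_ : _ \o _ = fun x => (k%:E * (f x)%:E)%E)//.
  by apply: integrableZl.
have m0 : m = 0.
  rewrite -(gaussian_mean mY lawY) /Y RintegralD//; [|exact: iZ|exact: iZ].
  by rewrite !RintegralZl// !EX !mulr0 addr0.
have s2 : s ^+ 2 = (b ^+ 2 + b' ^+ 2) * sigma ^+ 2 +
    2 * b * b' * cov (u.1 - v.1) (u.2 - v.2).
  rewrite -(gaussian_second_moment mY lawY) m0.
  have E w : (Y w - 0) ^+ 2 = b ^+ 2 * (X u w * X u w) +
      (2 * b * b' * (X u w * X v w) + b' ^+ 2 * (X v w * X v w)).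
    by rewrite /Y; ring.
  under eq_Rintegral do rewrite E.
  have iD (f g : T -> R) : P.-integrable [set: T] (EFin \o f) ->
     P.-integrable [set: T] (EFin \o g) -> P.-integrable [set: T] (EFin \o (fun x => f x + g x)).
    move=> fi gi; rewrite (_ : _ \o _ = fun x => ((f x)%:E + (g x)%:E)%E)//.
    by apply: integrableD.
  rewrite RintegralD//; [|exact/iZ/iXX|by apply: iD; exact/iZ/iXX].
  rewrite RintegralD//; [|exact/iZ/iXX|exact/iZ/iXX].
  rewrite !RintegralZl//.
  by rewrite !EXX !subrr !space_time_cov0//; ring.
by rewrite lawY// m0 gaussian_law_norm s2.
Qed.

Lemma same_fdd_pair_law
    (d1 : measure_display) (T1 : measurableType d1) (P1 : probability T1 R)
    (X1 : I -> {RV P1 >-> R})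
    (d2 : measure_display) (T2 : measurableType d2) (P2 : probability T2 R)
    (X2 : I -> {RV P2 >-> R}) :
  same_fdd X1 X2 -> pair_law P2 (fun u => X2 u) -> pair_law P1 (fun u => X1 u).
Proof.
move=> sf X2l u v b b' B mB; rewrite -X2l//.
have mf : measurable_fun [set: 2.-tuple R] (fun t : 2.-tuple R => b * tnth t ord0 + b' * tnth t (lift ord0 ord0)).
  apply: measurable_funD; apply: measurable_funM => //; exact: measurable_tnth.
have mC : measurable [set t : 2.-tuple R | B (b * tnth t ord0 + b' * tnth t (lift ord0 ord0))].
  by rewrite -[X in measurable X]setTI; exact: mf.
have := sf 2%N (fun i => if i == ord0 then u else v) _ mC.
rewrite /fdd => h; congr (_ = _) : h.
  by congr (P1 _); apply/seteqP; split => w /=; rewrite !tnth_mktuple.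
by congr (P2 _); apply/seteqP; split => w /=; rewrite !tnth_mktuple.
Qed.

End field_law.

Section field_probabilities.
Context (R : realType) (d : nat).
Variables (sigma a c alpha beta gamma : R).
Hypotheses (sigma0 : 0 < sigma) (a0 : 0 < a) (c0 : 0 < c)
  (alpha01 : 0 < alpha <= 1) (beta01 : 0 < beta <= 1) (gamma01 : 0 < gamma <= 1).
Local Notation cov := (@space_time_cov R d sigma a c alpha beta gamma).
Local Notation I := ('rV[R]_d * R)%type.
Local Notation pair_law := (@pair_law R d sigma a c alpha beta gamma).
Context (disp : measure_display) (T : measurableType disp) (P : probability T R).

(** If [eta] exceeds the standard deviation, the trivial kernel ([n = 1], [t = 0]) is enough.
    Otherwise scaling by the inverse standard deviation normalizes the variance and [n] is the
    integer part of the ratio, at least half of it because the ratio is at least 1. *)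
Lemma fejer_scale (w eta : R) : 0 <= w -> 0 < eta ->
  exists (n : nat) (t : R), [/\ (0 < n)%N, (n <= 1)%N \/ 1 <= t ^+ 2 * w,
    forall x, `|x| <= eta -> n%:R * `|t * x| <= 1 & Num.sqrt w / (2 * eta) <= n%:R].
Proof.
move=> w0 eta0; have [h|h] := ltP (Num.sqrt w) eta.
  exists 1%N, 0; split => //; first by left.
    by move=> x _; rewrite mul0r normr0 mulr0.
  rewrite ler_pdivrMr ?mulr_gt0// mul1r; apply: (le_trans (ltW h)).
  by rewrite ler_peMl// ?ltW// ltr1n.
have sw : 0 < Num.sqrt w by exact: lt_le_trans h.
set q := Num.sqrt w / eta.
have q1 : 1 <= q by rewrite ler_pdivlMr// mul1r.
have nq := truncn_itv (le_trans ler01 q1).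
have n1 : (0 < Num.trunc q)%N by rewrite truncn_gt0.
exists (Num.trunc q), (Num.sqrt w)^-1; split => //.
- by right; rewrite exprVn sqr_sqrtr// mulVf// gt_eqF// -sqrtr_gt0.
- move=> x xeta; rewrite normrM normfV (ger0_norm (sqrtr_ge0 w)).
  case/andP: nq => nq _.
  apply: (@le_trans _ _ (q * ((Num.sqrt w)^-1 * eta))).
    by apply: ler_pM => //; rewrite ?mulr_ge0 ?invr_ge0 ?sqrtr_ge0// ler_wpM2l// invr_ge0 sqrtr_ge0.
  by rewrite le_eqVlt; apply/orP; left; apply/eqP; rewrite /q; field; rewrite !gt_eqF.
- case/andP: nq => _ nq.
  have -> : Num.sqrt w / (2 * eta) = q / 2 by rewrite /q; field; rewrite gt_eqF.
  rewrite ler_pdivrMr//; apply: (le_trans (ltW nq)).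
  by rewrite -natrM ler_nat muln2 -addnn -[X in (X <= _)%N]addn1 leq_add2l.
Qed.

(** [small_ball2] for the difference and the sum at scale [2 delta], with kernel orders at least
    [r / (4 delta)] and [sigma / (4 delta)]. The alternative [r <= delta] covers points too close to
    gain anything: there the first order is at least 1 anyway. *)
Lemma pair_ball_le : exists2 K : R, 0 < K &
  forall (Z : I -> {RV P >-> R}), pair_law P (fun u => Z u) ->
  forall (u v : I) (z delta r : R), 0 < delta -> 0 < r ->
    r <= delta \/ r ^+ 2 <= 2 * (sigma ^+ 2 - cov (u.1 - v.1) (u.2 - v.2)) ->
  (P [set w | (`|Z u w - z| <= delta)%R /\ (`|Z v w - z| <= delta)%R] <=
   (K * delta ^+ 2 / r)%:E)%E.
Proof.
pose C : R := fejer_cst ^+ 2 / cos 1 ^+ 4.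
have C0 : 0 < C.
  rewrite divr_gt0 ?exprn_gt0 ?cos1_gt0//.
  by apply: lt_le_trans (fejer_cst_ge1); rewrite ltr01.
exists (C * 4 * (4 / sigma)); first by apply: mulr_gt0; [exact: mulr_gt0|exact: divr_gt0].
move=> Z Zl u v z delta r delta0 r0 hr.
pose V w := Z u w - Z v w; pose U w := Z u w + Z v w.
set cv := cov _ _ in hr.
have mV : measurable_fun [set: T] V by exact: measurable_funB.
have mU : measurable_fun [set: T] U by exact: measurable_funD.
have cv0 : 0 <= cv by exact: space_time_cov_ge0.
have cv1 : cv <= sigma ^+ 2 by exact: space_time_cov_le.
pose vV := 2 * (sigma ^+ 2 - cv). pose vU := 2 * (sigma ^+ 2 + cv).
have vV0 : 0 <= vV by rewrite mulr_ge0// subr_ge0.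
have vU0 : 0 <= vU by rewrite mulr_ge0// addr_ge0// sqr_ge0.
have char (b b' e : R) : \int[P]_x cos (b * V x + b' * U x + e) =
    cos e * expR (- ((b ^+ 2 * vV + b' ^+ 2 * vU) / 2)).
  pose Y x := (b + b') * Z u x + (b' - b) * Z v x.
  have mY : measurable_fun [set: T] Y.
    by apply: measurable_funD; apply: measurable_funM.
  have lawY := Zl u v (b + b') (b' - b).
  have := gaussian_expectation_cos mY lawY erefl 1 e.
  rewrite expr1n mul1r sqr_sqrtr; last first.
    rewrite -/cv (_ : _ + _ = b ^+ 2 * vV + b' ^+ 2 * vU); last by rewrite /vV /vU; ring.
    by rewrite addr_ge0// mulr_ge0// sqr_ge0.
  rewrite -/cv (_ : _ + _ = b ^+ 2 * vV + b' ^+ 2 * vU); last by rewrite /vV /vU; ring.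
  move=> <-; apply: eq_Rintegral => x _; congr cos.
  by rewrite /Y /V /U; ring.
have d20 : 0 < 2 * delta by rewrite mulr_gt0.
have [n [t [n0 nt nx nw]]] := fejer_scale vV0 d20.
have [n' [t' [n'0 nt' nx' nw']]] := fejer_scale vU0 d20.
have := small_ball2 mV mU char (2 * z) n0 n'0 nt nt'.
set S := [set x | _ /\ _] => hS.
have mS : measurable [set w | (`|Z u w - z| <= delta)%R /\ (`|Z v w - z| <= delta)%R].
  have mZ (x : I) : measurable [set w | (`|Z x w - z| <= delta)%R].
    rewrite -[X in measurable X]setTI.
    have mZx : measurable_fun [set: T] (Z x) by exact: measurable_funPT.
    exact: (mZx measurableT _ (measurable_normle z delta)).
  exact: (measurableI _ _ (mZ u) (mZ v)).
have mS' : measurable S.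
  have mf (k : nat) (b : R) (f : T -> R) : measurable_fun [set: T] f ->
      measurable [set x | (k%:R * `|b * f x| <= 1)%R].
    move=> mf; have m1 : measurable_fun [set: T] (fun x => k%:R * `|b * f x|).
      apply: measurable_funM => //; apply: measurableT_comp => //.
      exact: measurable_funM.
    rewrite (_ : [set x | _] = (fun x => k%:R * `|b * f x|) @^-1` `]-oo, 1%R]); last first.
      by apply/seteqP; split => x /=; rewrite in_itv.
    by rewrite -[X in measurable X]setTI; exact: m1.
  have m1 := mf n t V mV.
  have m2 := mf n' t' (fun x => U x - 2 * z) (measurable_funB mU (measurable_cst _)).
  exact: (measurableI _ _ m1 m2).
apply: (@le_trans _ _ (P S)).
  apply: le_measure; rewrite ?inE//.
  move=> w [h1 h2]; split.
    apply: nx; rewrite /V (_ : _ - _ = (Z u w - z) - (Z v w - z)); last by ring.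
    by apply: (le_trans (ler_normB _ _)); rewrite mulr2n mulrDl mul1r lerD.
  apply: nx'; rewrite /U (_ : _ - _ = (Z u w - z) + (Z v w - z)); last by ring.
  by apply: (le_trans (ler_normD _ _)); rewrite mulr2n mulrDl mul1r lerD.
apply: (le_trans hS); rewrite lee_fin -/C.
have b1 : r / (4 * delta) <= n%:R.
  case: hr => hr.
    apply: (@le_trans _ _ 1); last by rewrite ler1n.
    rewrite ler_pdivrMr ?mulr_gt0// mul1r; apply: (le_trans hr).
    by rewrite ler_peMl// ?ltW// ltr1n.
  apply: le_trans nw; rewrite mulrA -natrM ler_wpM2r//; first by rewrite invr_ge0 mulr_ge0// ltW.
  rewrite -[r]gtr0_norm// -sqrtr_sqr; exact: ler_wsqrtr.
have b2 : sigma / (4 * delta) <= n'%:R.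
  apply: le_trans nw'; rewrite mulrA -natrM ler_wpM2r//; first by rewrite invr_ge0 mulr_ge0// ltW.
  rewrite -[sigma]gtr0_norm// -sqrtr_sqr; apply: ler_wsqrtr.
  by rewrite /vU; have := sqr_ge0 sigma; lra.
rewrite (_ : C * 4 * (4 / sigma) * delta ^+ 2 / r = C / ((r / (4 * delta)) * (sigma / (4 * delta)))); last first.
  by field; rewrite !gt_eqF.
have d40 : 0 < 4 * delta by rewrite mulr_gt0.
rewrite ler_wpM2l ?(ltW C0)// lef_pV2 ?posrE ?mulr_gt0 ?ltr0n ?invr_gt0//.
by apply: ler_pM => //; rewrite divr_ge0 ?mulr_ge0// ltW.
Qed.

Lemma pair_tail_le (Z : I -> {RV P >-> R}) (u v : I) (l tau : R) :
  pair_law P (fun u => Z u) -> 0 < l -> 0 < tau ->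
  2 * (sigma ^+ 2 - cov (u.1 - v.1) (u.2 - v.2)) <= tau ^+ 2 ->
  (P [set w | (l * tau <= `|Z u w - Z v w|)%R] <= (2 * expR (- (l ^+ 2 / 2)))%:E)%E.
Proof.
move=> Zl l0 tau0 htau.
have cv1 : cov (u.1 - v.1) (u.2 - v.2) <= sigma ^+ 2 by exact: space_time_cov_le.
have mY : measurable_fun [set: T] (fun w => Z u w - Z v w) by exact: measurable_funB.
have lawY (B : set R) : measurable B -> P [set w | B (Z u w - Z v w)] =
    gaussian_law 0 (Num.sqrt (2 * (sigma ^+ 2 - cov (u.1 - v.1) (u.2 - v.2)))) B.
  move=> mB; have := Zl u v 1 (-1) B mB.
  rewrite (_ : _ + _ = 2 * (sigma ^+ 2 - cov (u.1 - v.1) (u.2 - v.2))); last by ring.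
  by move=> <-; congr (P _); apply/seteqP; split => w /=; rewrite mul1r mulN1r.
have := @normal_tail _ _ _ _ _ _ lawY l tau l0 tau0.
by apply; rewrite sqr_sqrtr// mulr_ge0// subr_ge0.
Qed.

Lemma field_ball_ge (B : R) : exists2 k : R, 0 < k &
  forall (Z : I -> {RV P >-> R}), pair_law P (fun u => Z u) ->
  forall (u : I) (z delta : R), `|z| <= B -> 0 <= delta <= 1 ->
  ((k * delta)%:E <= P [set w | (`|Z u w - z| <= delta)%R])%E.
Proof.
have s0 : sigma != 0 by rewrite gt_eqF.
have [k k0 kP] := gaussian_law_ball_ge B s0; exists k => // Z Zl u z delta zB d01.
apply: (le_trans (kP z delta zB d01)).
have := Zl u u 1 0 _ (measurable_normle z delta).
rewrite expr1n expr0n addr0 !mulr0 mul1r mul0r addr0 -gaussian_law_norm => <-.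
rewrite le_eqVlt; apply/orP; left; apply/eqP; congr (P _).
by apply/seteqP; split => w /=; rewrite mul1r mul0r addr0.
Qed.

End field_probabilities.

(** * Mass and energy on grids *)

Section kernel_sums.
Context {R : realType}.

(** Bernoulli's inequality for a fractional exponent, by weighted concavity of the logarithm:
    [ln v <= v - 1] is applied at [x / y] and [1 / y], where [y] is the right-hand side, with
    weights [b] and [1 - b]. *)
Lemma powR_bernoulli (x b : R) : 0 < x -> 0 <= b <= 1 -> x `^ b <= 1 + b * (x - 1).
Proof.
move=> x0 /andP[b0 b1].
have y0 : 0 < 1 + b * (x - 1).
  have [b1'|b1'] := eqVneq b 1; first by rewrite b1' mul1r addrC subrK.
  have : 0 < (1 - b) + b * x by rewrite ltr_wpDr ?mulr_ge0 ?(ltW x0)// subr_gt0 lt_neqAle b1' b1.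
  by move=> h; apply: (lt_le_trans h); lra.
set y := 1 + _ in y0 *.
rewrite /powR gt_eqF// -[leRHS](lnK (_ : y \in Num.pos)) ?posrE// ler_expR.
have l1 : ln (x / y) <= x / y - 1.
  have := @le_ln1Dx R (x / y - 1); rewrite (addrC 1) subrK; apply.
  by rewrite ltrBrDr addNr divr_gt0.
have l2 : ln (1 / y) <= 1 / y - 1.
  have := @le_ln1Dx R (1 / y - 1); rewrite (addrC 1) subrK; apply.
  by rewrite ltrBrDr addNr divr_gt0.
rewrite ln_div ?posrE// in l1; rewrite ln_div ?posrE// ln1 in l2.
have h : b * (ln x - ln y) + (1 - b) * (0 - ln y) <= b * (x / y - 1) + (1 - b) * (1 / y - 1).
  by apply: lerD; rewrite ler_wpM2l// subr_ge0.
have e : b * (x / y - 1) + (1 - b) * (1 / y - 1) = 0.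
  rewrite (_ : _ + _ = (1 + b * (x - 1)) / y - 1); last by field; rewrite gt_eqF.
  by rewrite -/y divff ?subrr// gt_eqF.
rewrite e in h; lra.
Qed.

(** Comparison with the integral of [x^(-b)]; the induction step is [powR_bernoulli] at
    [n / (n + 1)] with exponent [1 - b], which is why [n = 0] is set apart. *)
Lemma sum_powRN_le (b : R) (n : nat) : 0 <= b < 1 ->
  (1 - b) * \sum_(i < n) (i.+1%:R : R) `^ (- b) <= n%:R `^ (1 - b).
Proof.
move=> /andP[b0 b1]; elim: n => [|n IHn].
  by rewrite big_ord0 mulr0 powR_ge0.
rewrite big_ord_recr/= mulrDr; apply: (le_trans (lerD IHn (lexx _))).
have [->|n0] := eqVneq n 0%N.
  rewrite powR0 ?subr_eq0 ?gt_eqF// add0r !powR1 mulr1.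
  by rewrite lerBlDl lerDr.
have n0' : 0 < (n%:R : R) by rewrite ltr0n lt0n.
have nS0 : 0 < (n.+1%:R : R) by rewrite ltr0n.
have := @powR_bernoulli (n%:R / n.+1%:R) (1 - b) _ _.
have -> : (n%:R / n.+1%:R : R) - 1 = - n.+1%:R^-1.
  by rewrite -natr1; field; rewrite natr1 gt_eqF.
move=> /(_ (divr_gt0 n0' nS0)) h.
have {}h : (n%:R / n.+1%:R : R) `^ (1 - b) <= 1 + (1 - b) * (- n.+1%:R^-1).
  by apply: h; apply/andP; split; lra.
rewrite powRM ?invr_ge0 ?ler0n// in h.
have e1 : (n.+1%:R^-1 : R) `^ (1 - b) = (n.+1%:R `^ (1 - b))^-1.
  by rewrite -powR_inv1 ?ler0n// -powRrM mulN1r powRN.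
rewrite e1 ler_pdivrMr ?powR_gt0// in h.
have e2 : n.+1%:R `^ (- b) = n.+1%:R `^ (1 - b) / n.+1%:R :> R.
  rewrite [in LHS](_ : - b = (1 - b) - 1); last by lra.
  by rewrite (@powRB _ _ (1 - b) 1) ?powRr1 ?ler0n// (gt_eqF nS0) implybT.
rewrite e2; apply: (le_trans (lerD h (lexx _))).
by rewrite le_eqVlt; apply/orP; left; apply/eqP; ring.
Qed.

(* Truncated below so that the kernels [ngap `^ (- s)] are finite on the diagonal. *)
Definition gap (k l : nat) : nat := maxn 1 (maxn (k - l) (l - k)).

Lemma gap_gt0 k l : (0 < gap k l)%N. Proof. by rewrite leq_max. Qed.

Lemma gap_le m (k l : 'I_m) : (gap k l <= m)%N.
Proof.
rewrite !geq_max (leq_trans (leq_subr _ _) (ltnW (ltn_ord k))).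
rewrite (leq_trans (leq_subr _ _) (ltnW (ltn_ord l))) !andbT.
exact: leq_ltn_trans (ltn_ord k).
Qed.

Definition ngap (m : nat) (k l : nat) : R := (gap k l)%:R / m%:R.

Lemma ngap_gt0 m (k l : 'I_m) : 0 < ngap m k l.
Proof.
rewrite divr_gt0 ?ltr0n ?gap_gt0//; exact: leq_ltn_trans (ltn_ord k).
Qed.

Lemma ngap_le1 m (k l : 'I_m) : ngap m k l <= 1.
Proof.
have m0 : (0 < m)%N by exact: leq_ltn_trans (ltn_ord k).
by rewrite ler_pdivrMr ?ltr0n// mul1r ler_nat gap_le.
Qed.

Lemma sum_gap_le (f : nat -> R) (m : nat) (k : 'I_m) : (forall i, 0 <= f i) ->
  \sum_(l < m) f (gap k l) <= 3 * \sum_(i < m) f i.+1.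
Proof.
move=> f0.
have m0 : (0 < m)%N by exact: leq_ltn_trans (ltn_ord k).
have F0 (n : nat) : (n <= m)%N -> \sum_(0 <= i < n) f i.+1 <= \sum_(0 <= i < m) f i.+1.
  by move=> nm; rewrite [leRHS](big_cat_nat _ nm)//= lerDl sumr_ge0.
rewrite -!(big_mkord xpredT (fun i => f i.+1)) -(big_mkord xpredT (fun l => f (gap k l))).
rewrite (big_cat_nat _ (ltnW (ltn_ord k)))//= (big_ltn (ltn_ord k)).
(* Indices below [k], [k] itself, indices above [k]: each part is dominated by the one-sided sum. *)
have -> : 3 = 1 + (1 + 1) :> R by lra.
rewrite !mulrDl !mul1r; apply: lerD; last apply: lerD.
- rewrite big_nat_rev/= add0n; apply: le_trans (F0 k (ltnW (ltn_ord k))).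
  apply: ler_sum_nat => i /andP[_ ik].
  have -> : gap k (k - i.+1) = i.+1 by rewrite /gap; lia.
  by [].
- have -> : gap k k = 1%N by rewrite /gap; lia.
  apply: le_trans (F0 1%N m0).
  by rewrite big_nat1.
- rewrite -[k.+1]add0n big_addn; apply: le_trans (F0 _ (leq_subr k.+1 m)).
  apply: ler_sum_nat => i /andP[_ ik].
  have -> : gap k (i + k.+1) = i.+1 by rewrite /gap; lia.
  by [].
Qed.

Lemma sum_ngap_le (b : R) (m : nat) : 0 <= b < 1 ->
  \sum_(k < m) \sum_(l < m) (ngap m k l) `^ (- b) <= 3 / (1 - b) * m%:R ^+ 2.
Proof.
move=> b01; have /andP[b0 b1] := b01.
have [->|m0] := posnP m; first by rewrite big_ord0 expr0n mulr0.
have m0' : 0 < (m%:R : R) by rewrite ltr0n.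
have b1' : 0 < 1 - b by rewrite subr_gt0.
have row (k : 'I_m) : \sum_(l < m) (ngap m k l) `^ (- b) <= 3 / (1 - b) * m%:R.
  have e (n : nat) : (n%:R / m%:R : R) `^ (- b) = m%:R `^ b * n%:R `^ (- b).
    rewrite powRM ?invr_ge0 ?ler0n// mulrC; congr (_ * _).
    by rewrite -powR_inv1 ?ler0n// -powRrM mulrNN mul1r.
  apply: (le_trans (@sum_gap_le (fun n => (n%:R / m%:R) `^ (- b)) m k _)).
    by move=> i; exact: powR_ge0.
  under eq_bigr do rewrite e.
  rewrite -mulr_sumr -mulrA ler_wpM2l//.
  rewrite ler_pdivlMl// mulrCA; apply: (@le_trans _ _ (m%:R `^ b * m%:R `^ (1 - b))).
    by rewrite ler_wpM2l ?powR_ge0// sum_powRN_le.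
  by rewrite -powRD ?(gt_eqF m0') ?implybT// addrCA subrr addr0 powRr1 ?ler0n.
apply: (@le_trans _ _ (\sum_(k < m) 3 / (1 - b) * m%:R)).
  by apply: ler_sum => k _; exact: row.
by rewrite sumr_const card_ord -[leLHS]mulr_natr expr2 !mulrA.
Qed.

End kernel_sums.

Section grid.
Context {R : realType}.
Variables (d m : nat).

Definition grid := ({ffun 'I_d -> 'I_m} * 'I_m)%type.

Definition gridpt (k : grid) : 'rV[R]_d * R :=
  (\row_i ((k.1 i)%:R / m%:R), k.2%:R / m%:R).

Definition gdist (k l : grid) : R :=
  ngap m k.2 l.2 + \sum_(i < d) ngap m (k.1 i) (l.1 i).

Lemma gdist_ge_time (k l : grid) : ngap m k.2 l.2 <= gdist k l.
Proof. by rewrite lerDl sumr_ge0// => i _; rewrite ltW// ngap_gt0. Qed.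

Lemma gdist_ge_space (k l : grid) i : ngap m (k.1 i) (l.1 i) <= gdist k l.
Proof.
rewrite /gdist (bigD1 i)//= addrCA lerDl addr_ge0//.
  by rewrite ltW// ngap_gt0.
by rewrite sumr_ge0// => j _; rewrite ltW// ngap_gt0.
Qed.

Lemma gdist_gt0 (k l : grid) : 0 < gdist k l.
Proof. by apply: lt_le_trans (gdist_ge_time k l); exact: ngap_gt0. Qed.

Lemma gdist_le (k l : grid) : gdist k l <= d.+1%:R.
Proof.
rewrite -natr1 addrC; apply: lerD; first exact: ngap_le1.
apply: (@le_trans _ _ (\sum_(i < d) 1)); last by rewrite sumr_const card_ord.
by apply: ler_sum => i _; exact: ngap_le1.
Qed.

Lemma sum_grid_prod (F G : 'I_m -> 'I_m -> R) :
  \sum_(k : grid) \sum_(l : grid) (F k.2 l.2 * \prod_(i < d) G (k.1 i) (l.1 i)) =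
  (\sum_(i < m) \sum_(j < m) F i j) * (\sum_(i < m) \sum_(j < m) G i j) ^+ d.
Proof.
have row (k : grid) : \sum_(l : grid) (F k.2 l.2 * \prod_(i < d) G (k.1 i) (l.1 i)) =
   (\prod_(i < d) \sum_(j < m) G (k.1 i) j) * (\sum_(j < m) F k.2 j).
  rewrite (bigA_distr_bigA (fun i j => G (k.1 i) j))/= big_distrlr/= pair_big/=.
  by apply: eq_bigr => l _; rewrite mulrC.
under eq_bigr do rewrite row.
rewrite -(pair_big xpredT xpredT (fun (k1 : {ffun 'I_d -> 'I_m}) (k2 : 'I_m) =>
  (\prod_(i < d) \sum_(j < m) G (k1 i) j) * (\sum_(j < m) F k2 j)))/=.
rewrite -big_distrlr/= mulrC; congr (_ * _).
rewrite -(bigA_distr_bigA (fun _ j => \sum_(l < m) G j l))/=.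
by rewrite prodr_const card_ord.
Qed.

End grid.

Section probability_tools.
Context (disp : measure_display) (T : measurableType disp) (R : realType)
  (P : probability T R).

Lemma expectation_sum_indic (J : finType) (k : J -> R) (A : J -> set T) :
  (forall i, 0 <= k i) -> (forall i, measurable (A i)) ->
  (\int[P]_w (\sum_i k i * \1_(A i) w)%:E = (\sum_i k i * fine (P (A i)))%:E)%E.
Proof.
move=> k0 mA.
under eq_integral do rewrite -sumEFin.
rewrite ge0_integral_sum//; last 2 first.
- by move=> i; apply/measurable_EFinP; apply: measurable_funM => //; exact: measurable_indic.
- by move=> i w _; rewrite lee_fin mulr_ge0.
rewrite -sumEFin; apply: eq_bigr => i _.
under eq_integral do rewrite EFinM.
rewrite ge0_integralZl_EFin//; last first.
  by apply/measurable_EFinP; exact: measurable_indic.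
by rewrite integral_indic// setIT EFinM fineK// fin_num_measure.
Qed.

Lemma measurable_sum_indic (J : finType) (k : J -> R) (A : J -> set T) :
  (forall i, measurable (A i)) ->
  measurable_fun [set: T] (fun w => \sum_i k i * \1_(A i) w).
Proof.
move=> mA; apply: measurable_sum => i.
by apply: measurable_funM => //; exact: measurable_indic.
Qed.

Lemma measurable_set_ge (f : T -> R) (b : R) : measurable_fun [set: T] f ->
  measurable [set w | b <= f w].
Proof.
move=> mf; rewrite (_ : [set w | _] = f @^-1` `[b, +oo[%classic); last first.
  by apply/seteqP; split => w /=; rewrite in_itv/= andbT.
by rewrite -[X in measurable X]setTI; exact: mf.
Qed.

Lemma fine_markov (f : T -> R) (L K : R) : measurable_fun [set: T] f ->
  (forall w, 0 <= f w) -> 0 < L -> (\int[P]_w (f w)%:E <= K%:E)%E ->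
  (P [set w | (L <= f w)%R] <= (K / L)%:E)%E.
Proof.
move=> mf f0 L0 fK.
have mS := measurable_set_ge L mf.
have : (L%:E * P [set w | (L <= f w)%R] <= K%:E)%E.
  apply: le_trans fK.
  rewrite -[X in P X](setIT) -integral_indic// -ge0_integralZl_EFin//; last 2 first.
  - by apply/measurable_EFinP; exact: measurable_indic.
  - exact: ltW.
  apply: ge0_le_integral => //.
  - by move=> w _; rewrite -EFinM lee_fin mulr_ge0// ltW.
  - by apply: emeasurable_funM => //; apply/measurable_EFinP; exact: measurable_indic.
  - exact/measurable_EFinP.
  - move=> w _; rewrite -EFinM lee_fin indicE.
    have [|_] := boolP (w \in _); last by rewrite mulr0.
    by rewrite inE mulr1.
rewrite -(fineK (fin_num_measure P _ mS)) -EFinM !lee_fin.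
by rewrite ler_pdivlMr// mulrC.
Qed.

(** Paley-Zygmund with the second moment replaced by a dominating [g]. On the event,
    [f <= t/2 * f^2 + 1/(2 t)]; off it, [f < k/2]. Integrating, with [t] chosen so that the
    quadratic part contributes [k/4], leaves [k/4] to be paid by the probability. *)
Lemma paley_zygmund (f g : T -> R) (k Q K : R) :
  measurable_fun [set: T] f -> measurable_fun [set: T] g ->
  (forall w, 0 <= f w) -> (forall w, 0 <= g w) -> 0 < k -> 0 < Q -> 0 < K ->
  (forall w, f w ^+ 2 <= Q * g w) ->
  (k%:E <= \int[P]_w (f w)%:E)%E -> (\int[P]_w (g w)%:E <= K%:E)%E ->
  ((k ^+ 2 / (4 * (Q * K)))%:E <= P [set w | (k / 2 <= f w)%R])%E.
Proof.
move=> mf mg f0 g0 k0 Q0 K0 fg kf gK.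
have mS := measurable_set_ge (k / 2) mf.
set S := [set w | _] in mS *.
have QK0 : 0 < Q * K by exact: mulr_gt0.
pose t := k / (2 * (Q * K)).
have t0 : 0 < t by rewrite /t divr_gt0// mulr_gt0.
pose h w := k / 2 + (t / 2 * Q) * g w + (2 * t)^-1 * \1_S w.
have fh w : f w <= h w.
  rewrite /h indicE; have [wS|wS] := boolP (w \in S).
    rewrite mulr1.
    have h1 : f w <= t / 2 * (Q * g w) + (2 * t)^-1.
      apply: (@le_trans _ _ (t / 2 * f w ^+ 2 + (2 * t)^-1)); last first.
        by rewrite lerD2r ler_wpM2l// ltW// divr_gt0.
      rewrite -subr_ge0 (_ : _ - _ = t / 2 * (f w - t^-1) ^+ 2); last first.
        by field; rewrite gt_eqF.
      by rewrite mulr_ge0 ?sqr_ge0// ltW// divr_gt0.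
    by apply: (le_trans h1); rewrite mulrA -[leRHS]addrA lerDr ltW// divr_gt0.
  rewrite mulr0 addr0; move: wS; rewrite notin_setE /= => /negP; rewrite -ltNge => fk.
  apply: (le_trans (ltW fk)); rewrite lerDl mulr_ge0// mulr_ge0 ?(ltW Q0)//.
  by rewrite ltW// divr_gt0.
have fin : P S \is a fin_num by rewrite fin_num_measure.
have c0 : 0 <= t / 2 * Q by rewrite ltW// mulr_gt0// divr_gt0.
have i0 : 0 <= (2 * t)^-1 by rewrite invr_ge0 mulr_ge0// ltW.
have k20 : 0 <= k / 2 by rewrite ltW// divr_gt0.
have : (k%:E <= (k / 2 + t / 2 * Q * K + (2 * t)^-1 * fine (P S))%:E)%E.
  apply: (le_trans kf).
  apply: (@le_trans _ _ (\int[P]_w (h w)%:E)%E).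
    apply: ge0_le_integral => //.
    - by move=> w _; rewrite lee_fin.
    - exact/measurable_EFinP.
    - apply/measurable_EFinP; apply: measurable_funD.
        by apply: measurable_funD => //; exact: measurable_funM.
      by apply: measurable_funM => //; exact: measurable_indic.
    - by move=> w _; rewrite lee_fin.
  rewrite /h; under eq_integral do rewrite 2!EFinD.
  rewrite ge0_integralD//; last 4 first.
  - by move=> w _; rewrite -EFinD lee_fin addr_ge0// mulr_ge0.
  - apply: emeasurable_funD => //; apply/measurable_EFinP.
    exact: measurable_funM.
  - by move=> w _; rewrite lee_fin mulr_ge0.
  - by apply/measurable_EFinP; apply: measurable_funM => //; exact: measurable_indic.
  rewrite ge0_integralD//; last 2 first.
  - by move=> w _; rewrite lee_fin mulr_ge0.
  - by apply/measurable_EFinP; exact: measurable_funM.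
  have -> : (\int[P]__ (k / 2)%:E = (k / 2)%:E)%E.
    by rewrite (@integral_cst _ _ _ P setT measurableT)/= probability_setT mule1.
  have -> : (\int[P]_w (t / 2 * Q * g w)%:E = (t / 2 * Q)%:E * \int[P]_w (g w)%:E)%E.
    under eq_integral do rewrite EFinM.
    rewrite ge0_integralZl_EFin//.
    - by move=> w _; rewrite lee_fin.
    - exact/measurable_EFinP.
  have -> : (\int[P]_w ((2 * t)^-1 * \1_S w)%:E = ((2 * t)^-1)%:E * (fine (P S))%:E)%E.
    under eq_integral do rewrite EFinM.
    rewrite ge0_integralZl_EFin//; last by apply/measurable_EFinP; exact: measurable_indic.
    by rewrite integral_indic// setIT fineK.
  rewrite EFinD EFinD (EFinM (t / 2 * Q)) (EFinM (2 * t)^-1).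
  by rewrite leeD2r// leeD2l// lee_wpmul2l ?lee_fin.
rewrite lee_fin -(fineK fin) lee_fin => hk.
have h2 : t / 2 * Q * K = k / 4 by rewrite /t; field; rewrite !gt_eqF.
rewrite h2 in hk.
have h3 : k / 4 <= (2 * t)^-1 * fine (P S) by lra.
rewrite ler_pdivlMl in h3; last by rewrite mulr_gt0.
apply: le_trans h3.
by rewrite le_eqVlt; apply/orP; left; apply/eqP; rewrite /t; field; rewrite !gt_eqF.
Qed.

Lemma limsup_measure_ge (A : (set T)^nat) (q : R) : (forall n, measurable (A n)) ->
  (forall n, (q%:E <= P (A n))%E) ->
  (q%:E <= P (\bigcap_n \bigcup_(m in [set m | (n <= m)%N]) A m))%E.
Proof.
move=> mA qA; pose B n := \bigcup_(m in [set m | (n <= m)%N]) A m.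
have mB n : measurable (B n) by exact: bigcup_measurable.
have cB : P (B n) @[n --> \oo] --> P (\bigcap_n B n).
  apply: nonincreasing_cvg_mu => //.
  - by rewrite -ge0_fin_numE// fin_num_measure.
  - exact: bigcap_measurable.
  - move=> m n mn; apply/subsetPset => w [k /= nk Ak]; exists k => //=.
    exact: leq_trans nk.
rewrite -(cvg_lim _ cB)//; apply: lime_ge.
  by apply/cvg_ex; exists (P (\bigcap_n B n)).
apply: nearW => n; apply: (le_trans (qA n)); apply: le_measure; rewrite ?inE//.
by move=> w Aw; exists n => //=.
Qed.

End probability_tools.

Section energy.
Context (R : realType) (d p : nat) (alpha gamma : R).
Hypotheses (alpha01 : 0 < alpha <= 1) (gamma01 : 0 < gamma <= 1).
Context (disp : measure_display) (T : measurableType disp) (P : probability T R).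
Local Notation I := ('rV[R]_d * R)%type.
Variables (Xs : 'I_p -> I -> {RV P >-> R}) (z : 'rV[R]_p).

Definition hit (u : I) (delta : R) : set T :=
  [set w | forall j : 'I_p, `|Xs j u w - z ord0 j| <= delta].

Lemma measurable_hit u delta : measurable (hit u delta).
Proof.
rewrite (_ : hit u delta = \bigcap_(j in [set: 'I_p]) [set w | `|Xs j u w - z ord0 j| <= delta]); last first.
  by apply/seteqP; split => [w h j _|w h j]; exact: h.
apply: fin_bigcap_measurable => // j _.
rewrite -[X in measurable X]setTI.
have mX : measurable_fun [set: T] (Xs j u) by exact: measurable_funPT.
exact: (mX measurableT _ (measurable_normle _ _)).
Qed.

Let theta := Num.min alpha gamma.
(** With this radius [(1/m)^alpha] and [(1/m)^gamma] are at most [level m], so the gap [1/m] that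
    stands in for a zero coordinate difference falls under the alternative [r <= delta] of the
    two-point bound. *)
Definition level (m : nat) : R := m%:R `^ (- theta).

(* The normalized number of grid points at which the field is close to [z], and the energy
   of the corresponding measure. *)
Definition mass (m : nat) (w : T) : R :=
  \sum_(k : grid d m) (m%:R ^+ d.+1 * level m ^+ p)^-1 *
    \1_(hit (gridpt k) (level m)) w.

Definition energy (s : R) (m : nat) (w : T) : R :=
  \sum_(k : grid d m * grid d m)
    ((m%:R ^+ d.+1 * level m ^+ p) ^+ 2)^-1 * gdist k.1 k.2 `^ (- s) *
    \1_(hit (gridpt k.1) (level m) `&` hit (gridpt k.2) (level m)) w.

Lemma level_gt0 m : (0 < m)%N -> 0 < level m.
Proof. by move=> m0; rewrite powR_gt0// ltr0n. Qed.

Lemma level_le1 m : (0 < m)%N -> level m <= 1.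
Proof.
move=> m0; rewrite /level powRN invf_le1 ?powR_gt0 ?ltr0n//.
have := @ler_powR R m%:R _ 0 theta; rewrite powRr0; apply; first by rewrite ler1n.
by rewrite /theta le_min; case/andP: alpha01 => /ltW ->; case/andP: gamma01 => /ltW ->.
Qed.

Lemma mass_ge0 m w : 0 <= mass m w.
Proof.
apply: sumr_ge0 => k _; rewrite mulr_ge0// invr_ge0 mulr_ge0 ?exprn_ge0//.
exact: powR_ge0.
Qed.

Lemma energy_ge0 s m w : 0 <= energy s m w.
Proof.
apply: sumr_ge0 => k _; rewrite mulr_ge0// mulr_ge0 ?powR_ge0// invr_ge0.
exact: sqr_ge0.
Qed.

Lemma measurable_mass m : measurable_fun [set: T] (mass m).
Proof. by apply: measurable_sum_indic => k; exact: measurable_hit. Qed.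

Lemma measurable_energy s m : measurable_fun [set: T] (energy s m).
Proof.
apply: measurable_sum_indic => k.
by apply: measurableI; exact: measurable_hit.
Qed.

(** The kernel is bounded below because [gdist] never exceeds [d + 1]; the energy bound thus doubles
    as the second-moment bound in Paley-Zygmund. *)
Lemma mass_sqr_le s m w : 0 <= s ->
  mass m w ^+ 2 <= d.+1%:R `^ s * energy s m w.
Proof.
move=> s0; rewrite /mass expr2 big_distrlr/= pair_big/= /energy mulr_sumr.
apply: ler_sum => -[k l] _ /=.
set c := (m%:R ^+ d.+1 * level m ^+ p).
set G := gdist k l.
have G0 : 0 < G by exact: gdist_gt0.
have Gd : G <= d.+1%:R by exact: gdist_le.
have e : \1_(hit (gridpt k) (level m)) w * \1_(hit (gridpt l) (level m)) w =
    \1_(hit (gridpt k) (level m) `&` hit (gridpt l) (level m)) w :> R.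
  by rewrite indicI.
rewrite -e; set x := \1__ _; set y := \1__ _.
rewrite (_ : c^-1 * x * (c^-1 * y) = (c ^+ 2)^-1 * (x * y)); last first.
  by rewrite -exprVn; ring.
rewrite (_ : _ * (_ * (x * y)) = (c ^+ 2)^-1 * (x * y) * (d.+1%:R `^ s * G `^ (- s))); last by ring.
rewrite ler_peMr//.
  by rewrite mulr_ge0 ?invr_ge0 ?sqr_ge0// mulr_ge0 ?/x ?/y.
rewrite powRN ler_pdivlMr ?powR_gt0// mul1r.
by apply: ge0_ler_powR; rewrite ?nnegrE ?ler0n// ltW.
Qed.

Lemma gridpt_time_gap m (k l : grid d m) : k.2 != l.2 ->
  `|(@gridpt R d m k).2 - (gridpt l).2| = ngap m k.2 l.2.
Proof.
move=> kl; rewrite /= -mulrBl normrM [X in _ * X]ger0_norm ?invr_ge0//.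
rewrite /ngap; congr (_ / _).
have [h|h] := leqP k.2 l.2.
  rewrite distrC -natrB// normr_nat; congr (_%:R).
  by rewrite /gap; have : (k.2 : nat) != l.2 by []; lia.
rewrite -natrB ?(ltnW h)// normr_nat; congr (_%:R).
by rewrite /gap; lia.
Qed.

Lemma gridpt_space_gap m (k l : grid d m) i : k.1 i != l.1 i ->
  `|(@gridpt R d m k).1 ord0 i - (gridpt l).1 ord0 i| = ngap m (k.1 i) (l.1 i).
Proof.
move=> kl; rewrite /= !mxE -mulrBl normrM [X in _ * X]ger0_norm ?invr_ge0//.
rewrite /ngap; congr (_ / _).
have [h|h] := leqP (k.1 i) (l.1 i).
  rewrite distrC -natrB// normr_nat; congr (_%:R).
  by rewrite /gap; have : (k.1 i : nat) != l.1 i by []; lia.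
rewrite -natrB ?(ltnW h)// normr_nat; congr (_%:R).
by rewrite /gap; lia.
Qed.

Variables (K1 K2 : R).
Hypotheses (K10 : 0 < K1) (K20 : 0 < K2).
Hypothesis one_hit : forall u delta, 0 <= delta <= 1 ->
  (((K1 * delta) ^+ p)%:E <= P (hit u delta))%E.
Hypothesis two_hits : forall (u v : I) delta r, 0 < delta -> 0 < r ->
  `|u.2 - v.2| <= 1 -> (forall i, `|u.1 ord0 i - v.1 ord0 i| <= 1) ->
  [\/ r <= delta, r <= `|u.2 - v.2| `^ alpha |
     exists i, r <= `|u.1 ord0 i - v.1 ord0 i| `^ gamma] ->
  (P (hit u delta `&` hit v delta) <= ((K2 * delta ^+ 2 / r) ^+ p)%:E)%E.

Lemma mass_expectation m : (0 < m)%N ->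
  ((K1 ^+ p)%:E <= \int[P]_w (mass m w)%:E)%E.
Proof.
move=> m0; have l0 := level_gt0 m0.
rewrite expectation_sum_indic; last 2 first.
- by move=> k; rewrite invr_ge0 mulr_ge0 ?exprn_ge0// ltW.
- by move=> k; exact: measurable_hit.
rewrite lee_fin -mulr_sumr ler_pdivlMl; last by rewrite mulr_gt0 ?exprn_gt0// ltr0n.
apply: (@le_trans _ _ (\sum_(k : grid d m) (K1 * level m) ^+ p)).
  rewrite sumr_const card_prod card_ffun !card_ord -expnSr exprMn -[leRHS]mulr_natl natrX.
  by rewrite le_eqVlt; apply/orP; left; apply/eqP; ring.
apply: ler_sum => k _; rewrite -lee_fin fineK ?fin_num_measure//; last exact: measurable_hit.
by apply: one_hit; rewrite ltW//= level_le1.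
Qed.

Variables (s0 s1 p0 p1 : R).
Hypotheses (s00 : 0 <= s0) (s10 : 0 <= s1) (p00 : 0 <= p0) (p10 : 0 <= p1).
Hypothesis psum : p0 + d%:R * p1 = p%:R.
Let s := s0 + d%:R * s1.

(* The exponents s = s0 + d s1 and p = p0 + d p1 are distributed over the coordinates,
   which bounds the kernel by a product of one-dimensional kernels. *)
Lemma pair_kernel_le m (k l : grid d m) : (0 < m)%N ->
  fine (P (hit (gridpt k) (level m) `&` hit (gridpt l) (level m))) *
    gdist k l `^ (- s) <=
  (K2 * level m ^+ 2) ^+ p * (ngap m k.2 l.2 `^ (- (s0 + alpha * p0)) *
    \prod_(i < d) ngap m (k.1 i) (l.1 i) `^ (- (s1 + gamma * p1))).
Proof.
move=> m0; have l0 := level_gt0 m0.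
have [alpha0 alpha1] := andP alpha01; have [gamma0 gamma1] := andP gamma01.
have m0' : 0 < (m%:R : R) by rewrite ltr0n.
have m1 : 1 <= (m%:R : R) by rewrite ler1n.
(* [r] will be the largest of these coordinate rates. Being attained, it satisfies one of the
   alternatives of [two_hits]; being maximal, its power [p] can be shared among the coordinates. *)
pose phi (i : option 'I_d) : R :=
  if i is Some i then ngap m (k.1 i) (l.1 i) `^ gamma else ngap m k.2 l.2 `^ alpha.
have [i0 _ i0max] := @arg_maxP _ _ _ (None : option 'I_d) xpredT phi isT.
set r := phi i0 in i0max.
have r0 : 0 < r by rewrite /r; case: (i0) => [i|] /=; rewrite powR_gt0// ngap_gt0.
have lev (H : R) : (H = alpha) \/ (H = gamma) -> (m%:R^-1 : R) `^ H <= level m.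
  move=> HH; have thH : theta <= H.
    by case: HH => ->; rewrite /theta ge_min lexx ?orbT.
  rewrite /level -powR_inv1 ?ler0n// -powRrM mulN1r.
  by rewrite ler_powR// lerN2.
have gap1 (a : nat) : gap a a = 1%N by rewrite /gap subnn.
have two := @two_hits (gridpt k) (gridpt l) (level m) r l0 r0.
have dist1 (x : R) (a b : 'I_m) : x = `|(a%:R / m%:R : R) - b%:R / m%:R| -> x <= 1.
  move=> ->; rewrite ler_norml.
  have fr (c : 'I_m) : 0 <= (c%:R / m%:R : R) <= 1.
    by rewrite divr_ge0//= ler_pdivrMr// mul1r ler_nat ltnW.
  by have := fr a; have := fr b; lra.
have hP : (P (hit (gridpt k) (level m) `&` hit (gridpt l) (level m)) <=
    ((K2 * level m ^+ 2 / r) ^+ p)%:E)%E.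
  apply: two.
  - exact: (dist1 _ k.2 l.2).
  - by move=> i; apply: (dist1 _ (k.1 i) (l.1 i)); rewrite !mxE.
  - rewrite /r; case: (i0) => [i|] /=.
      have [kl|kl] := eqVneq (k.1 i) (l.1 i).
        constructor 1; rewrite kl /ngap gap1 mul1r; apply: lev; by right.
      by constructor 3; exists i; rewrite gridpt_space_gap.
    have [kl|kl] := eqVneq k.2 l.2.
      constructor 1; rewrite kl /ngap gap1 mul1r; apply: lev; by left.
    by constructor 2; rewrite -gridpt_time_gap.
have mI : measurable (hit (gridpt k) (level m) `&` hit (gridpt l) (level m)).
  by apply: measurableI; exact: measurable_hit.
have {}hP : fine (P (hit (gridpt k) (level m) `&` hit (gridpt l) (level m))) <=
    (K2 * level m ^+ 2 / r) ^+ p.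
  by rewrite -lee_fin fineK ?fin_num_measure.
set G := gdist k l.
have G0 : 0 < G by exact: gdist_gt0.
apply: (le_trans (ler_wpM2r (powR_ge0 _ _) hP)).
rewrite exprMn -mulrA ler_wpM2l//.
  by rewrite exprn_ge0// mulr_ge0 ?sqr_ge0// ltW.
rewrite exprVn powRN -invfM.
have prV : \prod_(i < d) ngap m (k.1 i) (l.1 i) `^ (- (s1 + gamma * p1)) =
   (\prod_(i < d) ngap m (k.1 i) (l.1 i) `^ (s1 + gamma * p1))^-1 :> R.
  by rewrite -prodfV; apply: eq_bigr => i _; rewrite powRN.
rewrite prV powRN -invfM.
have t0 : 0 < (ngap m k.2 l.2 : R) by exact: ngap_gt0.
have x0 i : 0 < (ngap m (k.1 i) (l.1 i) : R) by exact: ngap_gt0.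
rewrite lef_pV2 ?posrE; last 2 first.
- by rewrite mulr_gt0 ?exprn_gt0 ?powR_gt0.
- by rewrite mulr_gt0 ?powR_gt0// prodr_gt0// => i _; exact: powR_gt0.
have -> : r ^+ p = r `^ p0 * \prod_(i < d) r `^ p1.
  rewrite prodr_const card_ord -powR_mulrn ?(ltW r0)// -psum powRD ?(gt_eqF r0) ?implybT//.
  by rewrite (mulrC d%:R) powRrM powR_mulrn ?powR_ge0.
have -> : G `^ s = G `^ s0 * \prod_(i < d) G `^ s1.
  rewrite prodr_const card_ord /s powRD ?(gt_eqF G0) ?implybT//.
  by rewrite (mulrC d%:R) powRrM powR_mulrn ?powR_ge0.
rewrite mulrACA -big_split/=.
have mono (x y e : R) : 0 <= e -> 0 < x -> x <= y -> x `^ e <= y `^ e.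
  move=> e0 x0' xy; apply: ge0_ler_powR; rewrite ?nnegrE ?(ltW x0')//.
  exact: le_trans (ltW x0') xy.
apply: ler_pM.
- exact: powR_ge0.
- by rewrite prodr_ge0// => i _; exact: powR_ge0.
- rewrite powRD ?(gt_eqF t0) ?implybT// mulrC powRrM.
  apply: ler_pM; rewrite ?powR_ge0//.
    by apply: mono; rewrite ?powR_gt0//; exact: (i0max None).
  by apply: mono => //; exact: gdist_ge_time.
- apply: ler_prod => i _; rewrite powR_ge0/=.
  rewrite powRD ?(gt_eqF (x0 i)) ?implybT// mulrC powRrM.
  apply: ler_pM; rewrite ?powR_ge0//.
    by apply: mono; rewrite ?powR_gt0//; exact: (i0max (Some i)).
  by apply: mono => //; exact: gdist_ge_space.
Qed.

Hypotheses (t1 : s0 + alpha * p0 < 1) (x1 : s1 + gamma * p1 < 1).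

(** The normalization is exactly compensated: its factor [level^(2 p)] by the two-point bound, its
    factor [m^(2 (d + 1))] by the [d + 1] kernel sums, each of order [m^2] because the exponents are
    below 1. *)
Lemma energy_expectation : exists2 C : R, 0 < C & forall m, (0 < m)%N ->
  (\int[P]_w (energy s m w)%:E <= C%:E)%E.
Proof.
have [alpha0 alpha1] := andP alpha01; have [gamma0 gamma1] := andP gamma01.
pose Ct := 3 / (1 - (s0 + alpha * p0)); pose Cx := 3 / (1 - (s1 + gamma * p1)).
have Ct0 : 0 < Ct by rewrite divr_gt0// subr_gt0.
have Cx0 : 0 < Cx by rewrite divr_gt0// subr_gt0.
exists (K2 ^+ p * (Ct * Cx ^+ d)).
  by apply: mulr_gt0; [exact: exprn_gt0|apply: mulr_gt0 => //; exact: exprn_gt0].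
move=> m m0; have l0 := level_gt0 m0.
have m0' : 0 < (m%:R : R) by rewrite ltr0n.
pose N := (m%:R ^+ d.+1 * level m ^+ p) ^+ 2.
have N0 : 0 < N by rewrite exprn_gt0// mulr_gt0 ?exprn_gt0.
rewrite expectation_sum_indic; last 2 first.
- by move=> k; rewrite mulr_ge0 ?powR_ge0// invr_ge0 sqr_ge0.
- by move=> k; apply: measurableI; exact: measurable_hit.
rewrite lee_fin.
rewrite (_ : \sum_i _ = N^-1 * \sum_(k : grid d m * grid d m)
   (fine (P (hit (gridpt k.1) (level m) `&` hit (gridpt k.2) (level m))) *
    gdist k.1 k.2 `^ (- s))); last first.
  by rewrite mulr_sumr; apply: eq_bigr => k _; rewrite -/N; ring.
rewrite ler_pdivrMl//.
apply: (@le_trans _ _ (\sum_(k : grid d m * grid d m) (K2 * level m ^+ 2) ^+ p *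
   (ngap m k.1.2 k.2.2 `^ (- (s0 + alpha * p0)) *
    \prod_(i < d) ngap m (k.1.1 i) (k.2.1 i) `^ (- (s1 + gamma * p1))))).
  by apply: ler_sum => k _; exact: pair_kernel_le.
rewrite -mulr_sumr.
rewrite -(pair_big xpredT xpredT (fun k l : grid d m => ngap m k.2 l.2 `^ (- (s0 + alpha * p0)) *
    \prod_(i < d) ngap m (k.1 i) (l.1 i) `^ (- (s1 + gamma * p1))))/=.
rewrite (sum_grid_prod d (fun i j : 'I_m => ngap m i j `^ (- (s0 + alpha * p0)))
   (fun i j : 'I_m => ngap m i j `^ (- (s1 + gamma * p1)))).
have e0 : 0 <= s0 + alpha * p0 by rewrite addr_ge0// mulr_ge0// ltW.
have e1 : 0 <= s1 + gamma * p1 by rewrite addr_ge0// mulr_ge0// ltW.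
apply: (@le_trans _ _ ((K2 * level m ^+ 2) ^+ p * ((Ct * m%:R ^+ 2) * (Cx * m%:R ^+ 2) ^+ d))).
  rewrite ler_wpM2l ?exprn_ge0 ?mulr_ge0 ?exprn_ge0 ?(ltW K20) ?(ltW l0)//.
  have nn (e : R) : 0 <= \sum_(i < m) \sum_(j < m) (ngap m i j : R) `^ e.
    by apply: sumr_ge0 => i _; apply: sumr_ge0 => j _; exact: powR_ge0.
  apply: ler_pM; rewrite ?exprn_ge0 ?nn//.
    by apply: sum_ngap_le; rewrite e0.
  apply: lerXn2r; rewrite ?nnegrE ?nn//.
    by rewrite mulr_ge0 ?(ltW Cx0)// exprn_ge0 ?(ltW m0').
  by apply: sum_ngap_le; rewrite e1.
rewrite le_eqVlt; apply/orP; left; apply/eqP.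
rewrite /N (exprMn p K2) (exprMn d Cx) (exprAC _ 2%N p) (exprAC _ 2%N d) (exprS _ d).
by move: (K2 ^+ p) (level m ^+ p) (m%:R ^+ d : R) (Cx ^+ d) => a b c e; ring.
Qed.

End energy.

Section lower_event.
Context (R : realType) (d p : nat) (alpha gamma : R).
Hypotheses (alpha01 : 0 < alpha <= 1) (gamma01 : 0 < gamma <= 1).
Context (disp : measure_display) (T : measurableType disp) (P : probability T R).
Local Notation I := ('rV[R]_d * R)%type.
Variables (Xs : 'I_p -> I -> {RV P >-> R}) (z : 'rV[R]_p) (K1 K2 : R).
Hypotheses (K10 : 0 < K1) (K20 : 0 < K2).
Hypothesis one_hit : forall u delta, 0 <= delta <= 1 ->
  (((K1 * delta) ^+ p)%:E <= P (hit Xs z u delta))%E.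
Hypothesis two_hits : forall (u v : I) delta r, 0 < delta -> 0 < r ->
  `|u.2 - v.2| <= 1 -> (forall i, `|u.1 ord0 i - v.1 ord0 i| <= 1) ->
  [\/ r <= delta, r <= `|u.2 - v.2| `^ alpha |
     exists i, r <= `|u.1 ord0 i - v.1 ord0 i| `^ gamma] ->
  (P (hit Xs z u delta `&` hit Xs z v delta) <= ((K2 * delta ^+ 2 / r) ^+ p)%:E)%E.

(* The one-dimensional kernels of [pair_kernel_le] are then integrable. *)
Definition subcritical (s : R) : Prop := exists s0 s1 p0 p1 : R,
  [/\ [/\ 0 <= s0, 0 <= s1, 0 <= p0 & 0 <= p1],
      p0 + d%:R * p1 = p%:R, s = s0 + d%:R * s1,
      s0 + alpha * p0 < 1 & s1 + gamma * p1 < 1].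

(** One event for all the [s i]: at each [m] the mass is large with probability at least [q], and
    large energies are discarded for more and more exponents. What remains has probability at least
    [q / 2] for every [m], hence so has the event that it occurs infinitely often. *)
Lemma lower_event (s : nat -> R) : (forall i, subcritical (s i)) ->
  exists E, [/\ measurable E, (0 < P E)%E & forall w, E w -> forall i,
    exists c L : R, [/\ 0 < c, 0 < L & forall M, exists m, [/\ (M <= m)%N, (0 < m)%N,
      c <= mass alpha gamma Xs z m w & energy alpha gamma Xs z (s i) m w <= L]]].
Proof.
move=> sub.
have /choice[C CP] i : exists C : R, 0 < C /\ forall m, (0 < m)%N ->
    (\int[P]_w (energy alpha gamma Xs z (s i) m w)%:E <= C%:E)%E.
  have [s0 [s1 [p0 [p1 [[? ? ? ?] ? -> ? ?]]]]] := sub i.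
  have [C C0 CE] := energy_expectation alpha01 gamma01 K20 two_hits
    (s0 := s0) (s1 := s1) (p0 := p0) (p1 := p1) ltac:(done) ltac:(done) ltac:(done)
    ltac:(done) ltac:(done) ltac:(done) ltac:(done).
  by exists C.
have C0 i : 0 < C i by case: (CP i).
pose k := K1 ^+ p; have k0 : 0 < k by exact: exprn_gt0.
have s00 : 0 <= s 0%N.
  have [s0 [s1 [p0 [p1 [[? ? ? ?] ? -> ? ?]]]]] := sub 0%N.
  by rewrite addr_ge0// mulr_ge0.
pose Q : R := d.+1%:R `^ s 0%N.
have Q0 : 0 < Q by rewrite powR_gt0.
pose q := k ^+ 2 / (4 * (Q * C 0%N)).
have q0 : 0 < q by rewrite divr_gt0 ?exprn_gt0// !mulr_gt0.
have PZ m : (0 < m)%N -> (q%:E <= P [set w | (k / 2 <= mass alpha gamma Xs z m w)%R])%E.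
  move=> m0; apply: (@paley_zygmund _ _ _ P _ (energy alpha gamma Xs z (s 0%N) m)) => //.
  - exact: measurable_mass.
  - exact: measurable_energy.
  - by move=> w; exact: mass_ge0.
  - by move=> w; exact: energy_ge0.
  - by move=> w; exact: mass_sqr_le.
  - exact: mass_expectation.
  - by case: (CP 0%N) => _; exact.
(* The factor [2 ^+ i.+2] makes the probabilities of large energy sum to at most [q / 2]. *)
pose L i := C i * 2 ^+ i.+2 / q.
have L0 i : 0 < L i by rewrite divr_gt0// mulr_gt0// exprn_gt0.
pose B m i := [set w | (L i <= energy alpha gamma Xs z (s i) m w)%R].
have mB m i : measurable (B m i) by apply: measurable_set_ge; exact: measurable_energy.
have PB m i : (0 < m)%N -> (P (B m i) <= (q / 2 ^+ i.+2)%:E)%E.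
  move=> m0; apply: (@le_trans _ _ (C i / L i)%:E).
    apply: fine_markov => //; first exact: measurable_energy.
      by move=> w; exact: energy_ge0.
    by case: (CP i) => _; exact.
  rewrite lee_fin le_eqVlt; apply/orP; left; apply/eqP; rewrite /L.
  by field; rewrite !gt_eqF// exprn_gt0.
pose G m := [set w | (k / 2 <= mass alpha gamma Xs z m w)%R].
have mG m : measurable (G m) by apply: measurable_set_ge; exact: measurable_mass.
pose A n := G n.+1 `\` \big[setU/set0]_(i < n) B n.+1 i.
have mU n : measurable (\big[setU/set0]_(i < n) B n.+1 i).
  by apply: bigsetU_measurable => i _.
have mA n : measurable (A n) by exact: measurableD.
have sumq n : \sum_(i < n) q / 2 ^+ i.+2 <= q / 2.
  have -> : \sum_(i < n) q / 2 ^+ i.+2 = q / 2 - q / 2 ^+ n.+1.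
    elim: n => [|n IHn]; first by rewrite big_ord0 expr1 subrr.
    rewrite big_ord_recr/= IHn (exprS _ n.+1); field.
    by rewrite gt_eqF// exprn_gt0.
  by rewrite lerBlDr lerDl ltW// divr_gt0// exprn_gt0.
have PA n : ((q / 2)%:E <= P (A n))%E.
  have h1 : (q%:E <= P (G n.+1))%E by exact: PZ.
  have h2 : (P (\big[setU/set0]_(i < n) B n.+1 i) <= (q / 2)%:E)%E.
    apply: (@le_trans _ _ (\sum_(i < n) P (B n.+1 i))%E).
      exact: Boole_inequality.
    apply: (@le_trans _ _ (\sum_(i < n) (q / 2 ^+ i.+2)%:E)%E).
      by apply: lee_sum => i _; exact: PB.
    by rewrite sumEFin lee_fin.
  have h3 : (P (G n.+1) <= P (A n) + P (\big[setU/set0]_(i < n) B n.+1 i))%E.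
    apply: le_trans (measureU2 P _ _) => //.
    apply: le_measure; rewrite ?inE//; first exact: measurableU.
    move=> w Gw; have [Uw|Uw] := pselect ((\big[setU/set0]_(i < n) B n.+1 i) w).
      by right.
    by left.
  move: (le_trans h1 h3) h2.
  rewrite -[P (A n)]fineK ?fin_num_measure//.
  rewrite -[P (\big[setU/set0]_(i < n) _)]fineK ?fin_num_measure//.
  by rewrite -EFinD !lee_fin; lra.
exists (\bigcap_n \bigcup_(m in [set m | (n <= m)%N]) A m); split.
- by apply: bigcap_measurable => // n _; exact: bigcup_measurable.
- apply: lt_le_trans (limsup_measure_ge mA PA).
  by rewrite lte_fin divr_gt0.
move=> w Ew i; exists (k / 2), (L i); split => //; first by rewrite divr_gt0.
(* Beyond [i], large energies of exponent [s i] are among those discarded in [A m]. *)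
move=> M; have [m /= Mm [Gw Bw]] := Ew (maxn M i.+1) Logic.I.
rewrite geq_max in Mm; case/andP: Mm => Mm im.
exists m.+1; split => //; first exact: leqW.
rewrite leNgt; apply/negP => h; apply: Bw.
rewrite -bigcup_mkord; exists i => //; exact: ltW.
Qed.

End lower_event.

Section mass_cover.
Context (R : realType) (d p : nat) (alpha gamma : R).
Context (disp : measure_display) (T : measurableType disp) (P : probability T R).
Local Notation I := ('rV[R]_d * R)%type.
Variables (Xs : 'I_p -> I -> {RV P >-> R}) (z : 'rV[R]_p).

(* Grid points in the same [O j] are at distance at most [e j], hence the square of the
   mass of [O j] is at most [e j `^ s] times its energy; [t] is the parameter of the
   inequality [2 x <= t A + E / t] for [x ^+ 2 <= A * E]. *)
Lemma mass_cover_le (s t : R) (m n : nat) (w : T) (e : nat -> R) (O : nat -> set I) :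
  0 < s -> 0 < t -> (0 < m)%N -> (forall j, 0 < e j) ->
  (forall j, (j < n)%N -> m%:R^-1 <= e j) ->
  (forall j u v, O j u -> O j v -> `|u.2 - v.2| <= e j /\
     forall i, `|u.1 ord0 i - v.1 ord0 i| <= e j) ->
  (forall k : grid d m, hit Xs z (gridpt k) (level alpha gamma m) w ->
     exists2 j, (j < n)%N & O j (gridpt k)) ->
  2 * mass alpha gamma Xs z m w <=
  t * (d.+1%:R `^ s * \sum_(j < n) e j `^ s) + energy alpha gamma Xs z s m w / t.
Proof.
move=> s0 t0 m0 e0 me Oe cov.
pose H (k : grid d m) := hit Xs z (gridpt k) (level alpha gamma m).
(* Each hit is assigned to a single [O j], so the pieces are disjoint and their energies add up to
   at most the whole energy. The default 0 concerns grid points that are not hits. *)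
have /choice[J JP] (k : grid d m) : exists j : nat, H k w -> (j < n)%N /\ O j (gridpt k).
  have [Hk|Hk] := pselect (H k w); last by exists 0%N.
  by have [j jn Oj] := cov k Hk; exists j.
pose a : R := (m%:R ^+ d.+1 * level alpha gamma m ^+ p)^-1.
have a0 : 0 <= a by rewrite invr_ge0 mulr_ge0 ?exprn_ge0// powR_ge0.
pose x j : R := \sum_(k : grid d m) a * \1_(H k) w * (J k == j)%:R.
pose En j : R := \sum_(kl : grid d m * grid d m)
  a ^+ 2 * gdist kl.1 kl.2 `^ (- s) * (\1_(H kl.1) w * \1_(H kl.2) w) *
  ((J kl.1 == j)%:R * (J kl.2 == j)%:R).
have xE : mass alpha gamma Xs z m w <= \sum_(j < n) x j.
  rewrite /mass exchange_big/=; apply: ler_sum => k _.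
  rewrite -mulr_sumr -/a -/(H k) indicE.
  have [Hk|Hk] := boolP (w \in H k); last by rewrite !mulr0 mul0r.
  rewrite mulr1 ler_peMr//; rewrite inE in Hk; have [jn _] := JP k Hk.
  rewrite (bigD1 (Ordinal jn))//= eqxx lerDl sumr_ge0// => j _.
have EnE : \sum_(j < n) En j <= energy alpha gamma Xs z s m w.
  rewrite /energy exchange_big/=; apply: ler_sum => -[k l] _ /=.
  rewrite -mulr_sumr -exprVn -/a -/(H k) -/(H l).
  have -> : \1_(H k `&` H l) w = \1_(H k) w * \1_(H l) w :> R by rewrite indicI.
  rewrite ler_piMr//.
    by rewrite !mulr_ge0 ?sqr_ge0 ?powR_ge0.
  have [jn|jn] := ltnP (J k) n.
    rewrite (bigD1 (Ordinal jn))//= eqxx mul1r big1 ?addr0; first by case: eqP.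
    move=> j jk; rewrite (_ : J k == j = false) ?mul0r//.
    by apply/negbTE; apply: contra_neq jk => jk; apply: val_inj => /=.
  rewrite big1// => j _; rewrite (_ : J k == j = false) ?mul0r//.
  by apply/negbTE; rewrite gtn_eqF// (leq_trans (ltn_ord j)).
have xle j : (j < n)%N -> x j ^+ 2 <= (d.+1%:R `^ s * e j `^ s) * En j.
  move=> jn; rewrite expr2 /x big_distrlr/= pair_big/= /En mulr_sumr.
  apply: ler_sum => -[k l] _ /=.
  rewrite !indicE.
  have [Hk|_] := boolP (w \in H k); last by rewrite !(mulr0, mul0r).
  have [Hl|_] := boolP (w \in H l); last by rewrite !(mulr0, mul0r).
  have [Jk|_] := eqVneq (J k) j; last by rewrite !(mulr0, mul0r).
  have [Jl|_] := eqVneq (J l) j; last by rewrite !(mulr0, mul0r).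
  rewrite inE in Hk; rewrite inE in Hl.
  have [_ Ok] := JP k Hk; have [_ Ol] := JP l Hl.
  rewrite Jk in Ok; rewrite Jl in Ol.
  have [kl2 kl1] := Oe _ _ _ Ok Ol.
  have g0 : 0 < (gdist k l : R) by exact: gdist_gt0.
  have gle : gdist k l <= d.+1%:R * e j.
    have ng (u v : 'I_m) : `|(u%:R / m%:R : R) - v%:R / m%:R| <= e j -> ngap m u v <= e j.
      (* Equal coordinates have truncated gap [1 / m], hence the assumption [m%:R^-1 <= e j]. *)
      have [<-|uv] := eqVneq u v.
        by move=> _; rewrite /ngap /gap subnn mul1r; exact: me.
      rewrite -mulrBl normrM [X in _ * X]ger0_norm ?invr_ge0// /ngap.
      rewrite (_ : `|_| = (gap u v)%:R)//.
      have uv' : (u : nat) != v by [].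
      have [h|h] := leqP u v.
        rewrite distrC -natrB// normr_nat; congr (_%:R); rewrite /gap; lia.
      by rewrite -natrB ?(ltnW h)// normr_nat; congr (_%:R); rewrite /gap; lia.
    rewrite -natr1 addrC mulrDl mul1r; apply: lerD; first exact: ng.
    apply: (@le_trans _ _ (\sum_(i < d) e j)).
      by apply: ler_sum => i _; apply: ng; have := kl1 i; rewrite !mxE.
    by rewrite sumr_const card_ord -[leLHS]mulr_natl.
  rewrite !mulr1 -expr2 mulrCA ler_peMr ?sqr_ge0//.
  rewrite powRN ler_pdivlMr ?powR_gt0// mul1r -powRM ?ler0n ?(ltW (e0 j))//.
  apply: ge0_ler_powR; rewrite ?nnegrE ?(ltW s0) ?(ltW g0)//.
  by rewrite mulr_ge0 ?ler0n// ltW.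
have En0 j : 0 <= En j.
  apply: sumr_ge0 => kl _; rewrite mulr_ge0//.
  by rewrite !mulr_ge0 ?sqr_ge0 ?powR_ge0.
have x2 j : (j < n)%N -> 2 * x j <= t * (d.+1%:R `^ s * e j `^ s) + En j / t.
  move=> jn; set A := _ * e j `^ s.
  have A0 : 0 <= A by rewrite mulr_ge0 ?powR_ge0.
  have := xle j jn; rewrite -/A => h.
  have x0 : 0 <= x j by apply: sumr_ge0 => k _; rewrite !mulr_ge0.
  have r0 : 0 <= t * A + En j / t.
    by apply: addr_ge0; [apply: mulr_ge0 => //; exact: ltW|apply: divr_ge0; [exact: En0|exact: ltW]].
  rewrite -(@ler_pXn2r _ 2)// ?nnegrE//; last by apply: mulr_ge0.
  apply: (@le_trans _ _ (4 * (A * En j))).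
    by rewrite (_ : (2 * x j) ^+ 2 = 4 * x j ^+ 2); [lra|ring].
  rewrite -subr_ge0 (_ : _ - _ = (t * A - En j / t) ^+ 2) ?sqr_ge0//.
  by field; rewrite gt_eqF.
apply: (@le_trans _ _ (\sum_(j < n) 2 * x j)).
  by rewrite -mulr_sumr ler_wpM2l.
apply: (@le_trans _ _ (\sum_(j < n) (t * (d.+1%:R `^ s * e j `^ s) + En j / t))).
  by apply: ler_sum => j _; exact: x2.
rewrite big_split/= -!mulr_sumr lerD2l -mulr_suml ler_wpM2r// invr_ge0.
exact: ltW.
Qed.

End mass_cover.

(** * Hausdorff measure, lower bound *)

Section euclid.
Context (R : realType) (d : nat).
Local Notation I := ('rV[R]_d * R)%type.

Lemma euclid_norm_le (x : 'rV[R]_d) : euclid_norm x <= \sum_(i < d) `|x ord0 i|.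
Proof.
have s0 (r : seq 'I_d) : 0 <= \sum_(i <- r) `|x ord0 i| by exact: sumr_ge0.
rewrite /euclid_norm -(@ger0_norm _ (\sum_(i < d) `|x ord0 i|)) ?s0//.
rewrite -[leRHS]sqrtr_sqr ler_wsqrtr//.
elim: (index_enum _) => [|i r IHr]; first by rewrite !big_nil expr0n.
rewrite !big_cons sqrrD real_normK ?num_real// -addrA lerD2l.
by apply: (le_trans IHr); rewrite lerDr mulrn_wge0// mulr_ge0.
Qed.

Lemma euclid_dist_ge_time (u v : I) : `|u.2 - v.2| <= euclid_dist u v.
Proof. by rewrite /euclid_dist -sqrtr_sqr ler_wsqrtr// lerDr sqr_ge0. Qed.

Lemma euclid_dist_ge_space (u v : I) i : `|u.1 ord0 i - v.1 ord0 i| <= euclid_dist u v.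
Proof.
have -> : u.1 ord0 i - v.1 ord0 i = (u.1 - v.1) ord0 i by rewrite !mxE.
apply: (le_trans (coord_le_euclid_norm _ _)).
rewrite /euclid_dist -[leLHS]ger0_norm ?sqrtr_ge0// -sqrtr_sqr ler_wsqrtr//.
by rewrite lerDl sqr_ge0.
Qed.

Lemma euclid_dist_le (u v : I) :
  euclid_dist u v <= `|u.2 - v.2| + \sum_(i < d) `|u.1 ord0 i - v.1 ord0 i|.
Proof.
have n0 : 0 <= euclid_norm (u.1 - v.1) by exact: sqrtr_ge0.
apply: (@le_trans _ _ (`|u.2 - v.2| + euclid_norm (u.1 - v.1))); last first.
  rewrite lerD2l; apply: (le_trans (euclid_norm_le _)).
  by apply: ler_sum => i _; rewrite !mxE.
rewrite /euclid_dist -[leRHS]ger0_norm ?addr_ge0// -sqrtr_sqr ler_wsqrtr//.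
by rewrite [leRHS]sqrrD real_normK ?num_real// addrC lerD2r lerDl mulrn_wge0// mulr_ge0.
Qed.

Lemma euclid_distxx (u : I) : euclid_dist u u = 0.
Proof.
apply/eqP; rewrite eq_le sqrtr_ge0 andbT.
apply: (le_trans (euclid_dist_le _ _)).
by rewrite subrr normr0 add0r big1// => i _; rewrite subrr normr0.
Qed.

Lemma ediam_fin (F : set I) (delta : R) : F !=set0 ->
  (ediam (@euclid_dist R d) F <= delta%:E)%E ->
  exists D : R, [/\ 0 <= D, D <= delta, ediam (@euclid_dist R d) F = D%:E &
    forall u v, F u -> F v -> euclid_dist u v <= D].
Proof.
move=> [u Fu] Fd.
have D0 : (0%:E <= ediam (@euclid_dist R d) F)%E.
  by apply: ereal_sup_ubound; exists u, u; rewrite euclid_distxx.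
have Dfin : ediam (@euclid_dist R d) F \is a fin_num.
  by rewrite ge0_fin_numE// (le_lt_trans Fd)// ltry.
exists (fine (ediam (@euclid_dist R d) F)); rewrite fineK//; split => //.
- by rewrite fine_ge0.
- by rewrite -lee_fin fineK.
- move=> x y Fx Fy; rewrite -lee_fin fineK//; apply: ereal_sup_ubound.
  by exists x, y.
Qed.

Lemma compact_unit_cube :
  compact [set u : I | (forall i, 0 <= u.1 ord0 i <= 1) /\ 0 <= u.2 <= 1].
Proof.
rewrite (_ : [set u | _] =
  [set v : 'rV[R]_d | forall i, `[0, 1]%classic (v ord0 i)] `*` `[0, 1]%classic).
  apply: compact_setX; last exact: segment_compact.
  by apply: (@rV_compact R d (fun=> `[0, 1]%classic)) => i; exact: segment_compact.
apply/seteqP; split => -[x t] /= [h1 h2]; split => //=; rewrite ?in_itv//=.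
Qed.

End euclid.

Section hausdorff_lower.
Context (R : realType) (d p : nat) (alpha gamma : R).
Hypotheses (alpha01 : 0 < alpha <= 1) (gamma01 : 0 < gamma <= 1).
Context (disp : measure_display) (T : measurableType disp) (P : probability T R).
Local Notation I := ('rV[R]_d * R)%type.
Variables (Xs : 'I_p -> I -> {RV P >-> R}) (z : 'rV[R]_p).

Lemma level_le (r : R) : 0 < r -> exists M, forall m, (M <= m)%N -> (0 < m)%N ->
  level alpha gamma m <= r.
Proof.
move=> r0; have th0 : 0 < Num.min alpha gamma.
  by rewrite lt_min; case/andP: alpha01 => ->; case/andP: gamma01 => ->.
set th := Num.min _ _ in th0; pose b := r `^ (- th^-1).
exists (Num.bound b) => m Mm m0; rewrite /level -/th.
have bm : b <= m%:R.
  apply: (@le_trans _ _ (Num.bound b)%:R); last by rewrite ler_nat.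
  by rewrite ltW// archi_boundP// powR_ge0.
rewrite powRN -[leRHS]invrK lef_pV2 ?posrE ?invr_gt0 ?powR_gt0 ?ltr0n//.
have -> : r^-1 = b `^ th.
  by rewrite /b -powRrM mulNr mulVf ?gt_eqF// powR_inv1// ltW.
by apply: ge0_ler_powR; rewrite ?nnegrE ?powR_ge0// ltW.
Qed.

(** A null level set would have a cover with a tiny sum of powers. Away from it some component
    differs from its target by a definite amount; by compactness finitely many indices suffice, so
    for large [m] every hit lies in finitely many sets of the cover and [mass_cover_le] contradicts
    the mass bound. Diameters at most 1 allow passing from [s'] to the larger [s]. *)
Lemma hausdorff_measure_neq0 (s s' c L : R) (w : T) :
  (forall j, continuous (fun u => Xs j u w : R)) ->
  0 < s -> 0 <= s' <= s -> 0 < c -> 0 < L ->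
  (forall M, exists m, [/\ (M <= m)%N, (0 < m)%N,
     c <= mass alpha gamma Xs z m w & energy alpha gamma Xs z s m w <= L]) ->
  hausdorff_measure (@euclid_dist R d) s' (level_set Xs z w) <> 0%E.
Proof.
move=> cX s0 /andP[s'0 s's] c0 L0 freq H0.
pose Q : R := d.+1%:R `^ s; have Q0 : 0 < Q by rewrite powR_gt0.
(* Chosen so that [mass_cover_le] would give [2 c <= c / 2 + c]. *)
pose t := L / c; have t0 : 0 < t by rewrite divr_gt0.
pose eps := c / (4 * t * Q); have eps0 : 0 < eps.
  by apply: divr_gt0 => //; apply: mulr_gt0 => //; apply: mulr_gt0.
have : (hausdorff_premeasure (@euclid_dist R d) s' 1 (level_set Xs z w) < eps%:E)%E.
  apply: (@le_lt_trans _ _ 0%E); last by rewrite lte_fin.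
  by rewrite -H0; apply: ereal_sup_ubound; exists 1 => //=.
move=> /ereal_inf_lt[_ [F [Fcov Fd] <-]] Fsum.
have dp0 k : (0 <= diam_pow (@euclid_dist R d) s' (F k))%E.
  by rewrite /diam_pow; case: ifP => // _; exact: poweR_ge0.
have /choice[D DP] k : exists D : R, [/\ 0 <= D, D <= 1,
    (F k !=set0) -> diam_pow (@euclid_dist R d) s' (F k) = (D `^ s')%:E,
    ~ (F k !=set0) -> D = 0 &
    forall u v, F k u -> F k v -> euclid_dist u v <= D].
  have [Fk|Fk] := pselect (F k !=set0); last first.
    by exists 0; split => // u v Fu; exfalso; apply: Fk; exists u.
  have [D [D0 D1 DE Duv]] := ediam_fin Fk (Fd k).
  exists D; split => // _; rewrite /diam_pow ifF; first by rewrite DE.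
  by apply/negbTE/set0P.
have sumD n : \sum_(k < n) D k `^ s <= eps.
  rewrite -lee_fin -sumEFin; apply: le_trans (ltW Fsum).
  apply: le_trans (nneseries_lim_ge n (fun k _ _ => dp0 k)).
  rewrite big_mkord; apply: lee_sum => k _.
  have [D0 D1 DF DN _] := DP k.
  have [Fk|Fk] := pselect (F k !=set0); last first.
    by rewrite (DN Fk) powR0 ?gt_eqF.
  rewrite (DF Fk) lee_fin.
  have [->|Dn0] := eqVneq (D k) 0; first by rewrite [leLHS]powR0 ?gt_eqF// powR_ge0.
  have Dp : 0 < D k by rewrite lt_neqAle eq_sym Dn0.
  by rewrite /powR gt_eqF// ler_expR ler_wnM2r// ln_le0.
(* The sets are thickened: [g] has sum at most [eps] and makes room for an open neighbourhood even
   of a single point, of diameter 0. *)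
pose g k : R := eps / 2 ^+ k.+1.
have g0 k : 0 < g k by rewrite divr_gt0// exprn_gt0.
have sumg n : \sum_(k < n) g k <= eps.
  have -> : \sum_(i < n) g i = eps - eps / 2 ^+ n.
    elim: n => [|n IHn]; first by rewrite big_ord0 expr0 divr1 subrr.
    rewrite big_ord_recr/= IHn /g (exprS _ n); field.
    by rewrite gt_eqF// exprn_gt0.
  by rewrite lerBlDr lerDl ltW// divr_gt0// exprn_gt0.
pose e k := (D k `^ s + g k) `^ s^-1.
have eg k : 0 < D k `^ s + g k by rewrite ltr_wpDl ?powR_ge0.
have e0 k : 0 < e k by rewrite powR_gt0.
have es k : e k `^ s = D k `^ s + g k.
  by rewrite /e -powRrM mulVf ?gt_eqF// powRr1// ltW.
have De k : D k < e k.
  have [D0 _ _ _ _] := DP k.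
  have -> : D k = (D k `^ s) `^ s^-1 by rewrite -powRrM mulfV ?gt_eqF// powRr1.
  by rewrite /e gt0_ltr_powR ?nnegrE ?invr_gt0 ?powR_ge0 ?(ltW (eg k))// ltrDl.
(* Two displacements by [eta] added to the diameter [D] stay below [e]. *)
pose eta k := (e k - D k) / 3.
have eta0 k : 0 < eta k by rewrite divr_gt0// subr_gt0.
pose O k : set I := \bigcup_(v in F k) (ball v (eta k))°.
have ball_coord (u v : I) r : (ball v r)° u ->
    `|v.2 - u.2| < r /\ forall i, `|v.1 ord0 i - u.1 ord0 i| < r.
  move=> /interior_subset[/= [_ h1] h2]; split => //.
  by move=> i; have := h1 ord0 i.
have Oe j u v : O j u -> O j v ->
    `|u.2 - v.2| <= e j /\ forall i, `|u.1 ord0 i - v.1 ord0 i| <= e j.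
  move=> [u' Fu /ball_coord[u2 u1]] [v' Fv /ball_coord[v2 v1]].
  have [D0 _ _ _ /(_ _ _ Fu Fv) uv] := DP j.
  have tri (a b a' b' : R) : `|a' - a| < eta j -> `|b' - b| < eta j ->
      `|a' - b'| <= D j -> `|a - b| <= e j.
    move=> h1 h2 h3; have -> : a - b = - (a' - a) + ((a' - b') + (b' - b)) by ring.
    apply: (le_trans (ler_normD _ _)); rewrite normrN.
    apply: (le_trans (lerD (lexx _) (ler_normD _ _))).
    apply: (le_trans (lerD (ltW h1) (lerD h3 (ltW h2)))).
    have -> : eta j + (D j + eta j) = e j - (e j - D j) / 3 by rewrite /eta; field.
    by rewrite gerBl divr_ge0// subr_ge0 ltW.
  split; first by apply: tri u2 v2 _; exact: le_trans (euclid_dist_ge_time _ _) uv.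
  by move=> i; apply: tri (u1 i) (v1 i) _; exact: le_trans (euclid_dist_ge_space _ _ _) uv.
(* Points off the level set: some component is further than [1 / (k + 1)] from its target. The
   threshold uses the same index as the cover, so that one finite range of [k] controls both. *)
pose G j k : set I := (fun u => Xs j u w : R) @^-1` [set y | k.+1%:R^-1 < `|y - z ord0 j|].
have oG j k : open (G j k).
  apply: open_comp; first by move=> u _; exact: cX.
  rewrite (_ : [set y | _] = (fun y => `|y - z ord0 j|) @^-1` [set y | k.+1%:R^-1 < y])//.
  apply: open_comp; last exact: open_gt.
  move=> y _; apply: cvg_norm; apply: cvgB; [exact: cvg_id|exact: cvg_cst].
pose V k := O k `|` \bigcup_j G j k.
have oV k : open (V k).
  apply: openU; apply: bigcup_open => // v _; exact: open_interior.
have Vcov u : exists k, V k u.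
  have [Eu|Eu] := pselect (level_set Xs z w u).
    have [k _ Fk] := Fcov u Eu; exists k; left; exists u => //.
    exact: nbhsx_ballx.
  have [j uj] : exists j, Xs j u w != z ord0 j.
    apply/not_existsP => h; apply: Eu; apply/rowP => j; rewrite mxE.
    by apply/eqP; apply: contra_notT (h j).
  have uj0 : 0 < `|Xs j u w - z ord0 j| by rewrite normr_gt0 subr_eq0.
  exists (Num.bound `|Xs j u w - z ord0 j|^-1); right; exists j => //=.
  rewrite /G/= -[ltRHS]invrK ltf_pV2 ?posrE ?invr_gt0 ?ltr0n//.
  apply: (@lt_trans _ _ (Num.bound `|Xs j u w - z ord0 j|^-1)%:R).
    by apply: archi_boundP; rewrite invr_ge0.
  by rewrite ltr_nat.
have [N _ /(_ N (leqnn N)) cov] : \forall n \near \oo, forall u : I,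
    (forall i, 0 <= u.1 ord0 i <= 1) /\ 0 <= u.2 <= 1 -> exists2 k, (k < n)%N & V k u.
  have := @compact_unit_cube R d => /compact_near_coveringP.
  apply => u _; have [k Vku] := Vcov u.
  exists (V k, [set n | (k < n)%N]); last by move=> [v n] /= [Vv kn]; exists k.
  split; first by apply: open_nbhs_nbhs; split => //; exact: oV.
  by exists k.+1.
set n := N in cov.
have n0 : 0 < (n.+1%:R^-1 : R) by rewrite invr_gt0 ltr0n.
have [M1 M1P] := level_le n0.
pose M2 := (\max_(j < n) Num.bound (e j)^-1)%N.
have [m [Mm m0 cm Lm]] := freq (maxn M1 M2).
rewrite geq_max in Mm; have /andP[mM1 mM2] := Mm.
have := @mass_cover_le R d p alpha gamma _ _ P Xs z s t m n w e O s0 t0 m0 e0 _ Oe _.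
have me j : (j < n)%N -> m%:R^-1 <= e j.
  move=> jn; rewrite -[leRHS]invrK lef_pV2 ?posrE ?invr_gt0 ?ltr0n//.
  apply: (@le_trans _ _ (Num.bound (e j)^-1)%:R).
    by rewrite ltW// archi_boundP// invr_ge0 ltW.
  rewrite ler_nat; apply: leq_trans mM2.
  exact: (@leq_bigmax _ (fun j : 'I_n => Num.bound (e j)^-1) (Ordinal jn)).
move=> /(_ me) H1.
have {}H1 : 2 * mass alpha gamma Xs z m w <=
  t * (d.+1%:R `^ s * \sum_(j < n) e j `^ s) + energy alpha gamma Xs z s m w / t.
  apply: H1 => k hk.
  have m0' : 0 < (m%:R : R) by rewrite ltr0n.
  have [|j jn [Oj|[i _ Gi]]] := cov (gridpt k).
  - split => [i|] /=; rewrite ?mxE divr_ge0 ?ler0n//= ler_pdivrMr// mul1r ler_nat ltnW//.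
  - by exists j.
  - exfalso; have := hk i; apply/negP; rewrite -ltNge.
    apply: le_lt_trans Gi; apply: (le_trans (M1P _ mM1 m0)).
    by rewrite lef_pV2 ?posrE ?ltr0n// ler_nat ltnS; exact: ltnW.
have se : \sum_(j < n) e j `^ s <= 2 * eps.
  under eq_bigr do rewrite es.
  rewrite big_split/=; apply: (le_trans (lerD (sumD n) (sumg n))); lra.
have h1 : t * (Q * \sum_(j < n) e j `^ s) <= c / 2.
  have -> : c / 2 = t * (Q * (2 * eps)).
    by rewrite /eps; field; rewrite !gt_eqF.
  by rewrite ler_wpM2l ?(ltW t0)// ler_wpM2l// ltW.
have h2 : energy alpha gamma Xs z s m w / t <= c.
  by rewrite ler_pdivrMr// /t mulrC divfK ?gt_eqF.
move: H1; rewrite -/Q; lra.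
Qed.

End hausdorff_lower.

(** * Oscillation of the field on small boxes: dyadic chaining *)

Lemma measure_bigsetU_le (disp : measure_display) (T : measurableType disp) (R : realType)
    (P : probability T R) (J : finType) (A : J -> set T) : (forall k, measurable (A k)) ->
  (P (\big[setU/set0]_k A k) <= \sum_k P (A k))%E.
Proof.
move=> mA; suff : measurable (\big[setU/set0]_k A k) /\ (P (\big[setU/set0]_k A k) <= \sum_k P (A k))%E.
  by case.
apply: (big_rec2 (fun X y => measurable X /\ (P X <= y)%E)).
  by split => //; rewrite measure0.
move=> k y X _ [mX Xy]; split; first exact: measurableU.
by apply: (le_trans (measureU2 P (mA k) mX)); rewrite leeD2l.
Qed.

Section oscillation.
Context (R : realType) (d : nat) (alpha gamma : R).
Hypotheses (alpha01 : 0 < alpha <= 1) (gamma01 : 0 < gamma <= 1).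
Context (disp : measure_display) (T : measurableType disp) (P : probability T R).
Local Notation I := ('rV[R]_d * R)%type.

Lemma truncn_half (y : R) : 0 <= y -> (Num.truncn (2 * y))./2 = Num.truncn y.
Proof.
move=> y0; have y20 : 0 <= 2 * y by rewrite mulr_ge0.
have /andP[a1 a2] := truncn_itv y0; have /andP[b1 b2] := truncn_itv y20.
set a := Num.truncn y in a1 a2 *; set b := Num.truncn _ in b1 b2 *.
have h1 : (2 * a < b.+1)%N by rewrite -(ltr_nat R) natrM; lra.
have h2 : (b < 2 * a.+1)%N by rewrite -(ltr_nat R) natrM; lra.
move: h1 h2; clearbody a b; clear; lia.
Qed.

(** Dyadic points of the box with corner [q] and sides [hx], [ht]. The indices are plain naturals so
    that [half_index], which leads to the previous generation, carries no bounds. *)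
Definition boxpt (q : I) (hx ht : R) (m : nat) (k : ('I_d -> nat) * nat) : I :=
  (\row_i (q.1 ord0 i + hx * ((k.1 i)%:R / m%:R)), q.2 + ht * (k.2%:R / m%:R)).

Definition half_index (k : ('I_d -> nat) * nat) : ('I_d -> nat) * nat :=
  (fun i => (k.1 i)./2, k.2./2).

Lemma boxpt_half q hx ht m k : (0 < m)%N -> 0 <= hx -> 0 <= ht ->
  let u := boxpt q hx ht m.*2 k in let v := boxpt q hx ht m (half_index k) in
  `|u.2 - v.2| <= ht / m%:R /\ forall i, `|u.1 ord0 i - v.1 ord0 i| <= hx / m%:R.
Proof.
move=> m0 hx0 ht0.
have m0' : 0 < (m%:R : R) by rewrite ltr0n.
have key (a h : R) (n : nat) : 0 <= h ->
    `|a + h * (n%:R / m.*2%:R) - (a + h * (n./2%:R / m%:R))| <= h / m%:R.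
  move=> h0; rewrite -[n in n%:R / m.*2%:R]odd_double_half natrD -!muln2 !natrM.
  rewrite (_ : _ - _ = h / m%:R * ((odd n)%:R / 2)); last by field; rewrite gt_eqF.
  rewrite ger0_norm ?mulr_ge0 ?invr_ge0 ?(ltW m0')//.
  rewrite ler_piMr ?mulr_ge0 ?invr_ge0 ?(ltW m0')//.
  by rewrite ler_pdivrMr// mul1r; case: (odd n) => /=; lra.
by split => [|i]; rewrite /= ?mxE; exact: key.
Qed.

Let theta := Num.min alpha gamma.
(* The increments of the j-th generation of the chaining have standard deviation of order
   [osc_ratio ^+ (2 * j)]; the thresholds of [big_step] are larger by [osc_ratio ^- j]. *)
Definition osc_ratio : R := 2 `^ (- (theta / 2)).

Lemma osc_ratio_gt0 : 0 < osc_ratio. Proof. by rewrite powR_gt0. Qed.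

Let theta0 : 0 < theta.
Proof. by rewrite lt_min; case/andP: alpha01 => ->; case/andP: gamma01 => ->. Qed.

Lemma osc_ratio_lt1 : osc_ratio < 1.
Proof.
rewrite /osc_ratio /powR gt_eqF// expR_lt1 mulNr oppr_lt0 mulr_gt0 ?divr_gt0//.
by rewrite ln_gt0// ltr1n.
Qed.

Let osc_ratioX n : osc_ratio ^+ n = 2 `^ (- (theta / 2) * n%:R).
Proof. by rewrite powRrM powR_mulrn ?powR_ge0. Qed.

Lemma osc_ratio_sqr (h H r : R) (j : nat) : theta <= H -> 0 <= h -> 0 < r -> h `^ H <= r ->
  (h / (2 ^ j)%:R) `^ H <= r * osc_ratio ^+ (2 * j).
Proof.
move=> tH h0 r0 hr; rewrite powRM ?invr_ge0 ?ler0n//.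
apply: ler_pM; rewrite ?powR_ge0//.
rewrite osc_ratioX -powR_inv1 ?ler0n// -powRrM natrX -powR_mulrn ?ler0n// -powRrM.
rewrite ler_powR ?ler1n// mulN1r natrM.
have -> : - (theta / 2) * (2 * j%:R) = - (theta * j%:R) by field.
by rewrite mulrN lerN2 (mulrC theta) ler_wpM2l// ler0n.
Qed.

Variables (Z : I -> {RV P >-> R}) (K : R).
Hypothesis K0 : 0 < K.
Hypothesis tail : forall (u v : I) l tau, 0 < l -> 0 < tau ->
  `|u.2 - v.2| `^ alpha <= tau -> (forall i, `|u.1 ord0 i - v.1 ord0 i| `^ gamma <= tau) ->
  (P [set w | (l * (K * tau) <= `|Z u w - Z v w|)%R] <= (2 * expR (- (l ^+ 2 / 2)))%:E)%E.

Definition nat_index (m : nat) (k : grid d m) : ('I_d -> nat) * nat :=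
  (fun i => nat_of_ord (k.1 i), nat_of_ord k.2).

Definition big_step (q : I) (hx ht lambda r : R) (j : nat) (k : grid d (2 ^ j.+1)) : set T :=
  [set w | lambda / osc_ratio ^+ j * (K * (r * osc_ratio ^+ (2 * j))) <=
    `|Z (boxpt q hx ht (2 ^ j.+1) (nat_index k)) w -
      Z (boxpt q hx ht (2 ^ j) (half_index (nat_index k))) w|].

Definition big_osc (q : I) (hx ht lambda r : R) : set T :=
  \bigcup_j \big[setU/set0]_(k : grid d (2 ^ j.+1)) big_step q hx ht lambda r k.

Lemma measurable_big_osc q hx ht lambda r : measurable (big_osc q hx ht lambda r).
Proof.
apply: bigcup_measurable => j _; apply: bigsetU_measurable => k _.
apply: measurable_set_ge; apply: measurableT_comp => //.
by apply: measurable_funB; exact: measurable_funPT.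
Qed.

(** Telescoping along the dyadic approximations of [u], which start at [q]: outside the exceptional
    event the increments are at most [lambda K r osc_ratio^j], and continuity passes to the
    limit. *)
Lemma big_osc_le (q : I) hx ht lambda r (u : I) w : 0 < hx -> 0 < ht -> 0 < lambda -> 0 < r ->
  continuous (fun v => Z v w : R) -> ~ big_osc q hx ht lambda r w ->
  q.2 <= u.2 < q.2 + ht -> (forall i, q.1 ord0 i <= u.1 ord0 i < q.1 ord0 i + hx) ->
  `|Z u w - Z q w| <= lambda * (K * r) / (1 - osc_ratio).
Proof.
move=> hx0 ht0 lambda0 r0 cZ nosc u2 u1.
have x0 := osc_ratio_gt0; have x1 := osc_ratio_lt1.
pose yt := (u.2 - q.2) / ht; pose y i := (u.1 ord0 i - q.1 ord0 i) / hx.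
have yt01 : 0 <= yt < 1.
  have /andP[a b] := u2; rewrite divr_ge0 ?(ltW ht0) ?subr_ge0//=.
  by rewrite ltr_pdivrMr// mul1r ltrBlDl.
have y01 i : 0 <= y i < 1.
  have /andP[a b] := u1 i; rewrite divr_ge0 ?(ltW hx0) ?subr_ge0//=.
  by rewrite ltr_pdivrMr// mul1r ltrBlDl.
have tlt (v : R) j : 0 <= v < 1 -> (Num.truncn ((2 ^ j)%:R * v) < 2 ^ j)%N.
  move=> /andP[v0 v1]; rewrite -(ltr_nat R); apply: le_lt_trans (_ : (2 ^ j)%:R * v < _).
    by rewrite truncn_le// mulr_ge0.
  by rewrite -[ltRHS]mulr1 ltr_pM2l// ltr0n expn_gt0.
pose kk j : grid d (2 ^ j) :=
  ([ffun i => Ordinal (tlt (y i) j (y01 i))], Ordinal (tlt yt j yt01)).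
pose v j := boxpt q hx ht (2 ^ j) (nat_index (kk j)).
have v0 : v 0%N = q.
  have t0 (a : R) : 0 <= a < 1 -> Num.truncn ((2 ^ 0)%:R * a) = 0%N.
    by move=> /(tlt _ 0%N); rewrite expn0 ltnS leqn0 => /eqP.
  rewrite [RHS]surjective_pairing /v /boxpt; congr pair.
    by apply/rowP => i; rewrite !mxE /= ffunE /= t0// mul0r mulr0 addr0.
  by rewrite /= t0// mul0r mulr0 addr0.
have vhalf j : boxpt q hx ht (2 ^ j) (half_index (nat_index (kk j.+1))) = v j.
  rewrite /v /boxpt; congr pair.
    apply/rowP => i; rewrite !mxE /= !ffunE /= expnS natrM -mulrA truncn_half//.
    by rewrite mulr_ge0//; have /andP[] := y01 i.
  rewrite /= expnS natrM -mulrA truncn_half//.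
  by rewrite mulr_ge0//; have /andP[] := yt01.
have step j : `|Z (v j.+1) w - Z (v j) w| <= lambda * (K * r) * osc_ratio ^+ j.
  rewrite leNgt; apply/negP => h; apply: nosc; exists j => //.
  rewrite -bigcup_seq; exists (kk j.+1); first by rewrite /= mem_index_enum.
  rewrite /big_step/= vhalf; apply: le_trans (ltW h).
  rewrite mul2n -addnn exprD le_eqVlt; apply/orP; left; apply/eqP; field.
  by rewrite expf_neq0// gt_eqF.
have sumstep n : `|Z (v n) w - Z q w| <= lambda * (K * r) * \sum_(j < n) osc_ratio ^+ j.
  elim: n => [|n IHn]; first by rewrite v0 subrr normr0 big_ord0 mulr0.
  rewrite big_ord_recr/= mulrDr (_ : _ - _ = (Z (v n) w - Z q w) + (Z (v n.+1) w - Z (v n) w)).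
    by apply: (le_trans (ler_normD _ _)); exact: lerD.
  by ring.
have geo n : \sum_(j < n) osc_ratio ^+ j <= (1 - osc_ratio)^-1.
  rewrite -[leRHS]mul1r ler_pdivlMr ?subr_gt0//.
  have := subrX1 osc_ratio n; rewrite mulrC.
  have : 0 <= osc_ratio ^+ n by rewrite exprn_ge0// ltW.
  lra.
have vclose j : `|u.2 - (v j).2| <= ht / (2 ^ j)%:R /\
    forall i, `|u.1 ord0 i - (v j).1 ord0 i| <= hx / (2 ^ j)%:R.
  have key (a b h : R) : 0 < h -> 0 <= (a - b) / h ->
     `|a - (b + h * ((Num.truncn ((2 ^ j)%:R * ((a - b) / h)))%:R / (2 ^ j)%:R))| <= h / (2 ^ j)%:R.
    move=> h0 ab; have J0 : 0 < ((2 ^ j)%:R : R) by rewrite ltr0n expn_gt0.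
    have := @truncn_itv R ((2 ^ j)%:R * ((a - b) / h)).
    rewrite mulr_ge0 ?(ltW J0)// => /(_ isT).
    set n := Num.truncn _ => /andP[n1 n2].
    rewrite (_ : a - _ = h / (2 ^ j)%:R * ((2 ^ j)%:R * ((a - b) / h) - n%:R)); last first.
      by field; rewrite !gt_eqF.
    rewrite normrM ger0_norm ?divr_ge0 ?(ltW h0) ?(ltW J0)//.
    rewrite ler_piMr ?divr_ge0 ?(ltW h0) ?(ltW J0)//.
    rewrite -natr1 in n2; rewrite ler_norml; lra.
  split => [|i] /=; rewrite ?mxE ?ffunE /=; first by apply: key => //; have /andP[] := yt01.
  by apply: key => //; have /andP[] := y01 i.
apply/ler_addgt0Pr => e e0.
have /cvgrPdist_lt/(_ e e0) := cZ u.
move=> /nbhs_ballP[del /= del0 Bdel].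
have [j [jx jt]] : exists j, hx / (2 ^ j)%:R < del /\ ht / (2 ^ j)%:R < del.
  exists (Num.bound ((hx + ht) / del)).
  set j := Num.bound _.
  have jb : (hx + ht) / del < (2 ^ j)%:R.
    apply: (@lt_trans _ _ j%:R); last by rewrite ltr_nat ltn_expl.
    by rewrite archi_boundP// divr_ge0 ?addr_ge0// ltW.
  have J0 : 0 < ((2 ^ j)%:R : R) by rewrite ltr0n expn_gt0.
  rewrite ltr_pdivrMr// mulrC in jb.
  by split; rewrite ltr_pdivrMr//; lra.
have [vt vx] := vclose j.
have Buv : ball u del (v j).
  split => /=; last exact: le_lt_trans vt jt.
  split => // a i; rewrite (ord1 a); exact: le_lt_trans (vx i) jx.
have := Bdel _ Buv => /= h.
rewrite (_ : _ - _ = (Z u w - Z (v j) w) + (Z (v j) w - Z q w)); last by ring.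
apply: (le_trans (ler_normD _ _)); rewrite addrC; apply: lerD; last exact: ltW.
apply: (le_trans (sumstep j)); rewrite ler_wpM2l//.
by apply: mulr_ge0; [exact: ltW|apply: mulr_ge0; exact: ltW].
Qed.

(** From [exp (x / n) >= x / n]. The Gaussian tail is used only through this polynomial decay, of a
    degree chosen later to beat the number of chaining steps. *)
Lemma expRN_le (n : nat) (x : R) : (0 < n)%N -> 0 < x -> expR (- x) <= (n%:R / x) ^+ n.
Proof.
move=> n0 x0; have n0' : 0 < (n%:R : R) by rewrite ltr0n.
rewrite (_ : - x = n%:R * (- (x / n%:R))); last by field; rewrite gt_eqF.
rewrite expRM_natl lerXn2r ?nnegrE ?expR_ge0 ?divr_ge0 ?(ltW x0) ?(ltW n0')//.
rewrite expRN -[leRHS]invrK lef_pV2 ?posrE ?expR_gt0 ?invr_gt0 ?divr_gt0//.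
rewrite invf_div; apply: le_trans (expR_ge1Dx _).
by rewrite lerDr.
Qed.

(** Generation [j] has [2^((d + 1) (j + 1))] steps, each exceptional with probability of order
    [lambda^(-2 n) 2^(- theta n j)]; the condition on [n] leaves a factor [2^(- j)] to sum. *)
Lemma big_osc_prob (n : nat) : (0 < n)%N -> d.+2%:R <= theta * n%:R ->
  exists2 C : R, 0 < C & forall q hx ht lambda r, 0 < hx -> 0 < ht -> 0 < lambda -> 0 < r ->
    ht `^ alpha <= r -> hx `^ gamma <= r ->
    (P (big_osc q hx ht lambda r) <= (C / lambda ^+ (2 * n))%:E)%E.
Proof.
move=> n0 hn; have x0 := osc_ratio_gt0; have x1 := osc_ratio_lt1.
pose C : R := 2 ^+ d.+1 * (2 * (2 * n%:R) ^+ n).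
have C0 : 0 < C by rewrite !mulr_gt0 ?exprn_gt0 ?mulr_gt0 ?ltr0n.
exists (C * 2); first by rewrite mulr_gt0.
move=> q hx ht lambda r hx0 ht0 lambda0 r0 htr hxr.
pose D := C / lambda ^+ (2 * n).
have D0 : 0 < D by rewrite divr_gt0// exprn_gt0.
have Pstep j k : (P (@big_step q hx ht lambda r j k) <=
    (2 * (2 * n%:R) ^+ n / lambda ^+ (2 * n) * osc_ratio ^+ (2 * n * j))%:E)%E.
  have l0 : 0 < lambda / osc_ratio ^+ j by rewrite divr_gt0// exprn_gt0.
  have t0 : 0 < r * osc_ratio ^+ (2 * j) by rewrite mulr_gt0// exprn_gt0.
  have m0 : (0 < 2 ^ j)%N by rewrite expn_gt0.
  have := @boxpt_half q hx ht (2 ^ j) (nat_index k) m0 (ltW hx0) (ltW ht0).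
  rewrite -muln2 -expnSr => -[dt dx].
  apply: le_trans (tail l0 t0 _ _) _.
  - apply: le_trans (_ : (ht / (2 ^ j)%:R) `^ alpha <= _).
      apply: ge0_ler_powR; rewrite ?nnegrE ?divr_ge0 ?(ltW ht0)//.
      by case/andP: alpha01 => /ltW.
    by apply: osc_ratio_sqr => //; [rewrite /theta ge_min lexx|exact: ltW].
  - move=> i; apply: le_trans (_ : (hx / (2 ^ j)%:R) `^ gamma <= _).
      apply: ge0_ler_powR; rewrite ?nnegrE ?divr_ge0 ?(ltW hx0)//.
      by case/andP: gamma01 => /ltW.
    by apply: osc_ratio_sqr => //; [rewrite /theta ge_min lexx orbT|exact: ltW].
  rewrite lee_fin; have l20 : 0 < (lambda / osc_ratio ^+ j) ^+ 2 / 2 by rewrite divr_gt0// exprn_gt0.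
  apply: (le_trans (ler_wpM2l _ (expRN_le n0 l20))) => //.
  have -> : n%:R / ((lambda / osc_ratio ^+ j) ^+ 2 / 2) =
      2 * n%:R * (lambda ^+ 2)^-1 * (osc_ratio ^+ j) ^+ 2.
    by field; rewrite expf_neq0 ?gt_eqF.
  rewrite 2!exprMn exprVn -!exprM -(mulnA j 2) (mulnC j).
  by rewrite !mulrA.
have xn : osc_ratio ^+ (2 * n) <= 2^-1 ^+ d.+2.
  rewrite osc_ratioX exprVn -powR_mulrn ?ler0n// -powRN ler_powR ?ler1n// natrM.
  have -> : - (theta / 2) * (2 * n%:R) = - (theta * n%:R) by field.
  by rewrite lerN2.
have Plev j : (P (\big[setU/set0]_(k : grid d (2 ^ j.+1)) big_step q hx ht lambda r k) <=
    (D * 2^-1 ^+ j)%:E)%E.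
  apply: (@le_trans _ _ (\sum_(k : grid d (2 ^ j.+1)) P (big_step q hx ht lambda r k))%E).
    apply: measure_bigsetU_le => k.
    apply: measurable_set_ge; apply: measurableT_comp => //.
    by apply: measurable_funB; exact: measurable_funPT.
  apply: (le_trans (lee_sum _ (fun k _ => Pstep j k))).
  rewrite sumEFin lee_fin sumr_const card_prod card_ffun !card_ord -expnSr.
  rewrite -[leLHS]mulr_natl natrX natrX -exprM mulnC.
  apply: (@le_trans _ _ (2 ^+ (d.+1 * j.+1) * (2 * (2 * n%:R) ^+ n / lambda ^+ (2 * n) * (2^-1 ^+ d.+2) ^+ j))).
    rewrite ler_wpM2l ?exprn_ge0// ler_wpM2l//.
      by rewrite divr_ge0 ?mulr_ge0 ?exprn_ge0 ?mulr_ge0// ltW.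
    rewrite (exprM _ (2 * n)) lerXn2r ?nnegrE ?exprn_ge0 ?invr_ge0 ?(ltW x0)//.
  have pw : 2 ^+ (d.+1 * j.+1) * (2^-1 ^+ d.+2) ^+ j = 2 ^+ d.+1 * 2^-1 ^+ j :> R.
    rewrite mulnS exprD exprM (exprSr _ d.+1) (exprMn j) -mulrA; congr (_ * _).
    by rewrite mulrA -!exprMn divff ?pnatr_eq0// !expr1n mul1r.
  rewrite mulrCA pw /D /C le_eqVlt; apply/orP; left; apply/eqP.
  move: (2 ^+ d.+1 : R) ((2 * n%:R) ^+ n : R) (lambda ^+ _)^-1 (2^-1 ^+ j : R).
  by move=> *; ring.
apply: (@le_trans _ _ (\sum_(0 <= j <oo) P (\big[setU/set0]_(k : grid d (2 ^ j.+1)) big_step q hx ht lambda r k))%E).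
  apply: (measure_sigma_subadditive P) => //.
  - move=> j; apply: bigsetU_measurable => k _.
    apply: measurable_set_ge; apply: measurableT_comp => //.
    by apply: measurable_funB; exact: measurable_funPT.
  - exact: measurable_big_osc.
apply: lime_le; first by apply: is_cvg_nneseries => j _ _; exact: measure_ge0.
apply: nearW => m; apply: (@le_trans _ _ (\sum_(0 <= j < m) (D * 2^-1 ^+ j)%:E)%E).
  by apply: lee_sum => j _; exact: Plev.
have -> : C * 2 / lambda ^+ (2 * n) = D * 2 by exact: mulrAC.
rewrite sumEFin lee_fin -mulr_sumr.
rewrite ler_wpM2l ?(ltW D0)// big_mkord.
have -> : \sum_(j < m) 2^-1 ^+ j = 2 - 2 * 2^-1 ^+ m :> R.
  elim: m => [|m IHm]; first by rewrite big_ord0 expr0 mulr1 subrr.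
  by rewrite big_ord_recr/= IHm exprS; field.
by rewrite lerBlDr lerDl mulr_ge0// exprn_ge0.
Qed.

End oscillation.

(** * Covering the level set *)

Section cell_cover.
Context (R : realType) (d p : nat) (alpha gamma : R).
Hypotheses (p_gt0 : (0 < p)%N) (alpha01 : 0 < alpha <= 1) (gamma01 : 0 < gamma <= 1).
Context (disp : measure_display) (T : measurableType disp) (P : probability T R).
Local Notation I := ('rV[R]_d * R)%type.
Variables (Xs : 'I_p -> I -> {RV P >-> R}) (z : 'rV[R]_p) (K K3 : R).
Hypotheses (K0 : 0 < K) (K30 : 0 < K3).
Hypothesis tail : forall j (u v : I) l tau, 0 < l -> 0 < tau ->
  `|u.2 - v.2| `^ alpha <= tau -> (forall i, `|u.1 ord0 i - v.1 ord0 i| `^ gamma <= tau) ->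
  (P [set w | (l * (K * tau) <= `|Xs j u w - Xs j v w|)%R] <= (2 * expR (- (l ^+ 2 / 2)))%:E)%E.
Hypothesis hit_le : forall u delta, 0 < delta ->
  (P (hit Xs z u delta) <= ((K3 * delta) ^+ p)%:E)%E.

Lemma truncnS_le (y : R) : 1 <= y -> (Num.truncn y).+1%:R <= 2 * y.
Proof.
move=> y1; have y0 : 0 <= y by exact: le_trans y1.
by have /andP[h _] := truncn_itv y0; rewrite -natr1; lra.
Qed.

Lemma truncn_cell (a b h l : R) : 0 < h -> b <= a < b + l ->
  let n := Num.truncn ((a - b) / h) in
  (n < (Num.truncn (l / h)).+1)%N /\ b + h * n%:R <= a < b + h * n%:R + h.
Proof.
move=> h0 /andP[ba al] n.
have y0 : 0 <= (a - b) / h by rewrite divr_ge0 ?(ltW h0)// subr_ge0.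
have /andP[n1 n2] := truncn_itv y0; rewrite -/n in n1 n2.
split; first by rewrite ltnS; apply: le_truncn; rewrite ler_pM2r ?invr_gt0//; lra.
rewrite ler_pdivlMr// in n1; rewrite ltr_pdivrMr// -natr1 in n2; lra.
Qed.

(** First-moment method: a cell containing a point of the level set either has its corner within
    [rho] of a hit or has a large oscillation. Weighted by [r^kappa], the expected number of such
    cells tends to 0 with [r], and Markov's inequality bounds [bad]. Later [kappa = 0] gives
    emptiness and [kappa = min A B * s] a null measure. *)
Lemma cell_cover (A B kappa : R) : 0 < A -> 0 < B -> 0 <= kappa ->
  1 <= alpha * A -> 1 <= gamma * B -> A + d%:R * B - p%:R < kappa ->
  forall (b : I) (eps r0 eta : R), 0 < eps -> 0 < r0 -> 0 < eta ->
  exists (r : R) (bad : set T), [/\ 0 < r, r < r0, measurable bad, (P bad <= eta%:E)%E &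
    forall w, (forall j, continuous (fun u => Xs j u w : R)) -> ~ bad w ->
    exists S : seq I, (size S)%:R * r `^ kappa <= eps /\
    forall u, level_set Xs z w u -> b.2 <= u.2 < b.2 + 1 ->
      (forall i, b.1 ord0 i <= u.1 ord0 i < b.1 ord0 i + 1) ->
      exists2 q, q \in S & `|u.2 - q.2| <= r `^ A /\
        forall i, `|u.1 ord0 i - q.1 ord0 i| <= r `^ B].
Proof.
move=> A0 B0 kappa0 aA gB hk b eps r0 eta eps0 r00 eta0.
have p0 : 0 < (p%:R : R) by rewrite ltr0n.
(* Half of the slack in the exponents. The loss [lambda = r^(- e)] in the oscillation costs the
   factor [r^(- delta)] in the probability of [p] hits, leaving [r^delta]. *)
pose delta := (kappa - A - d%:R * B + p%:R) / 2.
have delta0 : 0 < delta by rewrite divr_gt0//; lra.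
pose e := delta / p%:R.
have e0 : 0 < e by rewrite divr_gt0.
pose theta := Num.min alpha gamma.
have theta0 : 0 < theta by rewrite lt_min; case/andP: alpha01 => ->; case/andP: gamma01 => ->.
pose W := A + d%:R * B + delta.
have W0 : 0 < W by rewrite addr_gt0// ltr_wpDr// mulr_ge0// ltW.
have e20 : 0 < 2 * e by apply: mulr_gt0.
have X0 : 0 <= d.+2%:R / theta by apply: divr_ge0 => //; exact: ltW.
have Y0 : 0 <= W / (2 * e) by apply: divr_ge0; exact: ltW.
(* The first summand makes the chaining bound summable ([n1]); the second makes the probability of a
   large oscillation of order at most [r^W], which offsets the number of cells ([n2]). *)
pose n := (Num.bound (d.+2%:R / theta + W / (2 * e))).+1.
have nb : d.+2%:R / theta + W / (2 * e) <= n%:R.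
  apply: (@le_trans _ _ (Num.bound (d.+2%:R / theta + W / (2 * e)))%:R); last by rewrite ler_nat.
  by apply: ltW; apply: archi_boundP; exact: addr_ge0.
have n1 : d.+2%:R <= theta * n%:R.
  by rewrite mulrC -ler_pdivrMr//; apply: le_trans nb; rewrite lerDl.
have n2 : W <= 2 * e * n%:R.
  by rewrite mulrC -ler_pdivrMr//; apply: le_trans nb; rewrite lerDr.
have /choice[Cf CfP] (j : 'I_p) : exists C : R, 0 < C /\
    forall (q : I) (hx ht lambda r : R), 0 < hx -> 0 < ht -> 0 < lambda -> 0 < r ->
    ht `^ alpha <= r -> hx `^ gamma <= r ->
    (P (big_osc alpha gamma (Xs j) K q hx ht lambda r) <= (C / lambda ^+ (2 * n))%:E)%E.
  by have [C C0 CP] := big_osc_prob alpha01 gamma01 (tail j) (ltn0Sn _) n1; exists C.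
pose x := osc_ratio alpha gamma.
have x0 : 0 < x by exact: osc_ratio_gt0.
have x1 : x < 1 by exact: osc_ratio_lt1.
pose K' := K / (1 - x).
have K'0 : 0 < K' by rewrite divr_gt0// subr_gt0.
pose C2 := (K3 * K') ^+ p + \sum_j Cf j.
have sC0 : 0 <= \sum_j Cf j by apply: sumr_ge0 => j _; case: (CfP j) => /ltW.
have C20 : 0 < C2 by rewrite ltr_wpDr// exprn_gt0// mulr_gt0.
pose Cbig := 2 ^+ d.+1 * C2.
have Cbig0 : 0 < Cbig by rewrite mulr_gt0// exprn_gt0.
(* [y] solves [Cbig * y^delta = eta * eps], the bound needed for Markov's inequality. *)
pose y := (eta * eps / Cbig) `^ delta^-1.
have y0 : 0 < y by rewrite powR_gt0// divr_gt0// mulr_gt0.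
pose r := Num.min (Num.min (r0 / 2) 1) y.
have r_gt0 : 0 < r by rewrite !lt_min divr_gt0// ltr01 y0.
have r_lt : r < r0 by rewrite !gt_min; apply/orP; left; apply/orP; left; lra.
have r_le1 : r <= 1 by rewrite !ge_min lexx orbT.
have r_ley : r <= y by rewrite !ge_min lexx orbT.
clearbody r.
have r_ge0 := ltW r_gt0.
have rD : r `^ delta <= eta * eps / Cbig.
  apply: (@le_trans _ _ (y `^ delta)).
    by apply: ge0_ler_powR; rewrite ?nnegrE ?(ltW delta0) ?(ltW y0).
  by rewrite /y -powRrM mulVf ?gt_eqF// powRr1// divr_ge0 ?mulr_ge0// ltW.
have rmono s t : t <= s -> r `^ s <= r `^ t.
  by move=> ts; rewrite /powR gt_eqF// ler_expR ler_wnM2r// ln_le0.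
have rX s t : r `^ s * r `^ t = r `^ (s + t).
  by rewrite powRD// (gt_eqF r_gt0) implybT.
pose hx := r `^ B; pose ht := r `^ A; pose lambda := r `^ (- e).
have hx0 : 0 < hx by rewrite powR_gt0.
have ht0 : 0 < ht by rewrite powR_gt0.
have lambda0 : 0 < lambda by rewrite powR_gt0.
pose rho := lambda * (K * r) / (1 - x).
have rho0 : 0 < rho by rewrite divr_gt0 ?subr_gt0// !mulr_gt0.
pose Mt := (Num.truncn (1 / ht)).+1; pose Mx := (Num.truncn (1 / hx)).+1.
pose J : finType := ({ffun 'I_d -> 'I_Mx} * 'I_Mt)%type.
pose q (k : J) : I := (\row_i (b.1 ord0 i + hx * (k.1 i)%:R), b.2 + ht * k.2%:R).
pose osc (k : J) := \big[setU/set0]_(j < p) big_osc alpha gamma (Xs j) K (q k) hx ht lambda r.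
pose G (k : J) := hit Xs z (q k) rho `|` osc k.
have mosc k : measurable (osc k).
  by apply: bigsetU_measurable => j _; exact: measurable_big_osc.
have mG k : measurable (G k).
  by apply: measurableU => //; exact: measurable_hit.
have PG k : (P (G k) <= (C2 * r `^ (A + d%:R * B - kappa + delta))%:E)%E.
  apply: (le_trans (measureU2 P (measurable_hit Xs z (q k) rho) (mosc k))).
  rewrite /C2 mulrDl EFinD; apply: leeD.
    apply: (le_trans (hit_le (q k) rho0)); rewrite lee_fin.
    have -> : K3 * rho = K3 * K' * r `^ (1 - e).
      rewrite /rho /lambda /K' (addrC 1 (- e)) -rX powRr1//; field.
      by rewrite subr_eq0 gt_eqF.
    rewrite exprMn ler_wpM2l//.
      by apply: exprn_ge0; apply: mulr_ge0; exact: ltW.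
    rewrite -powR_mulrn ?powR_ge0// -powRrM; apply: rmono.
    by rewrite mulrBl mul1r divfK ?gt_eqF// /delta; lra.
  have ha : ht `^ alpha <= r.
    by rewrite /ht -powRrM -[leRHS]powRr1//; apply: rmono; rewrite mulrC.
  have hg : hx `^ gamma <= r.
    by rewrite /hx -powRrM -[leRHS]powRr1//; apply: rmono; rewrite mulrC.
  apply: (le_trans (measure_bigsetU_le P (fun j => measurable_big_osc _ _ _ _ _ _ _ _ _))).
  apply: (@le_trans _ _ (\sum_(j < p) (Cf j / lambda ^+ (2 * n))%:E)%E).
    by apply: lee_sum => j _; case: (CfP j) => _; apply.
  rewrite sumEFin lee_fin -mulr_suml ler_wpM2l//.
  rewrite /lambda -powR_mulrn ?powR_ge0// -powRrM -powRN; apply: rmono.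
  rewrite mulNr opprK natrM (_ : e * (2 * n%:R) = 2 * e * n%:R); last by ring.
  by apply: le_trans n2; rewrite /W lerD2r gerBl.
pose count (w : T) : R := \sum_(k : J) r `^ kappa * \1_(G k) w.
have mcount : measurable_fun [set: T] count by exact: measurable_sum_indic.
have count0 w : 0 <= count w by apply: sumr_ge0 => k _; rewrite mulr_ge0 ?powR_ge0.
pose bad := [set w | eps <= count w].
exists r, bad; split => //.
- exact: measurable_set_ge.
- have Ecount : (\int[P]_w (count w)%:E <= (Cbig * r `^ delta)%:E)%E.
    rewrite expectation_sum_indic//; last by move=> k; exact: powR_ge0.
    rewrite lee_fin; apply: (@le_trans _ _ (\sum_(k : J) r `^ kappa *
        (C2 * r `^ (A + d%:R * B - kappa + delta)))).
      apply: ler_sum => k _; rewrite ler_wpM2l ?powR_ge0//.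
      by rewrite -lee_fin fineK ?fin_num_measure.
    rewrite sumr_const card_prod card_ffun !card_ord -[leLHS]mulr_natl natrM natrX.
    have inv1 (s : R) : 0 < s -> 1 <= 1 / r `^ s.
      move=> s0; rewrite div1r invf_ge1 ?powR_gt0//.
      by rewrite -(powRr0 r); apply: rmono; exact: ltW.
    have cx : Mx%:R ^+ d <= 2 ^+ d * r `^ (- (d%:R * B)).
      have -> : r `^ (- (d%:R * B)) = (1 / hx) ^+ d.
        by rewrite div1r -powRN -powR_mulrn ?powR_ge0// -powRrM mulNr mulrC.
      have h := truncnS_le (inv1 _ B0).
      rewrite -exprMn; apply: lerXn2r => //; rewrite nnegrE ?ler0n//.
      exact: le_trans h.
    have ct : Mt%:R <= 2 * r `^ (- A).
      by rewrite powRN -div1r; exact: truncnS_le (inv1 _ A0).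
    apply: (@le_trans _ _ (2 ^+ d * r `^ (- (d%:R * B)) * (2 * r `^ (- A)) *
        (r `^ kappa * (C2 * r `^ (A + d%:R * B - kappa + delta))))).
      rewrite ler_wpM2r ?mulr_ge0 ?powR_ge0 ?(ltW C20)//.
      by apply: ler_pM; rewrite ?exprn_ge0 ?ler0n.
    rewrite (_ : _ * _ * _ = Cbig * (r `^ (- (d%:R * B)) * r `^ (- A) * r `^ kappa *
        r `^ (A + d%:R * B - kappa + delta))); last by rewrite /Cbig exprS; ring.
    rewrite !rX le_eqVlt; apply/orP; left; apply/eqP; congr (_ * r `^ _); ring.
  apply: (le_trans (fine_markov mcount count0 eps0 Ecount)).
  rewrite lee_fin ler_pdivrMr//.
  by rewrite ler_pdivlMr// mulrC in rD.
move=> w cX nbad.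
pose S := [seq q k | k <- enum [pred k | w \in G k]].
exists S; split.
  have : count w <= eps by rewrite leNgt; apply/negP => h; apply: nbad; exact: ltW.
  apply: le_trans; rewrite /S size_map -cardE /count -mulr_sumr mulrC ler_wpM2l ?powR_ge0//.
  rewrite -sum1_card natr_sum big_mkcond/=; apply: ler_sum => k _.
  by rewrite indicE inE; case: (w \in G k).
move=> u Eu u2 u1.
have [t1 t2] := truncn_cell ht0 u2.
have xc i := truncn_cell hx0 (u1 i).
pose k : J := ([ffun i => Ordinal (proj1 (xc i))], Ordinal t1).
have q2 : (q k).2 <= u.2 < (q k).2 + ht by [].
have q1 i : (q k).1 ord0 i <= u.1 ord0 i < (q k).1 ord0 i + hx.
  by rewrite !mxE ffunE /=; case: (xc i).
exists (q k); last first.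
  have ab (a c h : R) : c <= a < c + h -> `|a - c| <= h.
    by move=> /andP[ca ah]; rewrite ger0_norm ?subr_ge0// lerBlDl ltW.
  by split => [|i]; apply: ab.
suff Gk : w \in G k by apply: map_f; rewrite mem_enum.
apply/mem_set.
have [ok|nok] := pselect (osc k w); [by right|left => j].
have nj : ~ big_osc alpha gamma (Xs j) K (q k) hx ht lambda r w.
  by move=> h; apply: nok; rewrite /osc (bigD1 j)//=; left.
have := big_osc_le alpha01 gamma01 K0 hx0 ht0 lambda0 r_gt0 (cX j) nj q2 q1.
rewrite -/x -/rho distrC.
have -> : z ord0 j = Xs j u w by rewrite -Eu mxE.
by [].
Qed.

End cell_cover.

Section hausdorff_upper.
Context (R : realType) (d : nat).
Local Notation I := ('rV[R]_d * R)%type.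

Definition in_box (b : I) (h : R) (u : I) : Prop :=
  b.2 <= u.2 < b.2 + h /\ forall i, b.1 ord0 i <= u.1 ord0 i < b.1 ord0 i + h.

(** Enumerates the integer lattice; naturals that encode no lattice point give the origin, a
    harmless repetition. *)
Definition cube_corner (n : nat) : I :=
  if unpickle n is Some k then
    (\row_i ((k : {ffun 'I_d -> int} * int).1 i)%:~R, k.2%:~R)
  else (0, 0).

Lemma cube_corner_cover (u : I) : exists n, in_box (cube_corner n) 1 u.
Proof.
pose k : {ffun 'I_d -> int} * int := ([ffun i => Num.floor (u.1 ord0 i)], Num.floor u.2).
exists (pickle k); rewrite /in_box /cube_corner pickleK /=; split => [|i].
  by have := floor_itv u.2; rewrite intrD.
by rewrite !mxE ffunE; have := floor_itv (u.1 ord0 i); rewrite intrD.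
Qed.

Lemma nneseries_pairing (f : nat -> nat * nat) (a : nat -> nat -> \bar R) :
  set_bij [set: nat] [set: nat * nat] f -> (forall i j, 0 <= a i j)%E ->
  (\sum_(0 <= m <oo) a (f m).1 (f m).2 = \sum_(0 <= i <oo) \sum_(0 <= j <oo) a i j)%E.
Proof.
move=> fbij a0.
rewrite nneseries_esumT// -(@reindex_esum _ _ _ _ _ f (fun k => a k.1 k.2) fbij).
rewrite nneseries_esumT; last by move=> i; exact: nneseries_ge0.
under [RHS]eq_esum do rewrite nneseries_esumT//.
rewrite (@esum_esum _ _ _ setT (fun=> setT))//; congr esum.
by apply/seteqP; split.
Qed.

(** Countable stability done by hand: the cover of the [n]-th unit cube gets the budget
    [eps / 2^(n + 1)], and the finite covers are merged into one sequence through a bijection with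
    pairs. *)
Lemma hausdorff_measure_eq0 (E : set I) (s : R) : 0 <= s ->
  (forall (n : nat) (eps delta : R), 0 < eps -> 0 < delta ->
    exists (rho : R) (S : seq I), [/\ 0 < rho, rho <= delta,
      (size S)%:R * rho `^ s <= eps &
      forall u, E u -> in_box (cube_corner n) 1 u -> exists2 q, q \in S &
        `|u.2 - q.2| <= rho /\ forall i, `|u.1 ord0 i - q.1 ord0 i| <= rho]) ->
  hausdorff_measure (@euclid_dist R d) s E = 0%E.
Proof.
move=> s0 hE; apply/eqP; rewrite eq_le; apply/andP; split; last first.
  apply: (@le_trans _ _ (hausdorff_premeasure (@euclid_dist R d) s 1 E)); last first.
    by apply: ereal_sup_ubound; exists 1 => //=.
  apply: le_ereal_inf_tmp => _ [F _ <-]; apply: nneseries_ge0 => k _ _.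
  by rewrite /diam_pow; case: ifP => // _; exact: poweR_ge0.
apply: ge_ereal_sup => _ [delta /= delta0 <-].
apply/lee_addgt0Pr => eps eps0; rewrite add0e.
(* A cell of sup-norm radius [rho] has Euclidean diameter at most [c * rho], by comparison with the
   l1 norm. *)
pose c : R := 2 * d.+1%:R.
have c0 : 0 < c by rewrite mulr_gt0// ltr0n.
pose e n := eps / 2 ^+ n.+1 / c `^ s.
have e0 n : 0 < e n by rewrite divr_gt0 ?powR_gt0// divr_gt0// exprn_gt0.
have dc0 : 0 < delta / c by exact: divr_gt0.
have /choice[g gP] n : exists g : R * seq I, [/\ 0 < g.1, g.1 <= delta / c,
      (size g.2)%:R * g.1 `^ s <= e n &
      forall u, E u -> in_box (cube_corner n) 1 u -> exists2 q, q \in g.2 &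
        `|u.2 - q.2| <= g.1 /\ forall i, `|u.1 ord0 i - q.1 ord0 i| <= g.1].
  by have [rho [S hS]] := hE n (e n) (delta / c) (e0 n) dc0; exists (rho, S).
pose cell (q : I) (rho : R) : set I :=
  [set u : I | `|u.2 - q.2| <= rho /\ forall i, `|u.1 ord0 i - q.1 ord0 i| <= rho].
have cell_dist q rho u v : cell q rho u -> cell q rho v -> euclid_dist u v <= c * rho.
  move=> [u2 u1] [v2 v1]; apply: (le_trans (euclid_dist_le _ _)).
  have key (a b b' : R) : `|a - b| <= rho -> `|b' - b| <= rho -> `|a - b'| <= 2 * rho.
    move=> h1 h2; rewrite (_ : a - b' = (a - b) - (b' - b)); last by ring.
    by apply: (le_trans (ler_normB _ _)); lra.
  rewrite (_ : c * rho = 2 * rho + \sum_(i < d) 2 * rho).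
    apply: lerD; first exact: key u2 v2.
    by apply: ler_sum => i _; exact: key (u1 i) (v1 i).
  by rewrite sumr_const card_ord -[_ *+ d]mulr_natl /c -natr1; ring.
(* The finite list is padded by the empty set, of weight 0 even for [s = 0]. *)
pose G n j : set I :=
  if (j < size (g n).2)%N then cell (nth (0, 0) (g n).2 j) (g n).1 else set0.
have Gdiam n j : (ediam (@euclid_dist R d) (G n j) <= (c * (g n).1)%:E)%E.
  apply: ge_ereal_sup => _ [u [v [Gu Gv ->]]]; rewrite lee_fin.
  by move: Gu Gv; rewrite /G; case: ifP => // _; exact: cell_dist.
pose a n j := diam_pow (@euclid_dist R d) s (G n j).
have a0 n j : (0 <= a n j)%E.
  by rewrite /a /diam_pow; case: ifP => // _; exact: poweR_ge0.
have a_le n j : (a n j <= (if (j < size (g n).2)%N then (c * (g n).1) `^ s else 0)%:E)%E.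
  have [g0 _ _ _] := gP n.
  have cg0 : 0 <= c * (g n).1 by rewrite mulr_ge0// ltW.
  rewrite /a /diam_pow; case: ifPn => [_|/set0P Gn0].
    by rewrite lee_fin; case: ifP => // _; exact: powR_ge0.
  have [D [D0 DM -> _]] := ediam_fin Gn0 (Gdiam n j).
  case: ifP => [_|h]; last by move: Gn0; rewrite /G h => -[].
  by rewrite poweR_EFin lee_fin; apply: ge0_ler_powR; rewrite ?nnegrE.
have a_sum n : (\sum_(0 <= j <oo) a n j <= (eps / 2 ^+ n.+1)%:E)%E.
  have [g0 _ gs _] := gP n.
  apply: lime_le; first by apply: is_cvg_nneseries => j _ _.
  apply: nearW => m; apply: (le_trans (lee_sum _ (fun j _ => a_le n j))).
  rewrite sumEFin lee_fin.
  apply: (@le_trans _ _ ((size (g n).2)%:R * (c * (g n).1) `^ s)).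
    set N := size _; set C := _ `^ s; have C0 : 0 <= C by exact: powR_ge0.
    have -> : \sum_(0 <= i < m) (if (i < N)%N then C else 0) = (minn m N)%:R * C.
      elim: m => [|m IHm]; first by rewrite big_geq// min0n mul0r.
      rewrite big_nat_recr//= IHm; case: ltnP => mN.
        by rewrite (minn_idPl mN) -natr1 mulrDl mul1r.
      by rewrite (minn_idPr (leqW mN)) addr0.
    by rewrite ler_wpM2r// ler_nat geq_minr.
  rewrite powRM ?(ltW c0) ?(ltW g0)// mulrCA -ler_pdivlMl ?powR_gt0//.
  by apply: (le_trans gs); rewrite [leRHS]mulrC.
have /card_esym/ppcard_eqP[f] := card_nat2.
have fbij : set_bij [set: nat] [set: nat * nat] f by exact: bij.
apply: (@le_trans _ _ (\sum_(0 <= m <oo) a (f m).1 (f m).2)%E).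
  apply: ereal_inf_lbound; exists (fun m => G (f m).1 (f m).2) => //=; split.
    move=> u Eu; have [n un] := cube_corner_cover u.
    have [_ _ _ /(_ u Eu un)[q qS uq]] := gP n.
    exists (f^-1%FUN (n, index q (g n).2)) => //.
    by rewrite invK ?inE//= /G index_mem qS nth_index.
  move=> m; apply: (le_trans (Gdiam _ _)); rewrite lee_fin.
  by have [_ + _ _] := gP (f m).1; rewrite ler_pdivlMr// mulrC.
rewrite nneseries_pairing//.
apply: lime_le; first by apply: is_cvg_nneseries => j _ _; exact: nneseries_ge0.
apply: nearW => m; apply: (le_trans (lee_sum _ (fun j _ => a_sum j))).
rewrite sumEFin lee_fin big_mkord.
have -> : \sum_(i < m) eps / 2 ^+ i.+1 = eps - eps / 2 ^+ m.
  elim: m => [|m IHm]; first by rewrite big_ord0 expr0 divr1 subrr.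
  rewrite big_ord_recr/= IHm (exprS _ m); field.
  by rewrite gt_eqF// exprn_gt0.
by rewrite lerBlDr lerDl ltW// divr_gt0// exprn_gt0.
Qed.

End hausdorff_upper.

Section level_null.
Context (disp : measure_display) (T : measurableType disp) (R : realType)
  (P : probability T R).

(** The intersection of the exceptional sets for [eta = 1 / (m + 1)] is measurable, null, and
    contains every failure of [Q], whether or not those form a measurable set. *)
Lemma ae_of_small_bad (Q : T -> Prop) :
  (forall eta : R, 0 < eta -> exists bad : set T, [/\ measurable bad,
    (P bad <= eta%:E)%E & forall w, ~ bad w -> Q w]) ->
  {ae P, forall w, Q w}.
Proof.
move=> h.
have /choice[B BP] (m : nat) : exists bad : set T, [/\ measurable bad,
    (P bad <= (m.+1%:R^-1 : R)%:E)%E & forall w, ~ bad w -> Q w].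
  by apply: h; rewrite invr_gt0 ltr0n.
have mB : measurable (\bigcap_m B m).
  by apply: bigcap_measurable => // m _; case: (BP m).
exists (\bigcap_m B m); split => //.
  apply/eqP; rewrite eq_le measure_ge0 andbT; apply/lee_addgt0Pr => e e0; rewrite add0e.
  have [mBm Bm _] := BP (Num.bound e^-1).
  apply: (@le_trans _ _ (P (B (Num.bound e^-1)))).
    by apply: le_measure; rewrite ?inE// => w; exact.
  apply: (le_trans Bm); rewrite lee_fin -[leRHS]invrK lef_pV2 ?posrE ?invr_gt0 ?ltr0n//.
  apply: (@le_trans _ _ (Num.bound e^-1)%:R); last by rewrite ler_nat.
  by rewrite ltW// archi_boundP// invr_ge0 ltW.
move=> w nQ m _; apply: contrapT => nB; apply: nQ.
by case: (BP m) => _ _; exact.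
Qed.

Context (d p : nat) (alpha gamma : R).
Hypotheses (p_gt0 : (0 < p)%N) (alpha01 : 0 < alpha <= 1) (gamma01 : 0 < gamma <= 1).
Local Notation I := ('rV[R]_d * R)%type.
Variables (Xs : 'I_p -> I -> {RV P >-> R}) (z : 'rV[R]_p) (K K3 : R).
Hypotheses (K0 : 0 < K) (K30 : 0 < K3).
Hypothesis tail : forall j (u v : I) l tau, 0 < l -> 0 < tau ->
  `|u.2 - v.2| `^ alpha <= tau -> (forall i, `|u.1 ord0 i - v.1 ord0 i| `^ gamma <= tau) ->
  (P [set w | (l * (K * tau) <= `|Xs j u w - Xs j v w|)%R] <= (2 * expR (- (l ^+ 2 / 2)))%:E)%E.
Hypothesis hit_le : forall u delta, 0 < delta ->
  (P (hit Xs z u delta) <= ((K3 * delta) ^+ p)%:E)%E.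
Hypothesis Xs_continuous : forall j, ae_continuous (Xs j).

Lemma ae_all_continuous :
  {ae P, forall w, forall j, continuous (fun u => Xs j u w : R)}.
Proof. by apply: filter_forall => j; exact: Xs_continuous. Qed.

(** A cell of sides [r^A] and [r^B] fits in a cube of side [r^(min A B)], as [r <= 1]; the sum of
    the [s]-th powers is then the quantity controlled by [cell_cover] with [kappa = min A B * s]. *)
Lemma level_set_null (A B s : R) : 0 < A -> 0 < B -> 0 <= s ->
  1 <= alpha * A -> 1 <= gamma * B -> A + d%:R * B - p%:R < Num.min A B * s ->
  {ae P, forall w, hausdorff_measure (@euclid_dist R d) s (level_set Xs z w) = 0%E}.
Proof.
move=> A0 B0 s0 aA gB hs; set H := Num.min A B in hs.
have H0 : 0 < H by rewrite lt_min A0 B0.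
have Hs0 : 0 <= H * s by rewrite mulr_ge0// ltW.
(* Integer parameters [n], [k] stand for the cube and the two small reals, so that only countably
   many almost sure statements are combined. *)
pose Q (n : nat) (k : nat) (w : T) := (forall j, continuous (fun u => Xs j u w : R)) ->
  exists (rho : R) (S : seq I), [/\ 0 < rho, rho <= k.+1%:R^-1,
      (size S)%:R * rho `^ s <= k.+1%:R^-1 &
      forall u, level_set Xs z w u -> in_box (cube_corner R d n) 1 u -> exists2 q, q \in S &
        `|u.2 - q.2| <= rho /\ forall i, `|u.1 ord0 i - q.1 ord0 i| <= rho].
have aeQ n k : {ae P, forall w, Q n k w}.
  apply: ae_of_small_bad => eta eta0.
  have k0 : 0 < (k.+1%:R^-1 : R) by rewrite invr_gt0 ltr0n.
  pose r0 : R := Num.min 1 (k.+1%:R^-1 `^ H^-1).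
  have r00 : 0 < r0 by rewrite lt_min ltr01 powR_gt0.
  have [r [bad [r_gt0 rr0 mbad Pbad cov]]] :=
    cell_cover p_gt0 alpha01 gamma01 K0 K30 tail hit_le A0 B0 Hs0 aA gB hs
      (cube_corner R d n) k0 r00 eta0.
  exists bad; split => // w nbad cX; have [S [Ssize Scov]] := cov w cX nbad.
  have r1 : r <= 1 by move: rr0; rewrite lt_min => /andP[/ltW].
  have rk : r <= k.+1%:R^-1 `^ H^-1 by move: rr0; rewrite lt_min => /andP[_ /ltW].
  have rmono s' t : t <= s' -> r `^ s' <= r `^ t.
    by move=> ts; rewrite /powR gt_eqF// ler_expR ler_wnM2r// ln_le0.
  exists (r `^ H), S; split.
  - exact: powR_gt0.
  - apply: (@le_trans _ _ ((k.+1%:R^-1 `^ H^-1) `^ H)).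
      by apply: ge0_ler_powR; rewrite ?nnegrE ?powR_ge0 ?(ltW H0) ?(ltW r_gt0).
    by rewrite -powRrM mulVf ?gt_eqF// powRr1// ltW.
  - by rewrite -powRrM.
  - move=> u Eu [u2 u1]; have [q qS [q2 q1]] := Scov u Eu u2 u1.
    exists q => //; split => [|i].
      by apply: (le_trans q2); apply: rmono; rewrite ge_min lexx.
    by apply: (le_trans (q1 i)); apply: rmono; rewrite ge_min lexx orbT.
have /ae_foralln aeQ2 := fun n => (ae_foralln (fun k => aeQ n k)).
apply: filterS2 aeQ2 ae_all_continuous => w Qw cX.
apply: hausdorff_measure_eq0 => // n eps delta eps0 delta0.
pose k := Num.bound ((Num.min eps delta)^-1).
have m0 : 0 < Num.min eps delta by rewrite lt_min eps0 delta0.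
have kle : k.+1%:R^-1 <= Num.min eps delta.
  rewrite -[leRHS]invrK lef_pV2 ?posrE ?invr_gt0 ?ltr0n//.
  apply: (@le_trans _ _ k%:R); last by rewrite ler_nat.
  by rewrite ltW// archi_boundP// invr_ge0 ltW.
rewrite le_min in kle; have /andP[ke kd] := kle.
have [rho [S [rho0 rhok Sk cov]]] := Qw n k cX.
by exists rho, S; split => //; [exact: le_trans kd|exact: le_trans ke].
Qed.

(** With [kappa = 0] and [eps = 1/2] the list of cells has length at most 1/2, hence is empty. *)
Lemma level_set_empty : alpha^-1 + d%:R / gamma < p%:R ->
  {ae P, forall w, level_set Xs z w = set0}.
Proof.
move=> hp.
have [alpha0 _] := andP alpha01; have [gamma0 _] := andP gamma01.
have hk : alpha^-1 + d%:R * gamma^-1 - p%:R < 0 by rewrite subr_lt0.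
have aA : 1 <= alpha * alpha^-1 by rewrite mulfV// gt_eqF.
have gB : 1 <= gamma * gamma^-1 by rewrite mulfV// gt_eqF.
have A0 : 0 < alpha^-1 by rewrite invr_gt0.
have B0 : 0 < gamma^-1 by rewrite invr_gt0.
pose Q (n : nat) (w : T) := (forall j, continuous (fun u => Xs j u w : R)) ->
  forall u, level_set Xs z w u -> ~ in_box (cube_corner R d n) 1 u.
have aeQ n : {ae P, forall w, Q n w}.
  apply: ae_of_small_bad => eta eta0.
  have h0 : 0 < (2^-1 : R) by rewrite invr_gt0.
  have [r [bad [r_gt0 _ mbad Pbad cov]]] :=
    cell_cover p_gt0 alpha01 gamma01 K0 K30 tail hit_le A0 B0 (lexx 0) aA gB hk
      (cube_corner R d n) h0 ltr01 eta0.
  exists bad; split => // w nbad cX u Eu [u2 u1].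
  have [S [Ssize Scov]] := cov w cX nbad.
  have [q] := Scov u Eu u2 u1.
  case: S Ssize {Scov} => [|q' S]; first by rewrite in_nil.
  rewrite powRr0 mulr1 => h _ _.
  have : 1 <= ((size (q' :: S))%:R : R) by rewrite ler1n.
  lra.
apply: filterS2 (ae_foralln aeQ) ae_all_continuous => w Qw cX.
apply/seteqP; split => // u Eu; have [n un] := cube_corner_cover u.
exact: Qw n cX u Eu un.
Qed.

End level_null.

(** * The level sets of the field *)

Section independent_estimates.
Context (R : realType) (d p : nat).
Variables (sigma a c alpha beta gamma : R).
Hypotheses (sigma0 : 0 < sigma) (a0 : 0 < a) (c0 : 0 < c)
  (alpha01 : 0 < alpha <= 1) (beta01 : 0 < beta <= 1) (gamma01 : 0 < gamma <= 1).
Local Notation cov := (@space_time_cov R d sigma a c alpha beta gamma).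
Local Notation I := ('rV[R]_d * R)%type.
Context (disp : measure_display) (T : measurableType disp) (P : probability T R).
Variables (Xs : 'I_p -> I -> {RV P >-> R}) (z : 'rV[R]_p).
Hypothesis Xs_law : forall j, @pair_law R d sigma a c alpha beta gamma _ _ P (fun u => Xs j u).
Hypothesis Xs_indep : independent_fields Xs.

Definition comp_hit (j : 'I_p) (u : I) (delta : R) : set T :=
  [set w | `|Xs j u w - z ord0 j| <= delta].

Lemma hitE u delta : hit Xs z u delta = \bigcap_j comp_hit j u delta.
Proof. by apply/seteqP; split => [w h j _|w h j]; exact: h. Qed.

Lemma measurable_comp_hit j u delta : measurable (comp_hit j u delta).
Proof.
rewrite -[X in measurable X]setTI.
have mX : measurable_fun [set: T] (Xs j u) by exact: measurable_funPT.
exact: (mX measurableT _ (measurable_normle _ _)).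
Qed.

Lemma comp_hit_field j u delta : field_sigma_algebra (Xs j) (comp_hit j u delta).
Proof.
apply: sub_gen_smallest; exists u => //; exists [set x | `|x - z ord0 j| <= delta].
  exact: measurable_normle.
by rewrite setTI.
Qed.

Lemma comp_hit2_field j u v delta :
  field_sigma_algebra (Xs j) (comp_hit j u delta `&` comp_hit j v delta).
Proof.
have hu : field_sigma_algebra (Xs j) (comp_hit j u delta) by exact: comp_hit_field.
have hv : field_sigma_algebra (Xs j) (comp_hit j v delta) by exact: comp_hit_field.
exact: (@measurableI _ (g_sigma_algebraType
  (\bigcup_u preimage_set_system [set: T] (Xs j u) measurable)) _ _ hu hv).
Qed.

Lemma indep_prob_le (E : 'I_p -> set T) (x : R) : (forall j, measurable (E j)) ->
  (forall j, field_sigma_algebra (Xs j) (E j)) ->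
  (forall j, (P (E j) <= x%:E)%E) -> (P (\bigcap_j E j) <= (x ^+ p)%:E)%E.
Proof.
move=> mE fE Ex; rewrite Xs_indep//.
under eq_bigr do rewrite -[P _]fineK ?fin_num_measure//.
rewrite prodEFin lee_fin -[in leRHS](card_ord p) -prodr_const; apply: ler_prod => j _.
by rewrite fine_ge0//= -lee_fin fineK ?fin_num_measure.
Qed.

Lemma indep_prob_ge (E : 'I_p -> set T) (x : R) : 0 <= x -> (forall j, measurable (E j)) ->
  (forall j, field_sigma_algebra (Xs j) (E j)) ->
  (forall j, (x%:E <= P (E j))%E) -> ((x ^+ p)%:E <= P (\bigcap_j E j))%E.
Proof.
move=> x0 mE fE Ex; rewrite Xs_indep//.
under eq_bigr do rewrite -[P _]fineK ?fin_num_measure//.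
rewrite prodEFin lee_fin -[in leLHS](card_ord p) -prodr_const; apply: ler_prod => j _.
by rewrite x0/= -lee_fin fineK ?fin_num_measure.
Qed.

Lemma hit_prob_ge : exists2 K1 : R, 0 < K1 & forall u delta, 0 <= delta <= 1 ->
  (((K1 * delta) ^+ p)%:E <= P (hit Xs z u delta))%E.
Proof.
have [k k0 kP] := @field_ball_ge R d sigma a c alpha beta gamma sigma0 _ _ P (\sum_j `|z ord0 j|).
exists k => // u delta d01; rewrite hitE; apply: indep_prob_ge.
- by case/andP: d01 => d0 _; rewrite mulr_ge0// ltW.
- by move=> j; exact: measurable_comp_hit.
- by move=> j; exact: comp_hit_field.
- move=> j; apply: (kP (Xs j) (Xs_law j)) => //.
  by rewrite (bigD1 j)//= lerDl sumr_ge0.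
Qed.

Lemma hit_prob_le : exists2 K3 : R, 0 < K3 & forall u delta, 0 < delta ->
  (P (hit Xs z u delta) <= ((K3 * delta) ^+ p)%:E)%E.
Proof.
have [K K0 KP] := @pair_ball_le R d sigma a c alpha beta gamma sigma0 a0 c0 beta01 _ _ P.
exists K => // u delta delta0; rewrite hitE; apply: indep_prob_le.
- by move=> j; exact: measurable_comp_hit.
- by move=> j; exact: comp_hit_field.
(* The two-point bound on the diagonal, with [r = delta], is a one-point bound. *)
- move=> j; have := KP (Xs j) (Xs_law j) u u (z ord0 j) delta delta delta0 delta0 (or_introl (lexx _)).
  rewrite expr2 mulrA mulfK ?gt_eqF//; apply: le_trans.
  rewrite le_eqVlt; apply/orP; left; apply/eqP; congr (P _).
  by apply/seteqP; split => w /=; [move=> h; split|case].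
Qed.

Lemma two_hits_prob_le : exists2 K2 : R, 0 < K2 &
  forall (u v : I) delta r, 0 < delta -> 0 < r ->
  `|u.2 - v.2| <= 1 -> (forall i, `|u.1 ord0 i - v.1 ord0 i| <= 1) ->
  [\/ r <= delta, r <= `|u.2 - v.2| `^ alpha |
     exists i, r <= `|u.1 ord0 i - v.1 ord0 i| `^ gamma] ->
  (P (hit Xs z u delta `&` hit Xs z v delta) <= ((K2 * delta ^+ 2 / r) ^+ p)%:E)%E.
Proof.
have [K K0 KP] := @pair_ball_le R d sigma a c alpha beta gamma sigma0 a0 c0 beta01 _ _ P.
have [M M0 MP] := @increment_variance_ge R d sigma a c alpha beta gamma
  sigma0 a0 c0 alpha01 beta01 gamma01.
(* With [m >= 1] and [m >= M], the radius [r / m] meets either alternative of [pair_ball_le]. *)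
pose m := M + 1; have m1 : 1 <= m by rewrite lerDr ltW.
have m0 : 0 < m by exact: lt_le_trans m1.
exists (K * m); first exact: mulr_gt0.
move=> u v delta r delta0 r0 uv2 uv1 hr.
have r'0 : 0 < r / m by exact: divr_gt0.
have rr' : r / m <= r by rewrite ler_pdivrMr// ler_peMr// ltW.
have cond : r / m <= delta \/ (r / m) ^+ 2 <= 2 * (sigma ^+ 2 - cov (u.1 - v.1) (u.2 - v.2)).
  have right (h : r <= `|u.2 - v.2| `^ alpha \/
       (exists i, r <= `|(u.1 - v.1) ord0 i| `^ gamma)) :
      (r / m) ^+ 2 <= 2 * (sigma ^+ 2 - cov (u.1 - v.1) (u.2 - v.2)).
    have uv1' i : `|(u.1 - v.1) ord0 i| <= 1 by rewrite !mxE.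
    have := MP (u.1 - v.1) (u.2 - v.2) r (ltW r0) uv2 uv1' h.
    set X := 2 * _ => hX.
    have X0 : 0 <= X.
      by rewrite -(pmulr_rge0 _ M0); apply: le_trans hX; exact: sqr_ge0.
    rewrite expr_div_n ler_pdivrMr ?exprn_gt0//; apply: (le_trans hX).
    rewrite mulrC ler_wpM2l// expr2.
    apply: (@le_trans _ _ (m * 1)); first by rewrite mulr1 lerDl.
    by rewrite ler_wpM2l// ltW.
  case: hr => [h|h|[i h]].
  - by left; exact: le_trans h.
  - by right; apply: right; left.
  - by right; apply: right; right; exists i; rewrite !mxE.
rewrite !hitE -bigcapI; apply: indep_prob_le.
- by move=> j; apply: measurableI; exact: measurable_comp_hit.
- by move=> j; exact: comp_hit2_field.
- move=> j; apply: (le_trans (KP (Xs j) (Xs_law j) u v (z ord0 j) delta (r / m) delta0 r'0 cond)).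
  rewrite lee_fin le_eqVlt; apply/orP; left; apply/eqP; field.
  by rewrite !gt_eqF.
Qed.

Lemma increment_tail : exists2 K : R, 0 < K &
  forall j (u v : I) l tau, 0 < l -> 0 < tau ->
  `|u.2 - v.2| `^ alpha <= tau -> (forall i, `|u.1 ord0 i - v.1 ord0 i| `^ gamma <= tau) ->
  (P [set w | (l * (K * tau) <= `|Xs j u w - Xs j v w|)%R] <= (2 * expR (- (l ^+ 2 / 2)))%:E)%E.
Proof.
have [K K0 KP] := @increment_variance_le R d sigma a c alpha beta gamma a0 c0 beta01 gamma01.
exists K => // j u v l tau l0 tau0 h2 h1.
apply: (pair_tail_le a0 c0 beta01 (Xs_law j) l0); first exact: mulr_gt0.
apply: KP => //; first exact: ltW.
by move=> i; rewrite !mxE.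
Qed.

End independent_estimates.

Section dimension.
Context (R : realType) (d : nat).
Local Notation I := ('rV[R]_d * R)%type.

(** The upper bound asks only for a sequence of exponents, as it comes from almost sure statements
    obtained one exponent at a time. *)
Lemma hausdorff_dim_eq (E : set I) (s : R) : 0 <= s ->
  (forall n : nat, hausdorff_measure (@euclid_dist R d) (s + n.+1%:R^-1) E = 0%E) ->
  (forall t, 0 <= t < s -> hausdorff_measure (@euclid_dist R d) t E <> 0%E) ->
  hausdorff_dim (@euclid_dist R d) E = s%:E.
Proof.
move=> s0 Eup Elow; apply/eqP; rewrite eq_le; apply/andP; split.
  apply/lee_addgt0Pr => e e0; pose n := Num.bound e^-1.
  apply: (@le_trans _ _ (s + n.+1%:R^-1)%:E).
    by apply: ereal_inf_lbound; exists (s + n.+1%:R^-1) => //; split => //; rewrite addr_ge0.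
  rewrite lee_fin lerD2l -[leRHS]invrK lef_pV2 ?posrE ?invr_gt0 ?ltr0n//.
  apply: (@le_trans _ _ n%:R); last by rewrite ler_nat.
  by rewrite ltW// archi_boundP// invr_ge0 ltW.
apply: le_ereal_inf_tmp => _ [t [t0 Et] <-]; rewrite lee_fin leNgt; apply/negP => ts.
by apply: Elow Et; rewrite t0.
Qed.

Context (p : nat) (alpha gamma : R).
Hypotheses (p_gt0 : (0 < p)%N) (alpha01 : 0 < alpha <= 1) (gamma01 : 0 < gamma <= 1).
Context (disp : measure_display) (T : measurableType disp) (P : probability T R).
Variables (Xs : 'I_p -> I -> {RV P >-> R}) (z : 'rV[R]_p) (K K1 K2 K3 : R).
Hypotheses (K_gt0 : 0 < K) (K1_gt0 : 0 < K1) (K2_gt0 : 0 < K2) (K3_gt0 : 0 < K3).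
Hypothesis tail : forall j (u v : I) l tau, 0 < l -> 0 < tau ->
  `|u.2 - v.2| `^ alpha <= tau -> (forall i, `|u.1 ord0 i - v.1 ord0 i| `^ gamma <= tau) ->
  (P [set w | (l * (K * tau) <= `|Xs j u w - Xs j v w|)%R] <= (2 * expR (- (l ^+ 2 / 2)))%:E)%E.
Hypothesis hit_ge : forall u delta, 0 <= delta <= 1 ->
  (((K1 * delta) ^+ p)%:E <= P (hit Xs z u delta))%E.
Hypothesis two_hits : forall (u v : I) delta r, 0 < delta -> 0 < r ->
  `|u.2 - v.2| <= 1 -> (forall i, `|u.1 ord0 i - v.1 ord0 i| <= 1) ->
  [\/ r <= delta, r <= `|u.2 - v.2| `^ alpha |
     exists i, r <= `|u.1 ord0 i - v.1 ord0 i| `^ gamma] ->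
  (P (hit Xs z u delta `&` hit Xs z v delta) <= ((K2 * delta ^+ 2 / r) ^+ p)%:E)%E.
Hypothesis hit_le : forall u delta, 0 < delta ->
  (P (hit Xs z u delta) <= ((K3 * delta) ^+ p)%:E)%E.
Hypothesis Xs_continuous : forall j, ae_continuous (Xs j).

(** The identity for [s] makes [s] the critical exponent of [level_set_null], so all
    [s + 1 / (n + 1)] give measure zero off a null set; on the event of [lower_event] every smaller
    exponent lies under some subcritical [t i]. *)
Lemma level_set_dim (A B s : R) : 0 < A -> 0 < B -> 0 < s ->
  1 <= alpha * A -> 1 <= gamma * B -> A + d%:R * B - p%:R = Num.min A B * s ->
  (forall t, 0 < t < s -> subcritical d p alpha gamma t) ->
  positive_probability P [set w |
    hausdorff_dim (@euclid_dist R d) (level_set Xs z w) = s%:E].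
Proof.
move=> A0 B0 s0 aA gB hs sub.
have H0 : 0 < Num.min A B by rewrite lt_min A0 B0.
(* Increases to [s] and is positive from [i = 0] on. *)
pose t (i : nat) : R := s * (1 - i.+2%:R^-1).
have i0 (i : nat) : 0 < (i.+2%:R^-1 : R) by rewrite invr_gt0 ltr0n.
have t0 i : 0 < t i.
  by rewrite mulr_gt0// subr_gt0 invf_lt1 ?ltr0n// ltr1n.
have ts i : t i < s by rewrite gtr_pMr// gtrBl.
have tsub i : subcritical d p alpha gamma (t i) by apply: sub; rewrite t0 ts.
have [E [mE PE hE]] := lower_event alpha01 gamma01 K1_gt0 K2_gt0 hit_ge two_hits tsub.
have ae_up : {ae P, forall w, forall n : nat,
    hausdorff_measure (@euclid_dist R d) (s + n.+1%:R^-1) (level_set Xs z w) = 0%E}.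
  apply: ae_foralln => n.
  have n0 : 0 < (n.+1%:R^-1 : R) by rewrite invr_gt0 ltr0n.
  apply: (level_set_null p_gt0 alpha01 gamma01 K_gt0 K3_gt0 tail hit_le Xs_continuous A0 B0) => //.
    by rewrite addr_ge0// ltW.
  by rewrite hs ltr_pM2l// ltrDl.
have [N [mN PN Nsub]] : {ae P, forall w, (forall n : nat,
    hausdorff_measure (@euclid_dist R d) (s + n.+1%:R^-1) (level_set Xs z w) = 0%E) /\
    forall j, continuous (fun u => Xs j u w : R)}.
  by apply: filterS2 ae_up (ae_all_continuous Xs_continuous) => w.
exists (E `\` N); split; first exact: measurableD.
  move=> w [Ew Nw].
  have [up cX] : (forall n : nat,
      hausdorff_measure (@euclid_dist R d) (s + n.+1%:R^-1) (level_set Xs z w) = 0%E) /\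
      forall j, continuous (fun u => Xs j u w : R).
    by apply: contrapT => h; apply: Nw; exact: Nsub.
  apply: hausdorff_dim_eq => //; first exact: ltW.
  move=> r /andP[r0 rs].
  have sr0 : 0 < s - r by rewrite subr_gt0.
  pose i := Num.bound (s / (s - r)).
  have ri : r <= t i.
    have : s / (s - r) <= i.+2%:R.
      apply: (@le_trans _ _ i%:R); last by rewrite ler_nat -addn2 leq_addr.
      by apply: ltW; apply: archi_boundP; apply: divr_ge0; exact: ltW.
    rewrite ler_pdivrMr// => h.
    have : s / i.+2%:R <= s - r by rewrite ler_pdivrMr ?ltr0n// mulrC.
    by rewrite /t mulrBr mulr1 lerBrDr lerBrDl.
  have [c [L [c0 L0 freq]]] := hE w Ew i.
  by apply: (hausdorff_measure_neq0 alpha01 gamma01 cX (t0 i) _ c0 L0 freq); rewrite r0.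
apply: lt_le_trans PE _.
apply: (@le_trans _ _ (P (E `\` N) + P N)%E); last by rewrite PN adde0.
apply: le_trans (measureU2 P _ _) => //; last exact: measurableD.
apply: le_measure; rewrite ?inE//; first by apply: measurableU => //; exact: measurableD.
by move=> w Ew; have [Nw|Nw] := pselect (N w); [right|left].
Qed.

End dimension.

(** * Distribution of the exponents over time and space *)

Section exponents.
Context (R : realType) (d p : nat) (alpha gamma : R).
Hypotheses (d_gt0 : (0 < d)%N) (alpha0 : 0 < alpha) (gamma0 : 0 < gamma).

Let d0 : 0 < (d%:R : R). Proof. by rewrite ltr0n. Qed.

(** Time alone can carry all of [p], since [alpha p < 1]. The remaining room, [1 - alpha p] in time
    and 1 in each space coordinate, is filled by the energy exponent in the same proportion
    [t / s]. *)
Lemma subcritical_time (t : R) : alpha * p%:R < 1 ->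
  0 < t < d%:R + 1 - alpha * p%:R -> subcritical d p alpha gamma t.
Proof.
move=> ap /andP[t0 ts]; set s := d%:R + 1 - alpha * p%:R in ts.
have s0 : 0 < s by exact: lt_trans ts.
have tau0 : 0 < t / s by exact: divr_gt0.
have tau1 : t / s < 1 by rewrite ltr_pdivrMr// mul1r.
have ap0 : 0 < 1 - alpha * p%:R by rewrite subr_gt0.
exists ((1 - alpha * p%:R) * (t / s)), (t / s), p%:R, 0; split.
- by split; [apply: mulr_ge0; exact: ltW|exact: ltW|exact: ler0n|exact: lexx].
- by rewrite mulr0 addr0.
- rewrite -mulrDl (_ : 1 - _ + _ = s); last by rewrite /s; ring.
  by rewrite mulrC divfK ?gt_eqF.
- have : (1 - alpha * p%:R) * (t / s) < 1 - alpha * p%:R by rewrite gtr_pMr.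
  by lra.
- by rewrite mulr0 addr0.
Qed.

(** Dually, space carries all of [p] in equal shares [p / d]. *)
Lemma subcritical_space (t : R) : gamma * p%:R < d%:R ->
  0 < t < d%:R + 1 - gamma * p%:R -> subcritical d p alpha gamma t.
Proof.
move=> gp /andP[t0 ts]; set s := d%:R + 1 - gamma * p%:R in ts.
have s0 : 0 < s by exact: lt_trans ts.
have tau0 : 0 < t / s by exact: divr_gt0.
have tau1 : t / s < 1 by rewrite ltr_pdivrMr// mul1r.
have y1 : 0 < 1 - gamma * p%:R / d%:R by rewrite subr_gt0 ltr_pdivrMr// mul1r.
exists (t / s), ((1 - gamma * p%:R / d%:R) * (t / s)), 0, (p%:R / d%:R); split.
- by split; [exact: ltW|apply: mulr_ge0; exact: ltW|exact: lexx|exact: divr_ge0].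
- by rewrite add0r mulrC divfK ?gt_eqF.
- rewrite mulrA -[X in X + _]mul1r -mulrDl.
  have -> : 1 + d%:R * (1 - gamma * p%:R / d%:R) = s by rewrite /s; field; rewrite gt_eqF.
  by rewrite mulrC divfK ?gt_eqF.
- by rewrite mulr0 addr0.
- have : (1 - gamma * p%:R / d%:R) * (t / s) < 1 - gamma * p%:R / d%:R by rewrite gtr_pMr.
  rewrite mulrA; lra.
Qed.

(** Time cannot carry [p]: it is saturated up to [e] by [p0 = (1 - e) / alpha] and receives no
    energy exponent, while space takes the rest of [p] and all of [t]. The slack is paid out of
    [s - t]: its cost [gamma / alpha * e] is at most half of that gap. *)
Lemma subcritical_mixed_space (t : R) : 1 <= alpha * p%:R ->
  0 < t < d%:R + gamma / alpha - gamma * p%:R -> subcritical d p alpha gamma t.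
Proof.
move=> ap /andP[t0 ts]; pose Y := gamma / alpha.
have Y0 : 0 < Y by exact: divr_gt0.
rewrite -/Y in ts; set s := d%:R + Y - gamma * p%:R in ts.
have Y20 : 0 < 2 * Y by exact: mulr_gt0.
pose e := Num.min 2^-1 ((s - t) / (2 * Y)).
have e0 : 0 < e by rewrite lt_min invr_gt0 ltr0n/= divr_gt0 ?subr_gt0.
have e2 : e <= 2^-1 by rewrite /e ge_min lexx.
have Ye : 2 * (Y * e) <= s - t.
  by rewrite mulrA (mulrC _ e) -ler_pdivlMr// /e ge_min lexx orbT.
clearbody e.
exists 0, (t / d%:R), ((1 - e) / alpha), ((p%:R - (1 - e) / alpha) / d%:R); split.
- split => //; [exact: divr_ge0 (ltW t0) _|by apply: divr_ge0 (ltW alpha0); lra|].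
  apply: divr_ge0 => //; rewrite subr_ge0 ler_pdivrMr// mulrC; lra.
- by field; rewrite !gt_eqF.
- by rewrite add0r mulrC divfK ?gt_eqF.
- by rewrite add0r mulrC divfK ?gt_eqF//; lra.
- rewrite mulrA -mulrDl ltr_pdivrMr// mul1r.
  have -> : gamma * (p%:R - (1 - e) / alpha) = gamma * p%:R - Y + Y * e.
    by rewrite /Y; field; rewrite gt_eqF.
  have Ye0 : 0 < Y * e by exact: mulr_gt0.
  move: Ye ts; rewrite /s; lra.
Qed.

(** Dually, each space coordinate is saturated up to [e] by [p1 = (1 - e) / gamma], and time takes
    the rest of [p] and all of [t]. *)
Lemma subcritical_mixed_time (t : R) : d%:R <= gamma * p%:R ->
  0 < t < d%:R * alpha / gamma + 1 - alpha * p%:R -> subcritical d p alpha gamma t.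
Proof.
move=> gp /andP[t0 ts]; pose Y := d%:R * alpha / gamma.
have Y0 : 0 < Y by rewrite divr_gt0// mulr_gt0.
rewrite -/Y in ts; set s := Y + 1 - alpha * p%:R in ts.
have Y20 : 0 < 2 * Y by exact: mulr_gt0.
pose e := Num.min 2^-1 ((s - t) / (2 * Y)).
have e0 : 0 < e by rewrite lt_min invr_gt0 ltr0n/= divr_gt0 ?subr_gt0.
have e2 : e <= 2^-1 by rewrite /e ge_min lexx.
have Ye : 2 * (Y * e) <= s - t.
  by rewrite mulrA (mulrC _ e) -ler_pdivlMr// /e ge_min lexx orbT.
clearbody e.
have e1 : 0 <= 1 - e by lra.
have de : d%:R * (1 - e) <= d%:R by rewrite ler_piMr//; lra.
exists t, 0, (p%:R - d%:R * (1 - e) / gamma), ((1 - e) / gamma); split.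
- split => //; [exact: ltW| |exact: divr_ge0 e1 (ltW gamma0)].
  by rewrite subr_ge0 ler_pdivrMr// [leRHS]mulrC; exact: le_trans gp.
- by field; rewrite gt_eqF.
- by rewrite mulr0 addr0.
- have -> : alpha * (p%:R - d%:R * (1 - e) / gamma) = alpha * p%:R - Y + Y * e.
    by rewrite /Y; field; rewrite gt_eqF.
  have Ye0 : 0 < Y * e by exact: mulr_gt0.
  move: Ye ts; rewrite /s; lra.
- by rewrite add0r mulrC divfK ?gt_eqF//; lra.
Qed.

End exponents.

Theorem proposition6p3 (R : realType) (d : nat) (hd : (1 <= d)%N)
    (sigma a c alpha beta gamma : R)
    (hsigma : 0 < sigma) (ha : 0 < a) (hc : 0 < c)
    (halpha : 0 < alpha <= 1) (hbeta : 0 < beta <= 1) (hgamma : 0 < gamma <= 1)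
    (disp0 : measure_display) (Omega0 : measurableType disp0)
    (P0 : probability Omega0 R) (X : 'rV[R]_d * R -> {RV P0 >-> R})
    (hX_gaussian : gaussian_field X) (hX_centered : centered_field X)
    (hX_stationary : stationary_field X) (hX_continuous : ae_continuous X)
    (hX_cov : forall (x y : 'rV[R]_d) (t s : R),
      ('E_P0[X (x + y, t + s)%R \* X (y, s)%R] =
       (space_time_cov sigma a c alpha beta gamma x t)%:E)%E)
    (p : nat) (hp : (1 <= p)%N)
    (disp : measure_display) (Omega : measurableType disp)
    (P : probability Omega R) (Xs : 'I_p -> 'rV[R]_d * R -> {RV P >-> R})
    (hXs : independent_copies X Xs)
    (hXs_continuous : forall j, ae_continuous (Xs j)) :
  (alpha^-1 + d%:R / gamma < p%:R ->
    forall z : 'rV[R]_p, {ae P, forall w, level_set Xs z w = set0}) /\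
  (p%:R < alpha^-1 + d%:R / gamma ->
    (alpha <= gamma -> forall z : 'rV[R]_p,
      positive_probability P [set w |
        hausdorff_dim (@euclid_dist R d) (level_set Xs z w) =
        (if p%:R < alpha^-1 then d%:R + 1 - alpha * p%:R
         else d%:R + gamma / alpha - gamma * p%:R)%:E]) /\
    (gamma <= alpha -> forall z : 'rV[R]_p,
      positive_probability P [set w |
        hausdorff_dim (@euclid_dist R d) (level_set Xs z w) =
        (if p%:R < d%:R / gamma then d%:R + 1 - gamma * p%:R
         else d%:R * alpha / gamma + 1 - alpha * p%:R)%:E])).
Proof.
have [copies indep] := hXs.
have law j := same_fdd_pair_law (copies j)
  (centered_gaussian_pair_law ha halpha hgamma hX_gaussian hX_centered hX_cov).
have [K K0 tail] := increment_tail ha hc hbeta hgamma law.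
have [alpha0 alpha1] := andP halpha; have [gamma0 gamma1] := andP hgamma.
have d0 : 0 < (d%:R : R) by rewrite ltr0n.
have A0 : 0 < alpha^-1 by rewrite invr_gt0.
have B0 : 0 < gamma^-1 by rewrite invr_gt0.
split=> [pbig z|psmall].
  have [K3 K30 hit_le] := hit_prob_le hsigma ha hc hbeta z law indep.
  exact: (level_set_empty hp halpha hgamma K0 K30 tail hit_le hXs_continuous pbig).
have aA : 1 <= alpha * alpha^-1 by rewrite mulfV ?gt_eqF.
have gB : 1 <= gamma * gamma^-1 by rewrite mulfV ?gt_eqF.
have dim z (A B s : R) : 0 < A -> 0 < B -> 0 < s -> 1 <= alpha * A -> 1 <= gamma * B ->
    A + d%:R * B - p%:R = Num.min A B * s ->
    (forall t, 0 < t < s -> subcritical d p alpha gamma t) ->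
    positive_probability P [set w |
      hausdorff_dim (@euclid_dist R d) (level_set Xs z w) = s%:E].
  have [K3 K30 hit_le] := hit_prob_le hsigma ha hc hbeta z law indep.
  have [K1 K10 hit_ge] := hit_prob_ge hsigma z law indep.
  have [K2 K20 two_hits] := two_hits_prob_le hsigma ha hc halpha hbeta hgamma z law indep.
  exact: (level_set_dim hp halpha hgamma K0 K10 K20 K30 tail hit_ge two_hits hit_le
    hXs_continuous).
split=> ag z.
  have BA : gamma^-1 <= alpha^-1 by rewrite lef_pV2.
  have [pa|ap] := ltP p%:R alpha^-1.
    have ap1 : alpha * p%:R < 1 by rewrite mulrC -ltr_pdivlMr// div1r.
    (* Cubes of side [r^(1 / alpha)], the shorter of the two natural sides: since [p < 1 / alpha],
       the smaller diameter outweighs the larger number of cells. *)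
    apply: (dim z alpha^-1 alpha^-1) => //.
    - have : 1 <= (d%:R : R) by rewrite ler1n.
      lra.
    - by rewrite ler_pdivlMr// mul1r.
    - by rewrite minxx; field; rewrite gt_eqF.
    - by move=> t; exact: subcritical_time.
  have ap1 : 1 <= alpha * p%:R by rewrite mulrC -ler_pdivrMr// div1r.
  have sE : d%:R + gamma / alpha - gamma * p%:R = gamma * (alpha^-1 + d%:R / gamma - p%:R).
    by field; rewrite !gt_eqF.
  (* For [p >= 1 / alpha] the natural anisotropic cells are kept, and their diameter is governed by
     the longer side [r^(1 / gamma)]. *)
  apply: (dim z alpha^-1 gamma^-1) => //.
  - by rewrite sE mulr_gt0// subr_gt0.
  - by rewrite (min_idPr BA) sE mulrA mulVf ?gt_eqF// mul1r.
  - by move=> t; exact: subcritical_mixed_space.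
have AB : alpha^-1 <= gamma^-1 by rewrite lef_pV2.
have [pg|gp] := ltP p%:R (d%:R / gamma).
  have gp1 : gamma * p%:R < d%:R by rewrite mulrC -ltr_pdivlMr.
  (* Roles of time and space exchanged: cubes of side [r^(1 / gamma)], now the shorter one. *)
  apply: (dim z gamma^-1 gamma^-1) => //.
  - lra.
  - by rewrite ler_pdivlMr// mul1r.
  - by rewrite minxx; field; rewrite gt_eqF.
  - by move=> t; exact: subcritical_space.
have gp1 : d%:R <= gamma * p%:R by rewrite mulrC -ler_pdivrMr.
have sE : d%:R * alpha / gamma + 1 - alpha * p%:R = alpha * (alpha^-1 + d%:R / gamma - p%:R).
  by field; rewrite !gt_eqF.
(* Natural cells again, with longer side [r^(1 / alpha)]. *)
apply: (dim z alpha^-1 gamma^-1) => //.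
- by rewrite sE mulr_gt0// subr_gt0.
- by rewrite (min_idPl AB) sE mulrA mulVf ?gt_eqF// mul1r.
- by move=> t; exact: subcritical_mixed_time.
Qed.
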